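(* Let $\mathfrak g=\mathfrak{sl}(\infty)$, let $\mu=(\mu_1,\ldots,\mu_k)$ be a partition and let $\prec$ be an admissible partial order on $\mathbb Z_{>0}$. Then $S^\mu V$ is $\mathfrak p(\prec)$-aligned if and only if there are pairwise distinct elements $i_1,\ldots,i_k\in\mathbb Z_{>0}$, numbered so that $i_j\prec i_l$ implies $j<l$, with the following property: for every $m\in\mathbb Z_{>0}\setminus\{i_1,\ldots,i_k\}$, either $i_k\prec m$, or $m$ is not comparable with $i_j$ for some $j\in\{1,\ldots,k\}$.
   Context: The ground field is $\mathbb C$. $\mathfrak g=\mathfrak{sl}(\infty)=\varinjlim_n\mathfrak g_n$, $\mathfrak g_n=\mathfrak{sl}(n+1)$, is the Lie algebra of finitary traceless matrices with rows and columns indexed by $\mathbb Z_{>0}$; $\mathfrak h$ is its subalgebra of diagonal matrices, $E_{ij}$ ($i\ne j$) are the elementary matrices, spanning the root spaces of the roots $\varepsilon_i-\varepsilon_j$. Modules are weight modules with respect to $\mathfrak h$ with finite-dimensional weight spaces. Orders: for a (strict) partial order $\prec$ on a set $F$ put $[i]=\{i\}\cup\{j\in F: i,j \text{ not comparable}\}$. The order is admissible if $[i]\ne[j]$ implies $[i]\cap[j]=\emptyset$; then the sets $[i]$ partition $F$. Parabolic subalgebras: for an admissible $\prec$ on $\mathbb Z_{>0}$, $\mathfrak p(\prec)=\mathfrak l(\prec)\oplus\mathfrak u(\prec)$, where $\mathfrak u(\prec)$ is spanned by the $E_{ij}$ with $i\prec j$, and $\mathfrak l(\prec)$ is spanned by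 $\mathfrak h$ and the $E_{ij}$ with $i\ne j$, $[i]=[j]$. Aligned modules: for a parabolic subalgebra $\mathfrak p=\mathfrak l\oplus\mathfrak u$ and a simple weight $\mathfrak l$-module $S$ on which $\mathfrak u$ is made to act by zero, let $M_{\mathfrak p}(S)=\mathbf U(\mathfrak g)\otimes_{\mathbf U(\mathfrak p)}S$. A simple weight $\mathfrak g$-module is $\mathfrak p$-aligned if it is isomorphic to the unique simple quotient of $M_{\mathfrak p}(S)$ for some simple weight $\mathfrak l$-module $S$. The modules $S^\mu V$: a partition is a tuple $\mu=(\mu_1,\dots,\mu_k)$ of positive integers with $\mu_i\ge\mu_{i+1}$. Let $\mathfrak b$ be the Borel subalgebra of upper triangular matrices (corresponding to the usual order on $\mathbb Z_{>0}$), $\mathfrak b_n=\mathfrak b\cap\mathfrak g_n$. For $n\gg0$ identify $\mu$ with the weight $(\mu_1,\ldots,\mu_k,0,\ldots,0)$ of $\mathfrak g_n$ and let $L_{\mathfrak b_n}(\mu)$ be the simple $\mathfrak g_n$-module with $\mathfrak b_n$-highest weight $\mu$. There is a unique (up to scalar) embedding of $\mathfrak g_n$-modules $L_{\mathfrak b_n}(\mu)\hookrightarrow L_{\mathfrak b_{n+1}}(\mu)$, and $S^\mu V:=\varinjlim_nL_{\mathfrak b_n}(\mu)\cong L_{\mathfrak b}(\mu)$. *)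

(* Defs.v *)
From HB Require Import structures.
From mathcomp Require Export all_boot all_order all_algebra.
From mathcomp Require Export reals complex.
From mathcomp Require Import generic_quotient ring.
From mathcomp Require Import boolp classical_sets cardinality fsbigop.

Set Implicit Arguments.
Unset Strict Implicit.
Unset Printing Implicit Defensive.

Import GRing.Theory.

Local Open Scope quotient_scope.
Local Open Scope ring_scope.

Section Subspaces.
Variables (K : fieldType) (V : lmodType K).
Local Open Scope classical_set_scope.

Definition subspace (N : set V) : Prop :=
  N 0 /\ forall a u v, N u -> N v -> N (a *: u + v).

Definition lspan (A : set V) : set V := smallest subspace A.

Definition finite_dim (N : set V) : Prop :=
  exists s : seq V, N = lspan [set` s].

Lemma subspace_lspan (A : set V) : subspace (lspan A).
Proof.
split=> [N [[]] //|a u v Au Av N NA].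
by case: (NA) => -[_ NP] _; apply: NP; [apply: Au|apply: Av].
Qed.

Lemma sub_lspan (A : set V) : A `<=` lspan A.
Proof. exact: sub_smallest. Qed.

Lemma lspan_sub (A N : set V) : subspace N -> A `<=` N -> lspan A `<=` N.
Proof. by move=> sN AN v; apply. Qed.

End Subspaces.

HB.mixin Record isLieAlgebra (K : fieldType) L of GRing.Lmodule K L := {
  lie : L -> L -> L;
  lie_linearl : forall a x y z, lie (a *: x + y) z = a *: lie x z + lie y z;
  lie_linearr : forall a x y z, lie z (a *: x + y) = a *: lie z x + lie z y;
  liexx : forall x, lie x x = 0;
  lie_jacobi : forall x y z,
    lie x (lie y z) + lie y (lie z x) + lie z (lie x y) = 0
}.

#[short(type="lieAlgType")]
HB.structure Definition LieAlgebra (K : fieldType) :=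
  {L of isLieAlgebra K L & GRing.Lmodule K L}.

Section LieTheory.
Variables (K : fieldType) (L : lieAlgType K).
Implicit Types x y z : L.

Lemma lie0l x : lie 0 x = 0.
Proof.
have := lie_linearl 1 (0 : L) 0 x; rewrite scaler0 addr0 scale1r.
by move/eqP; rewrite -subr_eq0 opprD addNKr oppr_eq0 => /eqP.
Qed.

Lemma lie0r x : lie x 0 = 0.
Proof.
have := lie_linearr 1 (0 : L) 0 x; rewrite scaler0 addr0 scale1r.
by move/eqP; rewrite -subr_eq0 opprD addNKr oppr_eq0 => /eqP.
Qed.

End LieTheory.

Record subalgebra (K : fieldType) (L : lieAlgType K) := Subalgebra {
  subalg_set : set L;
  subalg_subspace : subspace subalg_set;
  subalg_lie : forall x y, subalg_set x -> subalg_set y -> subalg_set (lie x y)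
}.

Record subalg_sort (K : fieldType) (L : lieAlgType K) (k : subalgebra L) :
  Type := SubalgElt { subalg_val : L; _ : subalg_val \in subalg_set k }.

Coercion subalg_sort : subalgebra >-> Sortclass.

Section SubalgebraType.
Variables (K : fieldType) (L : lieAlgType K) (k : subalgebra L).

HB.instance Definition _ := [isSub for @subalg_val K L k].
HB.instance Definition _ := [Choice of subalg_sort k by <:].

Lemma subalg_closed : GRing.subsemimod_closed (mem (subalg_set k)).
Proof.
case: (subalg_subspace k) => k0 kP; split; first split.
- by rewrite in_setE.
- by move=> u v; rewrite !in_setE => ku kv; rewrite -[u]scale1r; apply: kP.
- by move=> a v; rewrite !in_setE => kv; rewrite -[_ *: _]addr0; apply: kP.
Qed.

HB.instance Definition _ :=
  GRing.SubChoice_isSubLmodule.Build K L _ (subalg_sort k) subalg_closed.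

Definition sub_lie (x y : k) : k :=
  SubalgElt
    (mem_set (subalg_lie (set_mem (valP x)) (set_mem (valP y)))).

Lemma sub_lie_linearl a x y z :
  sub_lie (a *: x + y) z = a *: sub_lie x z + sub_lie y z.
Proof. by apply: val_inj; rewrite /= lie_linearl. Qed.

Lemma sub_lie_linearr a x y z :
  sub_lie z (a *: x + y) = a *: sub_lie z x + sub_lie z y.
Proof. by apply: val_inj; rewrite /= lie_linearr. Qed.

Lemma sub_liexx x : sub_lie x x = 0.
Proof. by apply: val_inj; rewrite /= liexx. Qed.

Lemma sub_lie_jacobi x y z :
  sub_lie x (sub_lie y z) + sub_lie y (sub_lie z x) + sub_lie z (sub_lie x y) = 0.
Proof. by apply: val_inj; rewrite /= lie_jacobi. Qed.

HB.instance Definition _ := isLieAlgebra.Build K (subalg_sort k)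
  sub_lie_linearl sub_lie_linearr sub_liexx sub_lie_jacobi.

Lemma sub_in_subspace (j : subalgebra L) :
  subspace [set x : k | subalg_set j (val x)].
Proof.
by case: (subalg_subspace j) => j0 jP; split => //= a u v ju jv; apply: jP.
Qed.

Lemma sub_in_lie (j : subalgebra L) (x y : k) :
  subalg_set j (val x) -> subalg_set j (val y) -> subalg_set j (val (lie x y)).
Proof. exact: subalg_lie. Qed.

(* the subalgebra k `&` j, seen inside k *)
Definition sub_in (j : subalgebra L) : subalgebra k :=
  Subalgebra (sub_in_subspace j) (@sub_in_lie j).

End SubalgebraType.

Section SpanSubalgebra.
Variables (K : fieldType) (L : lieAlgType K) (A : set L).
Local Open Scope classical_set_scope.

Lemma lspan_lie : (forall x y, A x -> A y -> lspan A (lie x y)) ->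
  forall x y, lspan A x -> lspan A y -> lspan A (lie x y).
Proof.
move=> AA x y Ax Ay; have [s0 sP] := subspace_lspan A.
suff : lspan A `<=` [set x | lspan A (lie x y)] by apply.
apply: lspan_sub => [|{Ax}x Ax].
  split=> [|a u v /= Au Av]; first by rewrite /= lie0l.
  by rewrite lie_linearl; apply: sP.
suff : lspan A `<=` [set y | lspan A (lie x y)] by apply.
apply: lspan_sub => [|{Ay}y Ay]; last exact: AA.
split=> [|a u v /= Au Av]; first by rewrite /= lie0r.
by rewrite lie_linearr; apply: sP.
Qed.

Definition span_subalgebra
    (AA : forall x y, A x -> A y -> lspan A (lie x y)) : subalgebra L :=
  Subalgebra (subspace_lspan A) (lspan_lie AA).

End SpanSubalgebra.

Record lieRep (K : fieldType) (L : lieAlgType K) (V : lmodType K) := LieRep {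
  rep_act :> L -> V -> V;
  rep_linearl : forall a x y v,
    rep_act (a *: x + y) v = a *: rep_act x v + rep_act y v;
  rep_linearr : forall x a u v,
    rep_act x (a *: u + v) = a *: rep_act x u + rep_act x v;
  rep_lie : forall x y v,
    rep_act (lie x y) v = rep_act x (rep_act y v) - rep_act y (rep_act x v)
}.

Section Representations.
Variables (K : fieldType) (L : lieAlgType K).
Local Open Scope classical_set_scope.

Definition submodule (V : lmodType K) (rho : lieRep L V) (N : set V) : Prop :=
  subspace N /\ forall x v, N v -> N (rho x v).

Definition maximal_submodule (V : lmodType K) (rho : lieRep L V) (N : set V) :=
  [/\ submodule rho N, N <> setT &
      forall N', submodule rho N' -> N `<=` N' -> N' = N \/ N' = setT].

Definition simple_module (V : lmodType K) (rho : lieRep L V) : Prop :=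
  (exists v : V, v != 0) /\
  forall N, submodule rho N -> N = [set 0] \/ N = setT.

Definition equivariant (V W : lmodType K) (rho : lieRep L V)
    (sigma : lieRep L W) (f : V -> W) : Prop :=
  forall x v, f (rho x v) = sigma x (f v).

(* sigma is isomorphic to the quotient of rho by ker f, and ker f is the only
   maximal submodule of rho *)
Definition is_unique_simple_quotient (V W : lmodType K) (rho : lieRep L V)
    (sigma : lieRep L W) : Prop :=
  exists f : {linear V -> W},
    [/\ equivariant rho sigma f, range f = setT,
        maximal_submodule rho (f @^-1` [set 0]) &
        forall N, maximal_submodule rho N -> N = f @^-1` [set 0]].

Definition weight_space (H : subalgebra L) (V : lmodType K) (rho : lieRep L V)
    (lambda : {scalar H}) : set V :=
  [set v | forall x : H, rho (val x) v = lambda x *: v].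

Arguments weight_space H {V} rho lambda.

Definition weight_module (H : subalgebra L) (V : lmodType K)
    (rho : lieRep L V) : Prop :=
  lspan (\bigcup_lambda weight_space H rho lambda) = setT /\
  forall lambda : {scalar H}, finite_dim (weight_space H rho lambda).

End Representations.

Section EnvelopingAlgebra.
Variables (K : fieldType) (L : lieAlgType K).

Inductive uterm : Type :=
  | UGen of L
  | UZero
  | UOne
  | UOpp of uterm
  | UScale of K & uterm
  | UAdd of uterm & uterm
  | UMul of uterm & uterm.

Inductive ucong : uterm -> uterm -> Prop :=
  | ucong_refl t : ucong t t
  | ucong_sym t u : ucong t u -> ucong u t
  | ucong_trans t u w : ucong t u -> ucong u w -> ucong t w
  | ucong_opp t t' : ucong t t' -> ucong (UOpp t) (UOpp t')
  | ucong_scale a t t' : ucong t t' -> ucong (UScale a t) (UScale a t')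
  | ucong_add t t' u u' :
      ucong t t' -> ucong u u' -> ucong (UAdd t u) (UAdd t' u')
  | ucong_mul t t' u u' :
      ucong t t' -> ucong u u' -> ucong (UMul t u) (UMul t' u')
  | ucong_addA t u w : ucong (UAdd t (UAdd u w)) (UAdd (UAdd t u) w)
  | ucong_addC t u : ucong (UAdd t u) (UAdd u t)
  | ucong_add0 t : ucong (UAdd UZero t) t
  | ucong_addN t : ucong (UAdd (UOpp t) t) UZero
  | ucong_scaleA a b t : ucong (UScale a (UScale b t)) (UScale (a * b) t)
  | ucong_scale1 t : ucong (UScale 1 t) t
  | ucong_scaleDr a t u :
      ucong (UScale a (UAdd t u)) (UAdd (UScale a t) (UScale a u))
  | ucong_scaleDl a b t :
      ucong (UScale (a + b) t) (UAdd (UScale a t) (UScale b t))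
  | ucong_mulA t u w : ucong (UMul t (UMul u w)) (UMul (UMul t u) w)
  | ucong_mul1l t : ucong (UMul UOne t) t
  | ucong_mul1r t : ucong (UMul t UOne) t
  | ucong_mulDl t u w : ucong (UMul (UAdd t u) w) (UAdd (UMul t w) (UMul u w))
  | ucong_mulDr t u w : ucong (UMul t (UAdd u w)) (UAdd (UMul t u) (UMul t w))
  | ucong_scaleAl a t u : ucong (UScale a (UMul t u)) (UMul (UScale a t) u)
  | ucong_scaleAr a t u : ucong (UScale a (UMul t u)) (UMul t (UScale a u))
  | ucong_gen_linear a x y :
      ucong (UGen (a *: x + y)) (UAdd (UScale a (UGen x)) (UGen y))
  | ucong_gen_lie x y :
      ucong (UGen (lie x y))
        (UAdd (UMul (UGen x) (UGen y)) (UOpp (UMul (UGen y) (UGen x)))).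

HB.instance Definition _ := gen_eqMixin uterm.
HB.instance Definition _ := gen_choiceMixin uterm.

Lemma ucong_equiv : equiv_class_of (fun t u => `[< ucong t u >]).
Proof.
split=> [t|t u|t u w]; first exact/asboolP/ucong_refl.
- by apply/asboolP/asboolP; apply: ucong_sym.
- by move=> /asboolP ut /asboolP uw; apply/asboolP; apply: ucong_trans ut uw.
Qed.

Canonical ucong_equivRel := EquivRelPack ucong_equiv.

(* U(L), by generators and relations: the free unital associative K-algebra on
   the symbols UGen x, x \in L, modulo the linearity of UGen and
   UGen [x, y] = UGen x * UGen y - UGen y * UGen x *)
Definition uea : Type := {eq_quot ucong_equivRel}.

HB.instance Definition _ := Choice.on uea.
HB.instance Definition _ := EqQuotient.on uea.

Lemma ueaP t u : reflect (ucong t u) (\pi_uea t == \pi_uea u).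
Proof. by rewrite eqmodE; apply: asboolP. Qed.

Lemma uea_eq t u : ucong t u -> \pi_uea t = \pi_uea u.
Proof. by move/ueaP/eqP. Qed.

Lemma ucong_repr t : ucong (repr (\pi_uea t)) t.
Proof. by apply/ueaP; rewrite reprK. Qed.

Definition uea_add := locked (fun p q : uea => \pi_uea (UAdd (repr p) (repr q))).
Definition uea_mul := locked (fun p q : uea => \pi_uea (UMul (repr p) (repr q))).
Definition uea_opp := locked (fun p : uea => \pi_uea (UOpp (repr p))).
Definition uea_scale :=
  locked (fun (a : K) (p : uea) => \pi_uea (UScale a (repr p))).

Lemma uea_addE t u : uea_add (\pi_uea t) (\pi_uea u) = \pi_uea (UAdd t u).
Proof. by rewrite /uea_add -lock; apply: uea_eq; apply: ucong_add; apply: ucong_repr. Qed.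
Lemma uea_mulE t u : uea_mul (\pi_uea t) (\pi_uea u) = \pi_uea (UMul t u).
Proof. by rewrite /uea_mul -lock; apply: uea_eq; apply: ucong_mul; apply: ucong_repr. Qed.
Lemma uea_oppE t : uea_opp (\pi_uea t) = \pi_uea (UOpp t).
Proof. by rewrite /uea_opp -lock; apply: uea_eq; apply: ucong_opp; apply: ucong_repr. Qed.
Lemma uea_scaleE a t : uea_scale a (\pi_uea t) = \pi_uea (UScale a t).
Proof. by rewrite /uea_scale -lock; apply: uea_eq; apply: ucong_scale; apply: ucong_repr. Qed.

Definition ueaE := (uea_addE, uea_mulE, uea_oppE, uea_scaleE).

Lemma uea_addA : associative uea_add.
Proof.
elim/quotW=> p; elim/quotW=> q; elim/quotW=> r.
by rewrite !ueaE; apply/uea_eq/ucong_addA.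
Qed.
Lemma uea_addC : commutative uea_add.
Proof.
by elim/quotW=> p; elim/quotW=> q; rewrite !ueaE; apply/uea_eq/ucong_addC.
Qed.
Lemma uea_add0 : left_id (\pi_uea UZero) uea_add.
Proof. by elim/quotW=> p; rewrite !ueaE; apply/uea_eq/ucong_add0. Qed.
Lemma uea_addN : left_inverse (\pi_uea UZero) uea_opp uea_add.
Proof. by elim/quotW=> p; rewrite !ueaE; apply/uea_eq/ucong_addN. Qed.

HB.instance Definition _ :=
  GRing.isZmodule.Build uea uea_addA uea_addC uea_add0 uea_addN.

Lemma uea_scaleA a b p : uea_scale a (uea_scale b p) = uea_scale (a * b) p.
Proof. by elim/quotW: p => p; rewrite !ueaE; apply/uea_eq/ucong_scaleA. Qed.
Lemma uea_scale1 : left_id 1 uea_scale.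
Proof. by elim/quotW=> p; rewrite !ueaE; apply/uea_eq/ucong_scale1. Qed.
Lemma uea_scaleDr : right_distributive uea_scale uea_add.
Proof.
move=> a; elim/quotW=> p; elim/quotW=> q.
by rewrite !ueaE; apply/uea_eq/ucong_scaleDr.
Qed.
Lemma uea_scaleDl p : {morph uea_scale^~ p : a b / a + b >-> uea_add a b}.
Proof.
by move=> a b; elim/quotW: p => p; rewrite !ueaE; apply/uea_eq/ucong_scaleDl.
Qed.

HB.instance Definition _ := GRing.Zmodule_isLmodule.Build K uea
  uea_scaleA uea_scale1 uea_scaleDr uea_scaleDl.

Lemma uea_mulA : associative uea_mul.
Proof.
elim/quotW=> p; elim/quotW=> q; elim/quotW=> r.
by rewrite !ueaE; apply/uea_eq/ucong_mulA.
Qed.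
Lemma uea_mul1l : left_id (\pi_uea UOne) uea_mul.
Proof. by elim/quotW=> p; rewrite !ueaE; apply/uea_eq/ucong_mul1l. Qed.
Lemma uea_mul1r : right_id (\pi_uea UOne) uea_mul.
Proof. by elim/quotW=> p; rewrite !ueaE; apply/uea_eq/ucong_mul1r. Qed.
Lemma uea_mulDl : left_distributive uea_mul uea_add.
Proof.
elim/quotW=> p; elim/quotW=> q; elim/quotW=> r.
by rewrite !ueaE; apply/uea_eq/ucong_mulDl.
Qed.
Lemma uea_mulDr : right_distributive uea_mul uea_add.
Proof.
elim/quotW=> p; elim/quotW=> q; elim/quotW=> r.
by rewrite !ueaE; apply/uea_eq/ucong_mulDr.
Qed.

Fixpoint uterm_aug (t : uterm) : K :=
  match t with
  | UGen _ | UZero => 0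
  | UOne => 1
  | UOpp u => - uterm_aug u
  | UScale a u => a * uterm_aug u
  | UAdd u w => uterm_aug u + uterm_aug w
  | UMul u w => uterm_aug u * uterm_aug w
  end.

Lemma uterm_aug_cong t u : ucong t u -> uterm_aug t = uterm_aug u.
Proof.
elim=> //= *; first [congruence | by rewrite ?addrA | by rewrite addrC |
  by rewrite add0r | by rewrite addNr | by rewrite mulrA | by rewrite mul1r |
  by rewrite mulr1 | by rewrite mulrDr | by rewrite mulrDl |
  by rewrite mulrCA | by rewrite !(mulr0, addr0, oppr0)].
Qed.

Lemma uea_1_neq0 : \pi_uea UOne != 0.
Proof. by apply/ueaP => /uterm_aug_cong /= /eqP; rewrite oner_eq0. Qed.

HB.instance Definition _ := GRing.Zmodule_isNzRing.Build uea
  uea_mulA uea_mul1l uea_mul1r uea_mulDl uea_mulDr uea_1_neq0.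

Lemma uea_scaleAl (a : K) (p q : uea) : a *: (p * q) = (a *: p) * q.
Proof.
elim/quotW: p => p; elim/quotW: q => q.
by rewrite /GRing.mul /GRing.scale /= !ueaE; apply/uea_eq/ucong_scaleAl.
Qed.

HB.instance Definition _ := GRing.Lmodule_isLalgebra.Build K uea uea_scaleAl.

Lemma uea_scaleAr (a : K) (p q : uea) : a *: (p * q) = p * (a *: q).
Proof.
elim/quotW: p => p; elim/quotW: q => q.
by rewrite /GRing.mul /GRing.scale /= !ueaE; apply/uea_eq/ucong_scaleAr.
Qed.

HB.instance Definition _ := GRing.Lalgebra_isAlgebra.Build K uea uea_scaleAr.

Definition uea_gen (x : L) : uea := \pi_uea (UGen x).

Lemma uea_gen_linear a x y : uea_gen (a *: x + y) = a *: uea_gen x + uea_gen y.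
Proof.
rewrite -[RHS]/(uea_add (uea_scale a (uea_gen x)) (uea_gen y)) /uea_gen !ueaE.
exact/uea_eq/ucong_gen_linear.
Qed.

Lemma uea_gen_lie x y :
  uea_gen (lie x y) = uea_gen x * uea_gen y - uea_gen y * uea_gen x.
Proof.
rewrite -[RHS]/(uea_add (uea_mul (uea_gen x) (uea_gen y))
  (uea_opp (uea_mul (uea_gen y) (uea_gen x)))) /uea_gen !ueaE.
exact/uea_eq/ucong_gen_lie.
Qed.

End EnvelopingAlgebra.

Section EnvelopingAction.
Variables (K : fieldType) (L : lieAlgType K) (V : lmodType K).
Variable rho : lieRep L V.

Fixpoint uterm_act (t : uterm L) (v : V) : V :=
  match t with
  | UGen x => rho x v
  | UZero => 0
  | UOne => v
  | UOpp u => - uterm_act u v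
  | UScale a u => a *: uterm_act u v
  | UAdd u w => uterm_act u v + uterm_act w v
  | UMul u w => uterm_act u (uterm_act w v)
  end.

Lemma uterm_act_linear t a u v :
  uterm_act t (a *: u + v) = a *: uterm_act t u + uterm_act t v.
Proof.
elim: t u v => [x|||t IHt|b t IHt|t IHt w IHw|t IHt w IHw] u v /=.
- exact: rep_linearr.
- by rewrite scaler0 addr0.
- by [].
- by rewrite IHt opprD scalerN.
- by rewrite IHt scalerDr !scalerA mulrC.
- by rewrite IHt IHw scalerDr addrACA.
- by rewrite IHw IHt.
Qed.

Lemma uterm_actD t u v : uterm_act t (u + v) = uterm_act t u + uterm_act t v.
Proof. by rewrite -[u]scale1r uterm_act_linear !scale1r. Qed.

Lemma uterm_act0 t : uterm_act t 0 = 0.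
Proof. by apply: (addIr (uterm_act t 0)); rewrite -uterm_actD !add0r. Qed.

Lemma uterm_actZ t a u : uterm_act t (a *: u) = a *: uterm_act t u.
Proof. by rewrite -[a *: u]addr0 uterm_act_linear uterm_act0 addr0. Qed.

Lemma uterm_act_cong t u : ucong t u -> uterm_act t =1 uterm_act u.
Proof.
move=> tu v; elim: tu v => //= {t u}.
- by move=> t u w _ IH1 _ IH2 v; rewrite IH1 IH2.
- by move=> t u _ IH v; rewrite IH.
- by move=> a t u _ IH v; rewrite IH.
- by move=> t t' u u' _ IH1 _ IH2 v; rewrite IH1 IH2.
- by move=> t t' u u' _ IH1 _ IH2 v; rewrite IH2 IH1.
- by move=> *; rewrite addrA.
- by move=> *; rewrite addrC.
- by move=> *; rewrite add0r.
- by move=> *; rewrite addNr.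
- by move=> *; rewrite scalerA.
- by move=> *; rewrite scale1r.
- by move=> *; rewrite scalerDr.
- by move=> *; rewrite scalerDl.
- by move=> *; rewrite uterm_actD.
- by move=> *; rewrite uterm_actZ.
- by move=> *; rewrite rep_linearl.
- by move=> *; rewrite rep_lie.
Qed.

Definition uea_act (p : uea L) (v : V) : V := uterm_act (repr p) v.

Lemma uea_actE t v : uea_act (\pi_(uea L) t) v = uterm_act t v.
Proof. exact/uterm_act_cong/ucong_repr. Qed.

End EnvelopingAction.

Section EnvelopingInclusion.
Variables (K : fieldType) (L : lieAlgType K) (k : subalgebra L).

Fixpoint uterm_map (t : uterm k) : uea L :=
  match t with
  | UGen x => uea_gen (val x)
  | UZero => 0
  | UOne => 1
  | UOpp u => - uterm_map u
  | UScale a u => a *: uterm_map u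
  | UAdd u w => uterm_map u + uterm_map w
  | UMul u w => uterm_map u * uterm_map w
  end.

Lemma uterm_map_cong t u : ucong t u -> uterm_map t = uterm_map u.
Proof.
elim=> //= {t u}; try by move=> *; congruence.
- by move=> *; rewrite addrA.
- by move=> *; rewrite addrC.
- by move=> *; rewrite add0r.
- by move=> *; rewrite addNr.
- by move=> *; rewrite scalerA.
- by move=> *; rewrite scale1r.
- by move=> *; rewrite scalerDr.
- by move=> *; rewrite scalerDl.
- by move=> *; rewrite mulrA.
- by move=> *; rewrite mul1r.
- by move=> *; rewrite mulr1.
- by move=> *; rewrite mulrDl.
- by move=> *; rewrite mulrDr.
- by move=> *; rewrite scalerAl.
- by move=> *; rewrite scalerAr.
- by move=> a x y; apply: uea_gen_linear.
- by move=> x y; apply: uea_gen_lie.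
Qed.

(* the algebra morphism U(k) -> U(L) induced by the inclusion of k in L *)
Definition uea_map (p : uea k) : uea L := uterm_map (repr p).

Lemma uea_mapE t : uea_map (\pi_(uea k) t) = uterm_map t.
Proof. exact/uterm_map_cong/ucong_repr. Qed.

End EnvelopingInclusion.

Section TensorProduct.
Variables (K : fieldType) (A : Type) (M S : lmodType K).
Variables (ra : M -> A -> M) (la : A -> S -> S).

Inductive tterm : Type :=
  | TPure of M & S
  | TZero
  | TOpp of tterm
  | TScale of K & tterm
  | TAdd of tterm & tterm.

Inductive tcong : tterm -> tterm -> Prop :=
  | tcong_refl t : tcong t t
  | tcong_sym t u : tcong t u -> tcong u t
  | tcong_trans t u w : tcong t u -> tcong u w -> tcong t w
  | tcong_opp t t' : tcong t t' -> tcong (TOpp t) (TOpp t')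
  | tcong_scale a t t' : tcong t t' -> tcong (TScale a t) (TScale a t')
  | tcong_add t t' u u' :
      tcong t t' -> tcong u u' -> tcong (TAdd t u) (TAdd t' u')
  | tcong_addA t u w : tcong (TAdd t (TAdd u w)) (TAdd (TAdd t u) w)
  | tcong_addC t u : tcong (TAdd t u) (TAdd u t)
  | tcong_add0 t : tcong (TAdd TZero t) t
  | tcong_addN t : tcong (TAdd (TOpp t) t) TZero
  | tcong_scaleA a b t : tcong (TScale a (TScale b t)) (TScale (a * b) t)
  | tcong_scale1 t : tcong (TScale 1 t) t
  | tcong_scaleDr a t u :
      tcong (TScale a (TAdd t u)) (TAdd (TScale a t) (TScale a u))
  | tcong_scaleDl a b t :
      tcong (TScale (a + b) t) (TAdd (TScale a t) (TScale b t))
  | tcong_linearl a m m' s :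
      tcong (TPure (a *: m + m') s) (TAdd (TScale a (TPure m s)) (TPure m' s))
  | tcong_linearr a m s s' :
      tcong (TPure m (a *: s + s')) (TAdd (TScale a (TPure m s)) (TPure m s'))
  | tcong_balanced m p s : tcong (TPure (ra m p) s) (TPure m (la p s)).

HB.instance Definition _ := gen_eqMixin tterm.
HB.instance Definition _ := gen_choiceMixin tterm.

Lemma tcong_equiv : equiv_class_of (fun t u => `[< tcong t u >]).
Proof.
split=> [t|t u|t u w]; first exact/asboolP/tcong_refl.
- by apply/asboolP/asboolP; apply: tcong_sym.
- by move=> /asboolP ut /asboolP uw; apply/asboolP; apply: tcong_trans ut uw.
Qed.

Canonical tcong_equivRel := EquivRelPack tcong_equiv.

(* M (x)_A S, for a right action ra of A on M and a left action la of A on S *)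
Definition tensor : Type := {eq_quot tcong_equivRel}.

HB.instance Definition _ := Choice.on tensor.
HB.instance Definition _ := EqQuotient.on tensor.

Lemma tensorP t u : reflect (tcong t u) (\pi_tensor t == \pi_tensor u).
Proof. by rewrite eqmodE; apply: asboolP. Qed.

Lemma tensor_eq t u : tcong t u -> \pi_tensor t = \pi_tensor u.
Proof. by move/tensorP/eqP. Qed.

Lemma tcong_repr t : tcong (repr (\pi_tensor t)) t.
Proof. by apply/tensorP; rewrite reprK. Qed.

Definition tensor_add :=
  locked (fun p q : tensor => \pi_tensor (TAdd (repr p) (repr q))).
Definition tensor_opp := locked (fun p : tensor => \pi_tensor (TOpp (repr p))).
Definition tensor_scale :=
  locked (fun (a : K) (p : tensor) => \pi_tensor (TScale a (repr p))).

Lemma tensor_addE t u :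
  tensor_add (\pi_tensor t) (\pi_tensor u) = \pi_tensor (TAdd t u).
Proof.
by rewrite /tensor_add -lock; apply: tensor_eq; apply: tcong_add;
  apply: tcong_repr.
Qed.
Lemma tensor_oppE t : tensor_opp (\pi_tensor t) = \pi_tensor (TOpp t).
Proof.
by rewrite /tensor_opp -lock; apply: tensor_eq; apply: tcong_opp;
  apply: tcong_repr.
Qed.
Lemma tensor_scaleE a t : tensor_scale a (\pi_tensor t) = \pi_tensor (TScale a t).
Proof.
by rewrite /tensor_scale -lock; apply: tensor_eq; apply: tcong_scale;
  apply: tcong_repr.
Qed.

Definition tensorE := (tensor_addE, tensor_oppE, tensor_scaleE).

Lemma tensor_addA : associative tensor_add.
Proof.
elim/quotW=> p; elim/quotW=> q; elim/quotW=> r.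
by rewrite !tensorE; apply/tensor_eq/tcong_addA.
Qed.
Lemma tensor_addC : commutative tensor_add.
Proof.
by elim/quotW=> p; elim/quotW=> q; rewrite !tensorE; apply/tensor_eq/tcong_addC.
Qed.
Lemma tensor_add0 : left_id (\pi_tensor TZero) tensor_add.
Proof. by elim/quotW=> p; rewrite !tensorE; apply/tensor_eq/tcong_add0. Qed.
Lemma tensor_addN : left_inverse (\pi_tensor TZero) tensor_opp tensor_add.
Proof. by elim/quotW=> p; rewrite !tensorE; apply/tensor_eq/tcong_addN. Qed.

HB.instance Definition _ := GRing.isZmodule.Build tensor
  tensor_addA tensor_addC tensor_add0 tensor_addN.

Lemma tensor_scaleA a b p :
  tensor_scale a (tensor_scale b p) = tensor_scale (a * b) p.
Proof. by elim/quotW: p => p; rewrite !tensorE; apply/tensor_eq/tcong_scaleA. Qed.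
Lemma tensor_scale1 : left_id 1 tensor_scale.
Proof. by elim/quotW=> p; rewrite !tensorE; apply/tensor_eq/tcong_scale1. Qed.
Lemma tensor_scaleDr : right_distributive tensor_scale tensor_add.
Proof.
move=> a; elim/quotW=> p; elim/quotW=> q.
by rewrite !tensorE; apply/tensor_eq/tcong_scaleDr.
Qed.
Lemma tensor_scaleDl p :
  {morph tensor_scale^~ p : a b / a + b >-> tensor_add a b}.
Proof.
move=> a b; elim/quotW: p => p.
by rewrite !tensorE; apply/tensor_eq/tcong_scaleDl.
Qed.

HB.instance Definition _ := GRing.Zmodule_isLmodule.Build K tensor
  tensor_scaleA tensor_scale1 tensor_scaleDr tensor_scaleDl.

Definition tpure (m : M) (s : S) : tensor := \pi_tensor (TPure m s).

Lemma tensor_piD t u : \pi_tensor (TAdd t u) = \pi_tensor t + \pi_tensor u.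
Proof. by rewrite -tensor_addE. Qed.
Lemma tensor_piN t : \pi_tensor (TOpp t) = - \pi_tensor t.
Proof. by rewrite -tensor_oppE. Qed.
Lemma tensor_piZ a t : \pi_tensor (TScale a t) = a *: \pi_tensor t.
Proof. by rewrite -tensor_scaleE. Qed.

Lemma tpure_linearl a m m' s :
  tpure (a *: m + m') s = a *: tpure m s + tpure m' s.
Proof.
by rewrite -tensor_piZ -tensor_piD; apply/tensor_eq/tcong_linearl.
Qed.

Lemma tpureBl m m' s : tpure (m - m') s = tpure m s - tpure m' s.
Proof. by rewrite addrC -scaleN1r tpure_linearl scaleN1r addrC. Qed.

Lemma tpure_linearr a m s s' :
  tpure m (a *: s + s') = a *: tpure m s + tpure m s'.
Proof.
by rewrite -tensor_piZ -tensor_piD; apply/tensor_eq/tcong_linearr.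
Qed.

Lemma tpure_balanced m p s : tpure (ra m p) s = tpure m (la p s).
Proof. exact/tensor_eq/tcong_balanced. Qed.

Lemma tensor_ind (P : tensor -> Prop) :
  (forall m s, P (tpure m s)) -> P 0 ->
  (forall a t u, P t -> P u -> P (a *: t + u)) -> forall t, P t.
Proof.
move=> Ppure P0 Plin; elim/quotW; elim=> [m s||t IHt|a t IHt|t IHt u IHu].
- exact: Ppure.
- exact: P0.
- by rewrite tensor_piN -scaleN1r -[_ *: _]addr0; apply: Plin.
- by rewrite tensor_piZ -[_ *: _]addr0; apply: Plin.
- by rewrite tensor_piD -[\pi_tensor t]scale1r; apply: Plin.
Qed.

End TensorProduct.

Section InducedModule.
Variables (K : fieldType) (L : lieAlgType K) (k : subalgebra L).
Variables (S : lmodType K) (tau : lieRep k S).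

(* M_k(S) = U(L) (x)_{U(k)} S *)
Definition induced : Type :=
  tensor (fun (u : uea L) (p : uea k) => u * uea_map p) (uea_act tau).

HB.instance Definition _ := GRing.Lmodule.on induced.

Fixpoint induced_term_act (x : L) (t : tterm (uea L) S) : induced :=
  match t with
  | TPure u s => tpure _ _ (uea_gen x * u) s
  | TZero => 0
  | TOpp t => - induced_term_act x t
  | TScale a t => a *: induced_term_act x t
  | TAdd t u => induced_term_act x t + induced_term_act x u
  end.

Lemma induced_term_act_cong x t u :
  tcong (fun (u : uea L) (p : uea k) => u * uea_map p) (uea_act tau) t u ->
  induced_term_act x t = induced_term_act x u.
Proof.
elim=> //= {t u}; try by move=> *; congruence.
- by move=> *; rewrite addrA.
- by move=> *; rewrite addrC.
- by move=> *; rewrite add0r.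
- by move=> *; rewrite addNr.
- by move=> *; rewrite scalerA.
- by move=> *; rewrite scale1r.
- by move=> *; rewrite scalerDr.
- by move=> *; rewrite scalerDl.
- by move=> *; rewrite mulrDr -scalerAr; apply: tpure_linearl.
- by move=> *; apply: tpure_linearr.
- by move=> m p s; rewrite mulrA; apply: tpure_balanced.
Qed.

Definition induced_act (x : L) (t : induced) : induced :=
  induced_term_act x (repr t).

Lemma induced_actE x t :
  induced_act x (\pi_induced t) = induced_term_act x t.
Proof. exact/induced_term_act_cong/tcong_repr. Qed.

Lemma induced_act_pure x u s :
  induced_act x (tpure _ _ u s) = tpure _ _ (uea_gen x * u) s.
Proof. exact: induced_actE. Qed.

Lemma induced_act_linearr x a t u :
  induced_act x (a *: t + u) = a *: induced_act x t + induced_act x u.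
Proof.
elim/quotW: t => t; elim/quotW: u => u.
by rewrite -tensor_piZ -tensor_piD !induced_actE.
Qed.

Lemma induced_act0 x : induced_act x 0 = 0.
Proof. exact: induced_actE. Qed.

Lemma induced_act_linearl a x y t :
  induced_act (a *: x + y) t = a *: induced_act x t + induced_act y t.
Proof.
elim/tensor_ind: t => [u s||b t u IHt IHu].
- rewrite !induced_act_pure uea_gen_linear mulrDl -scalerAl.
  exact: tpure_linearl.
- by rewrite !induced_act0 scaler0 addr0.
- rewrite !induced_act_linearr IHt IHu !scalerDr !scalerA mulrC.
  by rewrite addrACA.
Qed.

Lemma induced_act_lie x y t :
  induced_act (lie x y) t =
  induced_act x (induced_act y t) - induced_act y (induced_act x t).
Proof.
elim/tensor_ind: t => [u s||b t u IHt IHu].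
- rewrite !induced_act_pure uea_gen_lie mulrBl -!mulrA.
  exact: tpureBl.
- by rewrite !induced_act0 subr0.
- rewrite !induced_act_linearr IHt IHu scalerBr opprD.
  by rewrite addrACA.
Qed.

Definition induced_rep : lieRep L induced :=
  LieRep induced_act_linearl induced_act_linearr induced_act_lie.

End InducedModule.

Section FiniteSums.
Variable K : fieldType.
Local Open Scope classical_set_scope.

Lemma fsum_bound (f : nat -> K) N : (forall k, (N <= k)%N -> f k = 0) ->
  \sum_(k \in [set: nat]) f k = \sum_(0 <= k < N) f k.
Proof.
move=> f0; have r_uniq : uniq (index_iota 0 N) by apply: iota_uniq.
rewrite (fsbigE (index_iota 0 N)) //; last first.
  by move=> k _; rewrite mem_index_iota /= -leqNgt; apply: f0.
by apply: eq_bigl => k; rewrite in_setT.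
Qed.

Lemma fsum_single (f : nat -> K) k0 : (forall k, k != k0 -> f k = 0) ->
  \sum_(k \in [set: nat]) f k = f k0.
Proof.
move=> f0; rewrite (@fsum_bound f k0.+1) => [|k kk0]; last first.
  by apply: f0; rewrite gtn_eqF.
rewrite big_nat_recr //= big1_seq ?add0r // => k; rewrite mem_index_iota /=.
by move=> kk0; apply: f0; rewrite ltn_eqF.
Qed.

End FiniteSums.

Definition vanish_outside (K : fieldType) (N : nat) (A : nat -> nat -> K) : Prop :=
  forall i j, (N <= i)%N \/ (N <= j)%N -> A i j = 0.

(* finitary matrices; rows and columns are numbered from 0 instead of 1 *)
Record finmx (K : fieldType) := FinMx {
  finmx_fun :> nat -> nat -> K;
  finmxP : exists N, vanish_outside N finmx_fun
}.

Section FinitaryMatrices.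
Variable K : fieldType.
Local Open Scope classical_set_scope.
Implicit Types A B C : finmx K.

HB.instance Definition _ := gen_eqMixin (finmx K).
HB.instance Definition _ := gen_choiceMixin (finmx K).

Lemma finmx_eq A B : (forall i j, A i j = B i j) -> A = B.
Proof.
case: A B => [f fP] [g gP] /= fg.
have {}fg : f = g by apply/funext=> i; apply/funext=> j.
by case: _ / fg in gP *; congr FinMx; apply: Prop_irrelevance.
Qed.

Lemma vanish_outsideW N N' (f : nat -> nat -> K) :
  (N <= N')%N -> vanish_outside N f -> vanish_outside N' f.
Proof. by move=> NN' f0 i j ij; apply: f0; case: ij => /(leq_trans NN'); auto. Qed.

Lemma finmx_bound2 A B : exists N, vanish_outside N A /\ vanish_outside N B.
Proof.
have [[N AN] [M BM]] := (finmxP A, finmxP B); exists (maxn N M).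
by split; [apply: vanish_outsideW AN|apply: vanish_outsideW BM];
  rewrite ?leq_maxl ?leq_maxr.
Qed.

Lemma finmx_bound3 A B C : exists N,
  [/\ vanish_outside N A, vanish_outside N B & vanish_outside N C].
Proof.
have [[N [AN BN]] [M CM]] := (finmx_bound2 A B, finmxP C); exists (maxn N M).
by split; [apply: vanish_outsideW AN|apply: vanish_outsideW BN|
  apply: vanish_outsideW CM]; rewrite ?leq_maxl ?leq_maxr.
Qed.

Lemma finmx0_subproof : exists N, vanish_outside N (fun _ _ => 0 : K).
Proof. by exists 0%N. Qed.
Definition finmx0 := FinMx finmx0_subproof.

Lemma finmx_add_subproof A B :
  exists N, vanish_outside N (fun i j => A i j + B i j).
Proof.
by have [N [AN BN]] := finmx_bound2 A B; exists N => i j ij;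
  rewrite AN // BN // addr0.
Qed.
Definition finmx_add A B := FinMx (finmx_add_subproof A B).

Lemma finmx_opp_subproof A : exists N, vanish_outside N (fun i j => - A i j).
Proof. by have [N AN] := finmxP A; exists N => i j ij; rewrite AN // oppr0. Qed.
Definition finmx_opp A := FinMx (finmx_opp_subproof A).

Lemma finmx_scale_subproof a A :
  exists N, vanish_outside N (fun i j => a * A i j).
Proof. by have [N AN] := finmxP A; exists N => i j ij; rewrite AN // mulr0. Qed.
Definition finmx_scale a A := FinMx (finmx_scale_subproof a A).

Lemma finmx_addA : associative finmx_add.
Proof. by move=> A B C; apply: finmx_eq => i j /=; rewrite addrA. Qed.
Lemma finmx_addC : commutative finmx_add.
Proof. by move=> A B; apply: finmx_eq => i j /=; rewrite addrC. Qed.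
Lemma finmx_add0 : left_id finmx0 finmx_add.
Proof. by move=> A; apply: finmx_eq => i j /=; rewrite add0r. Qed.
Lemma finmx_addN : left_inverse finmx0 finmx_opp finmx_add.
Proof. by move=> A; apply: finmx_eq => i j /=; rewrite addNr. Qed.

HB.instance Definition _ := GRing.isZmodule.Build (finmx K)
  finmx_addA finmx_addC finmx_add0 finmx_addN.

Lemma finmx_scaleA a b A :
  finmx_scale a (finmx_scale b A) = finmx_scale (a * b) A.
Proof. by apply: finmx_eq => i j /=; rewrite mulrA. Qed.
Lemma finmx_scale1 : left_id 1 finmx_scale.
Proof. by move=> A; apply: finmx_eq => i j /=; rewrite mul1r. Qed.
Lemma finmx_scaleDr : right_distributive finmx_scale +%R.
Proof. by move=> a A B; apply: finmx_eq => i j /=; rewrite mulrDr. Qed.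
Lemma finmx_scaleDl A : {morph finmx_scale^~ A : a b / a + b}.
Proof. by move=> a b; apply: finmx_eq => i j /=; rewrite mulrDl. Qed.

HB.instance Definition _ := GRing.Zmodule_isLmodule.Build K (finmx K)
  finmx_scaleA finmx_scale1 finmx_scaleDr finmx_scaleDl.

Lemma finmx0E i j : (0 : finmx K) i j = 0. Proof. by []. Qed.
Lemma finmxDE A B i j : (A + B) i j = A i j + B i j. Proof. by []. Qed.
Lemma finmxNE A i j : (- A) i j = - A i j. Proof. by []. Qed.
Lemma finmxZE a A i j : (a *: A) i j = a * A i j. Proof. by []. Qed.
Definition finmxE := (finmx0E, finmxDE, finmxNE, finmxZE).

Lemma finmx_mul_subproof A B :
  exists N, vanish_outside N (fun i j => \sum_(k \in [set: nat]) A i k * B k j).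
Proof.
have [N [AN BN]] := finmx_bound2 A B; exists N => i j ij.
apply: fsbig1 => k _; case: ij => ij; first by rewrite AN ?mul0r //; left.
by rewrite BN ?mulr0 //; right.
Qed.
Definition finmx_mul A B := FinMx (finmx_mul_subproof A B).

Lemma finmx_mulE A B N i j : vanish_outside N A ->
  finmx_mul A B i j = \sum_(0 <= k < N) A i k * B k j.
Proof. by move=> AN; apply: fsum_bound => k Nk; rewrite AN ?mul0r //; right. Qed.

Lemma finmx_mulA : associative finmx_mul.
Proof.
move=> A B C; have [N [AN BN CN]] := finmx_bound3 A B C.
have ABN : vanish_outside N (finmx_mul A B).
  move=> i j ij; rewrite (finmx_mulE _ _ _ AN) big1 // => k _.
  case: ij => ij; first by rewrite AN ?mul0r //; left.
  by rewrite BN ?mulr0 //; right.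
apply: finmx_eq => i j; rewrite !(@finmx_mulE _ _ N) //.
under eq_bigr do rewrite (finmx_mulE _ _ _ BN) mulr_sumr.
under [RHS]eq_bigr do rewrite (finmx_mulE _ _ _ AN) mulr_suml.
rewrite exchange_big; apply: eq_bigr => k _; apply: eq_bigr => l _.
by rewrite mulrA.
Qed.

Lemma finmx_mul_linearl a A B C :
  finmx_mul (a *: A + B) C = a *: finmx_mul A C + finmx_mul B C.
Proof.
have [N [AN BN CN]] := finmx_bound3 A B C.
have ABN : vanish_outside N (a *: A + B).
  by move=> i j ij; rewrite !finmxE AN // BN // mulr0 addr0.
apply: finmx_eq => i j; rewrite !finmxE !(@finmx_mulE _ _ N) //.
rewrite mulr_sumr -big_split; apply: eq_bigr => k _ /=.
by rewrite mulrDl mulrA.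
Qed.

Lemma finmx_mul_linearr a A B C :
  finmx_mul C (a *: A + B) = a *: finmx_mul C A + finmx_mul C B.
Proof.
have [N CN] := finmxP C.
apply: finmx_eq => i j; rewrite !finmxE !(@finmx_mulE _ _ N) //.
rewrite mulr_sumr -big_split; apply: eq_bigr => k _ /=.
by rewrite mulrDr mulrCA.
Qed.

Lemma finmx_mulBl A B C : finmx_mul (A - B) C = finmx_mul A C - finmx_mul B C.
Proof. by rewrite addrC -scaleN1r finmx_mul_linearl scaleN1r addrC. Qed.

Lemma finmx_mulBr A B C : finmx_mul C (A - B) = finmx_mul C A - finmx_mul C B.
Proof. by rewrite addrC -scaleN1r finmx_mul_linearr scaleN1r addrC. Qed.

Definition finmx_lie A B : finmx K := finmx_mul A B - finmx_mul B A.

Lemma finmx_lie_linearl a A B C :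
  finmx_lie (a *: A + B) C = a *: finmx_lie A C + finmx_lie B C.
Proof.
rewrite /finmx_lie finmx_mul_linearl finmx_mul_linearr.
by rewrite scalerBr opprD addrACA.
Qed.

Lemma finmx_lie_linearr a A B C :
  finmx_lie C (a *: A + B) = a *: finmx_lie C A + finmx_lie C B.
Proof.
rewrite /finmx_lie finmx_mul_linearl finmx_mul_linearr.
by rewrite scalerBr opprD addrACA.
Qed.

Lemma finmx_liexx A : finmx_lie A A = 0.
Proof. exact: subrr. Qed.

Lemma finmx_jacobi A B C : finmx_lie A (finmx_lie B C) +
  finmx_lie B (finmx_lie C A) + finmx_lie C (finmx_lie A B) = 0.
Proof.
rewrite /finmx_lie !(finmx_mulBl, finmx_mulBr) !finmx_mulA.
by apply: finmx_eq => i j; rewrite !finmxE; ring.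
Qed.

HB.instance Definition _ := isLieAlgebra.Build K (finmx K)
  finmx_lie_linearl finmx_lie_linearr finmx_liexx finmx_jacobi.

Definition fintrace A : K := \sum_(i \in [set: nat]) A i i.

Lemma fintraceE A N : vanish_outside N A ->
  fintrace A = \sum_(0 <= i < N) A i i.
Proof. by move=> AN; apply: fsum_bound => i Ni; rewrite AN //; left. Qed.

Lemma fintrace_linear a A B : fintrace (a *: A + B) = a * fintrace A + fintrace B.
Proof.
have [N [AN BN]] := finmx_bound2 A B; rewrite !(@fintraceE _ N) //; last first.
  by move=> i j ij; rewrite !finmxE AN // BN // mulr0 addr0.
by rewrite mulr_sumr -big_split.
Qed.

Lemma fintrace_mulC A B : fintrace (finmx_mul A B) = fintrace (finmx_mul B A).
Proof.
have [N [AN BN]] := finmx_bound2 A B.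
have mulN (C D : finmx K) : vanish_outside N C -> vanish_outside N D ->
    vanish_outside N (finmx_mul C D).
  move=> CN DN i j ij; rewrite (finmx_mulE _ _ _ CN) big1 // => k _.
  case: ij => ij; first by rewrite CN ?mul0r //; left.
  by rewrite DN ?mulr0 //; right.
rewrite !(@fintraceE _ N); try exact: mulN.
under eq_bigr do rewrite (finmx_mulE _ _ _ AN).
under [RHS]eq_bigr do rewrite (finmx_mulE _ _ _ BN).
rewrite exchange_big; apply: eq_bigr => k _; apply: eq_bigr => l _.
exact: mulrC.
Qed.

Lemma slinf_subspace : subspace [set A : finmx K | fintrace A = 0].
Proof.
split=> [|a A B /= A0 B0]; last by rewrite fintrace_linear A0 B0 mulr0 addr0.
exact: fsbig1.
Qed.

Lemma slinf_lie A B :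
  fintrace A = 0 -> fintrace B = 0 -> fintrace (lie A B) = 0.
Proof.
move=> _ _; rewrite /lie /= /finmx_lie addrC -scaleN1r fintrace_linear.
by rewrite fintrace_mulC mulN1r addNr.
Qed.

Definition slinf : subalgebra (finmx K) :=
  @Subalgebra K (finmx K) [set A | fintrace A = 0] slinf_subspace slinf_lie.

Lemma elem_mx_subproof (i j : nat) : exists N,
  vanish_outside N (fun a b => ((a == i) && (b == j))%:R : K).
Proof.
exists (maxn i j).+1 => a b; rewrite !gtn_max => -[/andP[ia ja]|/andP[ib jb]].
  by rewrite gtn_eqF.
by rewrite (gtn_eqF jb) andbF.
Qed.
Definition elem_mx (i j : nat) : finmx K := FinMx (elem_mx_subproof i j).

Lemma elem_mx_mul i j k l :
  finmx_mul (elem_mx i j) (elem_mx k l) = (j == k)%:R *: elem_mx i l.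
Proof.
apply: finmx_eq => a b; rewrite finmxE /= (fsum_single (k0 := j)) /=.
  rewrite eqxx andbT.
  by case: (a == i); case: (j == k); case: (b == l); rewrite /= ?(mul0r, mulr0).
by move=> c cj; rewrite (negbTE cj) andbF mul0r.
Qed.

Lemma fintrace_elem_mx i j : i <> j -> fintrace (elem_mx i j) = 0.
Proof.
move=> ij; apply: fsbig1 => a _ /=.
by case: (eqVneq a i) => //= ->; case: eqP.
Qed.

Lemma finmx_mul_diagl A B i j : (forall k l, k <> l -> A k l = 0) ->
  finmx_mul A B i j = A i i * B i j.
Proof.
move=> Ad; rewrite /= (fsum_single (k0 := i)) // => k ki.
by rewrite Ad ?mul0r // => ik; rewrite ik eqxx in ki.
Qed.

Lemma finmx_mul_diagr A B i j : (forall k l, k <> l -> A k l = 0) ->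
  finmx_mul B A i j = B i j * A j j.
Proof.
move=> Ad; rewrite /= (fsum_single (k0 := j)) // => k kj.
by rewrite Ad ?mulr0 // => jk; rewrite jk eqxx in kj.
Qed.

End FinitaryMatrices.

Section Subalgebras.
Variable K : fieldType.
Local Open Scope classical_set_scope.
Local Notation g := (slinf K).
Implicit Types x y : g.

Lemma sl_eq x y : (forall i j, val x i j = val y i j) -> x = y.
Proof. by move=> xy; apply/val_inj/finmx_eq. Qed.

Lemma cartan_subspace :
  subspace [set x : g | forall i j, i <> j -> val x i j = 0].
Proof.
by split=> [|a x y /= xd yd] i j ij //=; rewrite xd // yd // mulr0 addr0.
Qed.

Lemma diag_lie x y : (forall i j, i <> j -> val x i j = 0) ->
  (forall i j, i <> j -> val y i j = 0) -> lie x y = 0.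
Proof.
move=> xd yd; apply: sl_eq => i j.
rewrite -[LHS]/(finmx_mul (val x) (val y) i j - finmx_mul (val y) (val x) i j).
rewrite (finmx_mul_diagl _ _ _ xd) (finmx_mul_diagr _ _ _ xd).
have [<-|/eqP ij] := eqVneq i j; first by rewrite mulrC subrr.
by rewrite yd // mulr0 mul0r subr0.
Qed.

Lemma cartan_lie x y : (forall i j, i <> j -> val x i j = 0) ->
  (forall i j, i <> j -> val y i j = 0) ->
  forall i j, i <> j -> val (lie x y) i j = 0.
Proof. by move=> xd yd i j _; rewrite diag_lie. Qed.

Definition cartan : subalgebra g := Subalgebra cartan_subspace cartan_lie.

Lemma sl_fin_subspace n : subspace [set x : g | vanish_outside n.+1 (val x)].
Proof.
split=> [|a x y /= xn yn] i j ij //=.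
by rewrite xn // yn // mulr0 addr0.
Qed.

Lemma sl_fin_lie n x y : vanish_outside n.+1 (val x) ->
  vanish_outside n.+1 (val y) -> vanish_outside n.+1 (val (lie x y)).
Proof.
have mulN (C D : finmx K) : vanish_outside n.+1 C -> vanish_outside n.+1 D ->
    vanish_outside n.+1 (finmx_mul C D).
  move=> CN DN i j ij; rewrite (finmx_mulE _ _ _ CN) big1 // => k _.
  case: ij => ij; first by rewrite CN ?mul0r //; left.
  by rewrite DN ?mulr0 //; right.
move=> xn yn i j ij.
rewrite -[LHS]/(finmx_mul (val x) (val y) i j - finmx_mul (val y) (val x) i j).
by rewrite !mulN // subr0.
Qed.

(* g_n = sl(n+1): traceless matrices supported in the rows and columns 0..n *)
Definition sl_fin (n : nat) : subalgebra g :=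
  Subalgebra (sl_fin_subspace n) (@sl_fin_lie n).

Definition upper_triangular x : Prop :=
  forall i j, (j < i)%N -> val x i j = 0.

Definition root_vectors (r : nat -> nat -> Prop) : set g :=
  [set x | exists i j, [/\ i <> j, r i j & val x = elem_mx K i j]].

Definition sl_elem (i j : nat) (ij : i <> j) : g :=
  SubalgElt (mem_set (fintrace_elem_mx K ij) :
    elem_mx K i j \in subalg_set (slinf K)).

Lemma cartan_root_vectors_lie (r : nat -> nat -> Prop) :
  (forall i j k, r i j -> r j k -> r i k) ->
  forall x y, (subalg_set cartan `|` root_vectors r) x ->
    (subalg_set cartan `|` root_vectors r) y ->
  lspan (subalg_set cartan `|` root_vectors r) (lie x y).
Proof.
move=> rtrans x y; set A := _ `|` _; have [s0 sP] := subspace_lspan A.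
have sZ a z : A z -> lspan A (a *: z).
  by move=> Az; rewrite -[_ *: _]addr0; apply: sP => //; apply: sub_lspan.
have lieE (u v : g) i j : val (lie u v) i j =
  finmx_mul (val u) (val v) i j - finmx_mul (val v) (val u) i j by [].
case=> [xd|[i [j [ij rij xE]]]]; case=> [yd|[k [l [kl rkl yE]]]].
- by rewrite diag_lie.
- suff -> : lie x y = (val x k k - val x l l) *: y.
    by apply: sZ; right; exists k, l.
  apply: sl_eq => a b; rewrite lieE (finmx_mul_diagl _ _ _ xd).
  rewrite (finmx_mul_diagr _ _ _ xd) -[RHS]/((val x k k - val x l l) * val y a b).
  rewrite yE /=; case: eqP => [->|_]; case: eqP => [->|_];
    rewrite /=; ring.
- suff -> : lie x y = (val y j j - val y i i) *: x.
    by apply: sZ; right; exists i, j.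
  apply: sl_eq => a b; rewrite lieE (finmx_mul_diagl _ _ _ yd).
  rewrite (finmx_mul_diagr _ _ _ yd) -[RHS]/((val y j j - val y i i) * val x a b).
  rewrite xE /=; case: eqP => [->|_]; case: eqP => [->|_];
    rewrite /=; ring.
have lieE' : val (lie x y) =
    (j == k)%:R *: elem_mx K i l - (l == i)%:R *: elem_mx K k j.
  rewrite -[LHS]/(finmx_mul (val x) (val y) - finmx_mul (val y) (val x)).
  by rewrite xE yE !elem_mx_mul.
have [jk|jk] := eqVneq j k; have [li|li] := eqVneq l i.
- apply: sub_lspan; left => a b ab; rewrite lieE' jk li !eqxx !scale1r.
  rewrite !finmxE /=.
  suff E c : ((a == c) && (b == c)) = false by rewrite !E subrr.
  by apply/andP => -[/eqP ac /eqP bc]; apply: ab; rewrite ac bc.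
- have il : i <> l by move/eqP; rewrite eq_sym (negbTE li).
  suff -> : lie x y = 1 *: sl_elem il.
    apply: sZ; right; exists i, l; split=> //.
    by apply: rtrans rij _; rewrite jk.
  by apply: val_inj; rewrite lieE' jk eqxx (negbTE li) scale0r subr0 !scale1r.
- have kj : k <> j by move/eqP; rewrite eq_sym (negbTE jk).
  suff -> : lie x y = (-1) *: sl_elem kj.
    apply: sZ; right; exists k, j; split=> //.
    by apply: rtrans rkl _; rewrite li.
  apply: val_inj; rewrite lieE' li eqxx (negbTE jk) scale0r sub0r scale1r.
  by rewrite scaleN1r.
- suff -> : lie x y = 0 by [].
  by apply: val_inj; rewrite lieE' (negbTE jk) (negbTE li) !scale0r subr0.
Qed.

End Subalgebras.

Definition prec_comparable (prec : nat -> nat -> Prop) (i j : nat) : Prop :=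
  prec i j \/ prec j i.

Definition ord_class (prec : nat -> nat -> Prop) (i : nat) : set nat :=
  ([set i] `|` [set j | ~ prec_comparable prec i j])%classic.

Record admissible (prec : nat -> nat -> Prop) : Prop := Admissible {
  prec_irr : forall i, ~ prec i i;
  prec_trans : forall i j k, prec i j -> prec j k -> prec i k;
  prec_adm : forall i j, ord_class prec i <> ord_class prec j ->
    (ord_class prec i `&` ord_class prec j = set0)%classic
}.

Section Parabolic.
Variables (K : fieldType) (prec : nat -> nat -> Prop).
Local Open Scope classical_set_scope.
Local Notation g := (slinf K).
Local Notation cl := (ord_class prec).

Let le i j := prec i j \/ cl i = cl j.

Hypothesis adm : admissible prec.

Lemma prec_class_neq i j : prec i j -> cl i <> cl j.
Proof.
move=> ij E; have : cl i j by rewrite E; left.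
by case=> [ji|]; [rewrite ji in ij; apply: (prec_irr adm) ij|apply; left].
Qed.

Lemma prec_classr i j k : prec i j -> cl j = cl k -> prec i k.
Proof.
move=> ij jk; have ik : cl i <> cl k by rewrite -jk; apply: prec_class_neq.
have [|nik] := pselect (prec i k); first by [].
have [ki|nki] := pselect (prec k i).
  by case: (prec_class_neq (prec_trans adm ki ij)).
have : (cl i `&` cl k) k by split; [right; case|left].
by rewrite (prec_adm adm ik).
Qed.

Lemma prec_classl i j k : cl i = cl j -> prec j k -> prec i k.
Proof.
move=> ij jk; have ik : cl i <> cl k by rewrite ij; apply: prec_class_neq.
have [|nik] := pselect (prec i k); first by [].
have [ki|nki] := pselect (prec k i).
  by case: (prec_class_neq (prec_trans adm jk ki)).
have : (cl i `&` cl k) k by split; [right; case|left].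
by rewrite (prec_adm adm ik).
Qed.

Lemma prec_le_trans i j k : le i j -> le j k -> le i k.
Proof.
rewrite /le => -[ij|ij] [jk|jk].
- by left; apply: (prec_trans adm) ij jk.
- by left; apply: prec_classr ij jk.
- by left; apply: prec_classl ij jk.
- by right; rewrite ij.
Qed.

Definition levi : subalgebra g :=
  span_subalgebra (@cartan_root_vectors_lie K (fun i j => cl i = cl j)
    (fun i j k ij jk => etrans ij jk)).

Definition nilradical : set g := lspan (root_vectors prec).

Lemma parabolic_lie_subproof x y :
  lspan (subalg_set levi `|` nilradical) x ->
  lspan (subalg_set levi `|` nilradical) y ->
  lspan (subalg_set levi `|` nilradical) (lie x y).
Proof.
suff -> : lspan (subalg_set levi `|` nilradical) =
    lspan (subalg_set (cartan K) `|` root_vectors le).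
  by apply: lspan_lie; apply: cartan_root_vectors_lie; apply: prec_le_trans.
apply/seteqP; split; apply: lspan_sub; try exact: subspace_lspan.
- move=> z [] zA; move: z zA; apply: lspan_sub; try exact: subspace_lspan.
    move=> z [zh|[i [j [ij rij zE]]]]; apply: sub_lspan; first by left.
    by right; exists i, j; split=> //; right.
  move=> z [i [j [ij rij zE]]]; apply: sub_lspan.
  by right; exists i, j; split=> //; left.
- move=> z [zh|[i [j [ij [rij|rij] zE]]]]; apply: sub_lspan.
  + by left; apply: sub_lspan; left.
  + by right; apply: sub_lspan; exists i, j.
  + by left; apply: sub_lspan; right; exists i, j.
Qed.

(* the span of the union is the sum l(<) + u(<) *)
Definition parabolic : subalgebra g :=
  Subalgebra (subspace_lspan (subalg_set levi `|` nilradical))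
    parabolic_lie_subproof.

End Parabolic.

Section Aligned.
Variables (K : fieldType) (prec : nat -> nat -> Prop).
Local Open Scope classical_set_scope.
Local Notation g := (slinf K).
Hypothesis adm : admissible prec.
Local Notation l := (levi K prec).
Local Notation p := (parabolic K adm).

(* tau is the p-module obtained from sigma by letting u act by zero *)
Definition inflation (S : lmodType K) (sigma : lieRep l S) (tau : lieRep p S) :
  Prop :=
  (forall (x : p) (y : l) s, val x = val y -> tau x s = sigma y s) /\
  (forall (x : p) s, nilradical prec (val x) -> tau x s = 0).

Definition aligned (W : lmodType K) (rho : lieRep g W) : Prop :=
  [/\ simple_module rho, weight_module (cartan K) rho &
      exists (S : lmodType K) (sigma : lieRep l S) (tau : lieRep p S),
        [/\ simple_module sigma, weight_module (sub_in l (cartan K)) sigma,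
            inflation sigma tau &
            is_unique_simple_quotient (induced_rep tau) rho]].

End Aligned.

Definition is_partition (mu : seq nat) : Prop :=
  sorted geq mu /\ all (fun m => 0 < m)%N mu.

Section SchurModules.
Variable K : fieldType.
Local Open Scope classical_set_scope.
Local Notation g := (slinf K).

(* the simple g_n-module of b_n-highest weight (mu_1, ..., mu_k, 0, ..., 0) *)
Definition is_simple_highest_weight (n : nat) (mu : seq nat) (V : lmodType K)
    (pi : lieRep (sl_fin K n) V) : Prop :=
  simple_module pi /\
  exists v : V, v != 0 /\
    forall x : sl_fin K n, upper_triangular (val x) ->
      pi x v = (\sum_(i < n.+1) (nth 0%N mu i)%:R * val (val x) i i) *: v.

(* rho is isomorphic to S^mu V: W is the direct limit of a chain of embeddings
   of g_n-modules L_n -> L_(n+1), n >= n0, with L_n simple of highest weight mu.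
   As the maps iota n are injective, W is the limit iff the maps phi n into W
   are compatible with them, injective and jointly surjective. *)
Definition is_schur_module (mu : seq nat) (W : lmodType K) (rho : lieRep g W) :
  Prop :=
  exists (n0 : nat) (L : nat -> lmodType K)
    (pi : forall n, lieRep (sl_fin K n) (L n))
    (iota : forall n, {linear L n -> L n.+1})
    (phi : forall n, {linear L n -> W}),
  [/\ (size mu <= n0)%N,
      forall n, (n0 <= n)%N ->
        [/\ is_simple_highest_weight mu (pi n), injective (iota n) &
            forall (x : sl_fin K n) (y : sl_fin K n.+1) v, val x = val y ->
              iota n (pi n x v) = pi n.+1 y (iota n v)],
      forall n, (n0 <= n)%N ->
        [/\ injective (phi n),
            forall (x : sl_fin K n) v, phi n (pi n x v) = rho (val x) (phi n v) &
            forall v, phi n.+1 (iota n v) = phi n v] &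
      forall w : W, exists n (v : L n), (n0 <= n)%N /\ phi n v = w].

End SchurModules.

(* Main.v *)
From HB Require Import structures.
Require Import Defs.
From mathcomp Require Import boolp classical_sets cardinality fsbigop.
From mathcomp Require Import zify ring.

Set Implicit Arguments.
Unset Strict Implicit.
Unset Printing Implicit Defensive.

Import Order.TTheory GRing.Theory Num.Theory.
Local Open Scope ring_scope.

(** Write E a b for the matrix units, p = l + u for the parabolic subalgebra of
    the order, W for the Schur module of mu, and call a vector of W singular if
    u kills it.

    W is aligned if and only if it contains a nonzero singular vector. If W is
    a quotient of the module induced from S, the image of 1 (x) S consists of
    singular vectors and generates W ([aligned_singular]). Conversely, let v be
    a singular weight vector and S the p-submodule it generates. The sums of
    the entries of a weight over initial segments of classes are constant on S,
    while the operators E b a with a before b lower them; comparing these sums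
    shows that S is simple over l ([top_simple]) and that the kernel of the map
    to W is the only maximal submodule of the induced module
    ([induced_quotient], [singular_aligned]).

    The weights of W are tuples nu of nonnegative integers with sum |mu|, they
    are permuted by all transpositions, and their partial sums are at most
    those of mu. The modules L n of the direct limit are treated inside W. Their
    lowering operators F are nilpotent by simplicity ([simple_root_string]),
    so sl(2)-strings give the reflections ([reflect_weight], [is_weight_swap]),
    and reflections with dominance give nonnegativity ([weight_ge0]). This
    forces the highest weight vectors of L n and L (n+1) to be proportional
    ([highest_vector_extends]), so W has a highest weight vector for all of
    sl(infinity) and the same analysis applies to W itself
    ([schur_highest_weight]).

    It remains to decide when a singular vector exists. If v is singular of
    weight nu, the support of nu is down-closed for the order, and it has at
    least as many elements as mu has parts ([singular_initial_list],
    [schur_weight_support]). So there is a list s of distinct indices, one for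
    each part of mu, such that whatever precedes an entry of s occurs earlier
    in s. Conversely, given such an s, a weight vector whose weight has the
    entries of mu along s is singular ([schur_extremal_vector]). Finally the
    existence of such a list s is equivalent to the condition on i_1, ..., i_k
    ([initial_list_condition]): that condition says that finitely many classes
    form an initial segment of the order, and minimal elements of their union
    can be taken one at a time. *)

(** * Subspaces and simultaneous eigenvectors *)

Section Subspaces.
Variables (K : fieldType) (V : lmodType K).
Local Open Scope classical_set_scope.
Implicit Types (N A B : set V).

Lemma subspaceZ N a v : subspace N -> N v -> N (a *: v).
Proof. by case=> N0 NP Nv; rewrite -[_ *: _]addr0; apply: NP. Qed.

Lemma subspaceD N u v : subspace N -> N u -> N v -> N (u + v).
Proof. by case=> N0 NP Nu Nv; rewrite -[u]scale1r; apply: NP. Qed.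

Lemma subspaceB N u v : subspace N -> N u -> N v -> N (u - v).
Proof.
move=> sN Nu Nv; apply: subspaceD => //.
by rewrite -scaleN1r; apply: subspaceZ.
Qed.

Lemma subspace_sum N (I : eqType) (r : seq I) (F : I -> V) : subspace N ->
  (forall i, i \in r -> N (F i)) -> N (\sum_(i <- r) F i).
Proof.
move=> sN NF; rewrite big_seq; apply: big_rec => [|i u ir Nu]; first by case: sN.
by apply: subspaceD => //; apply: NF.
Qed.

Lemma subspace_set0 : subspace [set (0 : V)].
Proof. by split=> // a u v /= -> ->; rewrite scaler0 addr0. Qed.

Lemma subspaceI A B : subspace A -> subspace B -> subspace (A `&` B).
Proof. by move=> [A0 AP] [B0 BP]; split=> // a u v [? ?] [? ?]; split; auto. Qed.

Lemma lspan_mono A B : A `<=` B -> lspan A `<=` lspan B.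
Proof.
move=> AB; apply: lspan_sub; first exact: subspace_lspan.
by move=> x /AB; apply: sub_lspan.
Qed.

Lemma lspan_list A v : lspan A v ->
  exists2 s : seq V, (forall x, x \in s -> exists c a, A a /\ x = c *: a) &
    v = \sum_(x <- s) x.
Proof.
apply: (@lspan_sub _ _ A [set v | exists2 s : seq V,
  (forall x, x \in s -> exists c a, A a /\ x = c *: a) & v = \sum_(x <- s) x]).
- split=> [|a u w /=]; first by exists [::]; rewrite ?big_nil.
  move=> [s sA ->] [t tA ->]; exists ([seq a *: x | x <- s] ++ t).
    move=> x; rewrite mem_cat => /orP[/mapP[y /sA[c [b [Ab ->]]] ->]|/tA//].
    by exists (a * c), b; rewrite scalerA.
  by rewrite big_cat big_map scaler_sumr.
- move=> a Aa /=; exists [:: a]; last by rewrite big_seq1.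
  by move=> x; rewrite inE => /eqP->; exists 1, a; rewrite scale1r.
Qed.

Lemma lspan_eq0 A v : lspan A v -> (forall x, A x -> x = 0) -> v = 0.
Proof. by move=> Av A0; apply: (lspan_sub subspace_set0 A0). Qed.

End Subspaces.

(** Downward closure of finite-dimensionality, in the form that serves a
    submodule carrying its own type: the ambient span is peeled off one
    generator at a time, and a vector of N that involves the first generator
    splits N as a line plus the part that avoids it. *)
Lemma finite_dim_sub (K : fieldType) (U V : lmodType K) (f : {linear U -> V})
    (N : set U) (s : seq V) : injective f -> subspace N ->
  (forall u, N u -> lspan [set` s]%classic (f u)) -> finite_dim N.
Proof.
move=> finj; elim: s N => [|x s IHs] N sN Ns.
  exists [::]; apply/seteqP; split=> [u /Ns|]; last first.
    by apply: lspan_sub => // u; rewrite /= in_nil.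
  move=> /lspan_eq0 fu0; have -> : u = 0.
    by apply: finj; rewrite linear0; apply: fu0.
  by case: (@subspace_lspan _ U [set` [::]]%classic).
have xsP v : lspan [set` x :: s]%classic v -> exists c w,
    lspan [set` s]%classic w /\ v = c *: x + w.
  apply: (@lspan_sub _ _ _ (fun v => exists c w,
    lspan [set` s]%classic w /\ v = c *: x + w)); last first.
    have [s0 sP] := subspace_lspan [set` s]%classic.
    move=> y /=; rewrite inE => /orP[/eqP->|ys].
      by exists 1, 0; rewrite scale1r addr0.
    by exists 0, y; rewrite scale0r add0r; split=> //; apply: sub_lspan.
  have [s0 sP] := subspace_lspan [set` s]%classic.
  split=> [|a u w [c [y [sy ->]]] [d [z [sz ->]]]].
    by exists 0, 0; rewrite scale0r addr0.
  exists (a * c + d), (a *: y + z); split; first exact: sP.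
  by rewrite scalerDr scalerA scalerDl addrACA.
pose N' := (N `&` [set u | lspan [set` s] (f u)])%classic.
have sN' : subspace N'.
  apply: subspaceI => //; have [s0 sP] := subspace_lspan [set` s]%classic.
  by split=> [|a u w /= ? ?]; rewrite /= ?linear0 // linearP; apply: sP.
have [t N't] : finite_dim N' by apply: IHs => // u [].
have [NN'|] := pselect (forall u, N u -> lspan [set` s]%classic (f u)).
  exists t; rewrite -N't; apply/seteqP; split=> [u Nu|u []//].
  by split=> //; apply: NN'.
move=> /existsNP[u0 /not_implyP[Nu0 nu0]].
have [c [w [sw fu0]]] := xsP _ (Ns _ Nu0).
have c0 : c != 0.
  by apply: contra_notN nu0 => /eqP c0; rewrite fu0 c0 scale0r add0r.
exists (u0 :: t); apply/seteqP; split; last first.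
  apply: lspan_sub => // u /=; rewrite inE => /orP[/eqP->//|ut].
  by have [] : N' u by rewrite N't; apply: sub_lspan.
move=> u Nu; have [d [z [sz fu]]] := xsP _ (Ns _ Nu).
have : N' (u - (d / c) *: u0).
  split; first by apply: subspaceB => //; apply: subspaceZ.
  rewrite /= linearB linearZ /= fu fu0 scalerDr scalerA divfK // opprD addrACA subrr add0r.
  have ss := subspace_lspan [set` s]%classic.
  exact: (subspaceB ss sz (subspaceZ _ ss sw)).
rewrite N't => tu; rewrite -(subrK ((d / c) *: u0) u).
have st := subspace_lspan [set` u0 :: t]%classic.
apply: (subspaceD st).
  by apply: lspan_mono tu => y /= yt; rewrite inE yt orbT.
by apply: (subspaceZ _ st); apply: sub_lspan; rewrite /= mem_head.
Qed.

Section Representations.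
Variables (K : fieldType) (L : lieAlgType K) (V : lmodType K).
Variable rho : lieRep L V.
Local Open Scope classical_set_scope.
Implicit Types (T p q : set L) (N S : set V) (x y : L) (chi : L -> K).

Lemma rep_actD x u v : rho x (u + v) = rho x u + rho x v.
Proof. by rewrite -[u]scale1r rep_linearr !scale1r. Qed.

Lemma rep_act0 x : rho x 0 = 0.
Proof. by apply: (addIr (rho x 0)); rewrite -rep_actD !add0r. Qed.

Lemma rep_actZ x a u : rho x (a *: u) = a *: rho x u.
Proof. by rewrite -[a *: u]addr0 rep_linearr rep_act0 addr0. Qed.

Lemma rep_act_sum x (s : seq V) :
  rho x (\sum_(u <- s) u) = \sum_(u <- s) rho x u.
Proof. by elim/big_rec2: _ => [|u y z _ <-]; rewrite ?rep_act0 ?rep_actD. Qed.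

Lemma rep_zero v : rho 0 v = 0.
Proof.
have := rep_linearl rho 1 0 0 v; rewrite scaler0 addr0 scale1r.
by move/eqP; rewrite -subr_eq0 opprD addNKr oppr_eq0 => /eqP.
Qed.

Lemma rep_scale a x v : rho (a *: x) v = a *: rho x v.
Proof. by rewrite -[a *: x]addr0 rep_linearl rep_zero addr0. Qed.

Lemma rep_comm x y v : rho x (rho y v) = rho y (rho x v) + rho (lie x y) v.
Proof. by rewrite rep_lie addrC subrK. Qed.

Definition stable T N := forall x v, T x -> N v -> N (rho x v).

Lemma stable_lspan T N : subspace N -> stable T N -> stable (lspan T) N.
Proof.
move=> sN TN x v Tx Nv; move: x Tx; apply: lspan_sub => [|x Tx]; last exact: TN.
split=> [|a x y /= Nx Ny]; first by rewrite /= rep_zero; case: sN.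
by rewrite rep_linearl; case: sN => _; apply.
Qed.

Lemma submoduleE N : submodule rho N <-> subspace N /\ stable setT N.
Proof.
by split=> -[sN NP]; split=> // x v; [move=> _; apply: NP|apply: NP].
Qed.

Definition generated q S : set V :=
  smallest (fun N => subspace N /\ stable q N) S.

Lemma subspace_generated q S : subspace (generated q S).
Proof.
split=> [N [[[]]] //|a u v Su Sv N [[sN qN] SN]].
by case: (sN) => _; apply; [apply: Su|apply: Sv].
Qed.

Lemma sub_generated q S : S `<=` generated q S.
Proof. exact: sub_smallest. Qed.

Lemma generated_stable q S : stable q (generated q S).
Proof. by move=> x v qx Sv N NP; apply: NP.1.2 => //; apply: Sv. Qed.

Lemma generated_sub q S N : subspace N -> stable q N -> S `<=` N ->
  generated q S `<=` N.
Proof. by move=> sN qN SN v; apply. Qed.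

(** The weak form of the Poincare-Birkhoff-Witt theorem that suffices for
    spanning: for w in the q-closure, x (y w) = y (x w) + [x, y] w, and both
    terms stay inside, so being mapped inside by p propagates along q. *)
Lemma generated_stable_complement p q S :
  (forall x y, p x -> q y -> lspan (p `|` q) (lie x y)) ->
  stable p S -> stable p (generated q S).
Proof.
move=> pq pS x w px Xw; set X := generated q S in Xw *.
have sX : subspace X := @subspace_generated q S.
suff : X `<=` X `&` [set w | forall x, p x -> X (rho x w)].
  by move/(_ w Xw) => -[_ /(_ x px)].
apply: generated_sub.
- apply: subspaceI => //; split=> [x' _|a u v /= Xu Xv x' px'].
    by rewrite rep_act0; case: sX.
  by rewrite rep_linearr; case: sX => _; apply; [apply: Xu|apply: Xv].
- move=> y v qy [Xv pv]; split; first exact: generated_stable.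
  move=> z pz; rewrite rep_comm; apply: (subspaceD sX).
    by apply: generated_stable => //; apply: pv.
  have := pq _ _ pz qy; move: (lie z y); apply: lspan_sub.
    split=> [|a t t' /= Xt Xt']; first by rewrite /= rep_zero; case: sX.
    by rewrite rep_linearl; case: sX => _; apply.
  by move=> t [pt|qt]; [apply: pv|apply: generated_stable].
- move=> s Ss; split=> [|y py]; first exact: sub_generated.
  by apply: sub_generated; apply: pS.
Qed.

Definition eigen T chi v : Prop := forall x, T x -> rho x v = chi x *: v.

Lemma eigenZ T chi a v : eigen T chi v -> eigen T chi (a *: v).
Proof. by move=> ev x Tx; rewrite rep_actZ ev // !scalerA mulrC. Qed.

Lemma eigen_subspace T chi : subspace (eigen T chi).
Proof.
split=> [x _|a u v eu ev x Tx]; first by rewrite rep_act0 scaler0.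
by rewrite rep_linearr eu // ev // scalerDr !scalerA mulrC.
Qed.

(** Applying x - chi_y(x) for an x that distinguishes the first eigenvector y
    of the list from v0 kills y and only rescales the other terms. *)
Lemma eigen_separation T N chi v0 (s : seq V) :
  subspace N -> stable T N -> eigen T chi v0 ->
  (forall u, u \in s -> exists2 chi', eigen T chi' u &
     exists2 x, T x & chi' x != chi x) ->
  N (v0 + \sum_(y <- s) y) -> N v0.
Proof.
move=> sN TN; elim: {s}(size s) {-2}s (erefl (size s)) v0 => [|n IHn] [|y s] //=.
  by move=> _ v0 _ _; rewrite big_nil addr0.
move=> [sz] v0 e0 es; have [chi' ey [x Tx ne]] := es _ (mem_head y s).
rewrite big_cons => Nv.
suff : N ((chi x - chi' x) *: v0).
  move=> /(subspaceZ (chi x - chi' x)^-1 sN).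
  by rewrite scalerA mulVf ?scale1r // subr_eq0 eq_sym.
apply: (IHn [seq rho x z - chi' x *: z | z <- s]).
- by rewrite size_map.
- exact: eigenZ.
- move=> _ /mapP[z zs ->]; have [|chi2 ez2 [t Tt net]] := es z.
    by rewrite inE zs orbT.
  exists chi2; last by exists t.
  by rewrite ez2 // -scalerBl; apply: eigenZ.
rewrite big_map sumrB -scaler_sumr -rep_act_sum scalerBl -e0 //.
suff -> : rho x v0 - chi' x *: v0 +
    (rho x (\sum_(j <- s) j) - chi' x *: (\sum_(j <- s) j)) =
    rho x (v0 + (y + \sum_(j <- s) j)) - chi' x *: (v0 + (y + \sum_(j <- s) j)).
  by apply: subspaceB => //; [apply: TN|apply: subspaceZ].
rewrite !rep_actD !scalerDr (ey _ Tx) [in RHS]opprD [RHS]addrACA.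
by congr (_ + _); rewrite opprD addrACA subrr add0r.
Qed.

Lemma eigen_split T (A : set V) chi v :
  (forall a, A a -> exists chi', eigen T chi' a) -> lspan A v ->
  exists v0 s, [/\ lspan (A `&` eigen T chi) v0,
    (forall u, u \in s -> exists2 chi', eigen T chi' u &
     exists2 x, T x & chi' x != chi x) & v = v0 + \sum_(y <- s) y].
Proof.
move=> AT /lspan_list[s sA ->].
elim: s sA => [|x s IHs] sA.
  exists 0, [::]; rewrite !big_nil addr0; split=> //.
  by case: (subspace_lspan (A `&` eigen T chi)).
have [|v0 [t [v0P tP st]]] := IHs; first by move=> y ys; apply: sA; rewrite inE ys orbT.
have [c [a [Aa xE]]] := sA _ (mem_head x s); rewrite big_cons st.
have [ea|nea] := pselect (eigen T chi a).
  exists (x + v0), t; rewrite addrA; split=> //.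
  apply: (subspaceD (@subspace_lspan _ _ _)) => //.
  by rewrite xE; apply: (subspaceZ _ (@subspace_lspan _ _ _)); apply: sub_lspan.
exists v0, (x :: t); rewrite big_cons addrCA; split=> // y.
rewrite inE => /orP[/eqP->|/tP//]; have [chi' ea] := AT _ Aa; exists chi'.
  by rewrite xE; apply: eigenZ.
apply: contrapT => nex; apply: nea => z Tz; rewrite ea //.
by have [->//|ne] := eqVneq (chi' z) (chi z); case: nex; exists z.
Qed.

Lemma eigen_in_span T (A : set V) chi v :
  (forall a, A a -> exists chi', eigen T chi' a) -> lspan A v ->
  eigen T chi v -> lspan (A `&` eigen T chi) v.
Proof.
move=> AT Av ev; have [v0 [s [v0P sP vE]]] := eigen_split chi AT Av.
suff /= /eqP : [set 0] (v0 - v) by rewrite subr_eq0 => /eqP <-.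
apply: (@eigen_separation T _ chi _ s) => //.
- exact: subspace_set0.
- by move=> x u _ /= ->; rewrite rep_act0.
- apply: (subspaceB (eigen_subspace _ _)) => //.
  by apply: lspan_sub v0P; [exact: eigen_subspace|move=> ? []].
by rewrite /= addrAC -vE subrr.
Qed.

Lemma eigen_decomposition T (A N : set V) v :
  (forall a, A a -> exists chi', eigen T chi' a) -> subspace N -> stable T N ->
  lspan A v -> N v -> lspan [set a | N a /\ exists chi,
    lspan (A `&` eigen T chi) a] v.
Proof.
move=> AT sN TN /lspan_list[s sA ->]; set D := [set a | _].
have sD := subspace_lspan D.
elim: {s}(size s).+1 {-2}s (leqnn (size s).+1) sA => // n IHn [|x s] sz sA.
  by rewrite big_nil; case: sD.
have [c [a [Aa xE]]] := sA _ (mem_head x s); have [chi ea] := AT _ Aa.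
pose Q (y : V) := `[< exists c b, [/\ A b, eigen T chi b & y = c *: b] >].
rewrite (bigID Q) /= => Nv.
have v0P : lspan (A `&` eigen T chi) (\sum_(y <- x :: s | Q y) y).
  rewrite -big_filter; apply: (subspace_sum (@subspace_lspan _ _ _)) => y.
  rewrite mem_filter => /andP[/asboolP[d [b [Ab eb ->]]] _].
  by apply: (subspaceZ _ (@subspace_lspan _ _ _)); apply: sub_lspan.
have Nv0 : N (\sum_(y <- x :: s | Q y) y).
  move: Nv; rewrite -[X in _ + X]big_filter; apply: (eigen_separation sN TN (chi:=chi)).
    by apply: lspan_sub v0P; [exact: eigen_subspace|move=> ? []].
  move=> y; rewrite mem_filter => /andP[/asboolP nQ /sA[d [b [Ab yE]]]].
  have [chi' eb] := AT _ Ab; exists chi'; first by rewrite yE; apply: eigenZ.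
  apply: contrapT => nex; apply: nQ; exists d, b; split=> // z Tz; rewrite eb //.
  by have [->//|ne] := eqVneq (chi' z) (chi z); case: nex; exists z.
apply: (subspaceD sD); first by apply: sub_lspan; split=> //; exists chi.
rewrite -big_filter; apply: IHn.
- have Qx : Q x by apply/asboolP; exists c, a.
  rewrite /= Qx /= size_filter. exact: leq_ltn_trans (count_size _ _) (sz : (size s < n)%N).
- by move=> y; rewrite mem_filter => /andP[_ /sA].
- rewrite big_filter; have := subspaceB sN Nv Nv0.
  by rewrite addrAC subrr add0r.
Qed.

End Representations.

(** * Matrix units in sl(infinity) *)

Section MatrixUnits.
Variable K : fieldType.
Local Open Scope classical_set_scope.
Local Notation g := (slinf K).
Implicit Types (x y : g) (a b c d i j : nat) (P : nat -> Prop).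

(** The convention E a a = 0 makes the bracket formulas uniform. *)
Definition munit a b : g :=
  if pselect (a <> b) is left ab then sl_elem K ab else 0.

Definition mcoroot a b : g := lie (munit a b) (munit b a).

Lemma munitE a b i j :
  val (munit a b) i j = ((i == a) && (j == b) && (a != b))%:R.
Proof.
rewrite /munit; case: pselect => [ab|nab].
  by move/eqP: (ab) => ->; rewrite andbT.
have -> : a = b by apply: contrapT.
by rewrite eqxx andbF.
Qed.

Lemma munit_val a b : a != b -> val (munit a b) = elem_mx K a b.
Proof. by move=> ab; apply: finmx_eq => i j; rewrite munitE ab andbT. Qed.

Lemma munit_diag a : munit a a = 0.
Proof. by apply: sl_eq => i j; rewrite munitE eqxx andbF. Qed.

Lemma slDE x y i j : val (x + y) i j = val x i j + val y i j.
Proof. by []. Qed.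

Lemma slZE (c : K) x i j : val (c *: x) i j = c * val x i j.
Proof. by []. Qed.

Lemma slBE x y i j : val (x - y) i j = val x i j - val y i j.
Proof. by []. Qed.

Lemma sl_lieE x y : val (lie x y) =
  finmx_mul (val x) (val y) - finmx_mul (val y) (val x).
Proof. by []. Qed.

Lemma munit_mull a b (A : finmx K) i j : a != b ->
  finmx_mul (val (munit a b)) A i j = (i == a)%:R * A b j.
Proof.
move=> ab; rewrite /= (fsum_single (k0 := b)); first by rewrite munitE ab eqxx !andbT.
by move=> k kb; rewrite munitE (negbTE kb) andbF mul0r.
Qed.

Lemma munit_mulr a b (A : finmx K) i j : a != b ->
  finmx_mul A (val (munit a b)) i j = A i a * (j == b)%:R.
Proof.
move=> ab; rewrite /= (fsum_single (k0 := a)); first by rewrite munitE ab eqxx !andbT.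
by move=> k ka; rewrite munitE (negbTE ka) mulr0.
Qed.

Lemma munit_lieE a b x i j : a != b -> val (lie (munit a b) x) i j =
  (i == a)%:R * val x b j - val x i a * (j == b)%:R.
Proof.
by move=> ab; rewrite sl_lieE finmxDE finmxNE munit_mull // munit_mulr.
Qed.

Lemma lie_munit a b c d : a != b -> c != d -> (a, b) != (d, c) ->
  lie (munit a b) (munit c d) =
  (b == c)%:R *: munit a d - (d == a)%:R *: munit c b.
Proof.
move=> ab cd; rewrite xpair_eqE => abcd; apply: sl_eq => i j.
rewrite munit_lieE // slBE !slZE !munitE cd [c == b]eq_sym [a == d]eq_sym.
rewrite [a == d]eq_sym in abcd.
by move: (b == c) (d == a) abcd (i == a) (i == c) (j == b) (j == d);
  do 2![case] => //= _ [] [] [] []; rewrite /=; ring.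
Qed.

Lemma mcorootE a b i j : a != b -> val (mcoroot a b) i j =
  (i == j)%:R * ((i == a)%:R - (i == b)%:R).
Proof.
move=> ab; rewrite munit_lieE // !munitE !eqxx [b == a]eq_sym ab !andbT /=.
have [<-|ij] := eqVneq i j.
  by case: (i == a); case: (i == b); rewrite /=; ring.
have nij c : (i == c)%:R * (j == c)%:R = 0 :> K.
  have [ic|_] := eqVneq i c; last by rewrite mul0r.
  by rewrite -ic [j == i]eq_sym (negbTE ij) mulr0.
by rewrite !nij mul0r subrr.
Qed.

(** This holds because F = E a b satisfies F F = 0 and F x F = x b a F. *)
Lemma lie_munit_munit a b x : a != b ->
  lie (munit a b) (lie (munit a b) x) = (- (val x b a *+ 2)) *: munit a b.
Proof.
move=> ab; apply: sl_eq => i j; rewrite munit_lieE // slZE !munit_lieE //.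
rewrite munitE ab andbT [b == a]eq_sym (negbTE ab).
case: (i == a); case: (j == b); rewrite /=; ring.
Qed.

Definition diagonal x : Prop := forall i j, i <> j -> val x i j = 0.

Lemma lie_diag_munit x a b : diagonal x ->
  lie x (munit a b) = (val x a a - val x b b) *: munit a b.
Proof.
move=> xd; have [->|ab] := eqVneq a b; first by rewrite munit_diag lie0r scaler0.
apply: sl_eq => i j; rewrite sl_lieE finmxDE finmxNE.
rewrite (finmx_mul_diagl _ _ _ xd) (finmx_mul_diagr _ _ _ xd) slZE munitE ab andbT.
case: eqP => [->|_]; case: eqP => [->|_]; rewrite /=; ring.
Qed.

(** This gives all of sl(infinity) for P total, and the copies of sl(n+1) for P
    an initial segment. *)
Definition supported P x : Prop :=
  forall i j, ~ P i \/ ~ P j -> val x i j = 0.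

Definition torus P : set g := [set x | diagonal x /\ supported P x].

Lemma supported_munit P a b : P a -> P b -> supported P (munit a b).
Proof.
move=> Pa Pb i j ij; rewrite munitE; case: eqP => //= ia; case: eqP => //= jb.
by case: ij; rewrite ?ia ?jb.
Qed.

Lemma supported_lie P x y : supported P x -> supported P y ->
  supported P (lie x y).
Proof.
move=> xP yP i j ij; rewrite sl_lieE finmxDE finmxNE /= !fsbig1 ?subr0 // => k _;
  by case: ij => ij; do ?[rewrite xP ?mul0r ?mulr0 //; auto; fail |
     rewrite yP ?mul0r ?mulr0 //; auto; fail].
Qed.

Lemma torus_mcoroot P a b : P a -> P b -> torus P (mcoroot a b).
Proof.
move=> Pa Pb; split; last by apply: supported_lie; apply: supported_munit.
have [->|ab] := eqVneq a b.
  by rewrite /mcoroot munit_diag lie0l => i j.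
by move=> i j /eqP ij; rewrite mcorootE // (negbTE ij) mul0r.
Qed.

Lemma matrix_unit_span P x : supported P x ->
  lspan (torus P `|` [set y | exists a b, [/\ a != b, P a, P b, val x a b != 0 &
    y = munit a b]]) x.
Proof.
move=> xP; set A := _ `|` _; have sA := subspace_lspan A.
have [N xN] := finmxP (val x).
pose o := \sum_(p <- [seq (a, b) | a <- iota 0 N, b <- iota 0 N])
  val x p.1 p.2 *: munit p.1 p.2.
have oE i j : val o i j = (i != j)%:R * val x i j.
  rewrite /o; transitivity (\sum_(p <- [seq (a, b) | a <- iota 0 N, b <- iota 0 N])
    val x p.1 p.2 * val (munit p.1 p.2) i j).
    by elim/big_rec2: _ => // p _ z _ <-; rewrite slDE slZE.
  have [ijN|ijN] := boolP ((i < N) && (j < N))%N; last first.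
    rewrite (xN i j) ?mulr0; last first.
      by move: ijN; rewrite negb_and -!leqNgt => /orP[]; [left|right].
    rewrite big_seq big1 // => -[a b] /allpairsP[[a' b'] /= [a'N b'N [-> ->]]].
    rewrite munitE; case: eqP => [ia|]; case: eqP => [jb|] //=; rewrite ?mulr0 //.
    move: ijN a'N b'N; rewrite ia jb !mem_iota /= add0n => /negbTE h h1 h2.
    by rewrite h1 h2 in h.
  rewrite (bigD1_seq (i, j)) /=; first last.
  - by apply: allpairs_uniq => [||[? ?] [? ?] _ _ //]; apply: iota_uniq.
  - by apply/allpairsP; exists (i, j); rewrite !mem_iota /= !add0n; case/andP: ijN.
  rewrite munitE !eqxx /= mulrC big1 ?addr0 // => -[a b] /=.
  rewrite xpair_eqE negb_and munitE [i == a]eq_sym [j == b]eq_sym.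
  by case: (a == i); case: (b == j) => //= _; rewrite mulr0.
rewrite -(subrK o x); apply: (subspaceD sA).
  apply: sub_lspan; left; split=> i j ij; rewrite slBE oE.
    by move/eqP: ij => ->; rewrite mul1r subrr.
  by rewrite xP // mulr0 subr0.
apply: (subspace_sum sA) => -[a b] _ /=.
have [->|ab] := eqVneq a b; first by rewrite munit_diag scaler0; case: sA.
have [->|x0] := eqVneq (val x a b) 0; first by rewrite scale0r; case: sA.
apply: (subspaceZ _ sA); apply: sub_lspan; right; exists a, b; split=> //.
- by apply: contrapT => nP; move/eqP: x0; apply; apply: xP; left.
- by apply: contrapT => nP; move/eqP: x0; apply; apply: xP; right.
Qed.

End MatrixUnits.

Arguments munit {K} a b.
Arguments mcoroot {K} a b.
Arguments torus_mcoroot {K P a b}.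
Arguments supported_munit {K P a b}.

(** * Integral weights *)

Section Weights.
Implicit Types (nu : nat -> int) (w : nat -> int) (a b i N : nat) (P : nat -> Prop).
Local Open Scope classical_set_scope.

Definition vanish_from N nu : Prop := forall i, (N <= i)%N -> nu i = 0.

Definition add_root nu a b : nat -> int :=
  fun i => nu i + ((i == a)%:Z - (i == b)%:Z).

Definition swap a b i : nat := if i == a then b else if i == b then a else i.

(** Indicator functions w give the partial sums that measure dominance. *)
Definition pairing w nu : int := \sum_(i \in [set: nat]) w i * nu i.

Definition ind (A : nat -> Prop) : nat -> int := fun i => `[< A i >]%:Z.

(** A weight of the traceless torus determines its entries only up to a common
    constant; fixing the degree removes this ambiguity. *)
Definition degree_weight P (d : int) nu : Prop :=
  [/\ forall i, ~ P i -> nu i = 0, exists N, vanish_from N nu &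
      pairing (fun=> 1) nu = d].

Lemma pairingE N w nu : vanish_from N nu ->
  pairing w nu = \sum_(0 <= i < N) w i * nu i.
Proof.
move=> nuN; rewrite /pairing (fsbigE (index_iota 0 N)) ?iota_uniq //; last first.
  by move=> k _; rewrite mem_index_iota /= -leqNgt => /nuN ->; rewrite mulr0.
by apply: eq_bigl => k; rewrite in_setT.
Qed.

Lemma vanish_fromW N N' nu : (N <= N')%N -> vanish_from N nu -> vanish_from N' nu.
Proof. by move=> NN' nuN i N'i; apply: nuN; apply: leq_trans N'i. Qed.

Lemma vanish_add_root N nu a b : (a < N)%N -> (b < N)%N -> vanish_from N nu ->
  vanish_from N (add_root nu a b).
Proof. by move=> aN bN nuN i Ni; rewrite /add_root nuN //; lia. Qed.

Lemma pairing_add_root w nu a b : (exists N, vanish_from N nu) ->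
  pairing w (add_root nu a b) = pairing w nu + (w a - w b).
Proof.
move=> [N0 nuN0]; pose N := maxn N0 (maxn a b).+1.
have nuN : vanish_from N nu by apply: vanish_fromW nuN0; rewrite leq_maxl.
rewrite (@pairingE N) ?(@pairingE N _ nu) //; last first.
  by apply: vanish_add_root => //; rewrite /N; lia.
have delta c : (c < N)%N -> \sum_(0 <= i < N) w i * (i == c)%:Z = w c.
  move=> cN; rewrite (bigD1_seq c) /= ?iota_uniq ?mem_index_iota //=.
  rewrite eqxx mulr1 big1 ?addr0 // => i /negbTE ->; exact: mulr0.
under eq_bigr do rewrite mulrDr mulrBr.
by rewrite big_split sumrB /= !delta // /N; lia.
Qed.

Lemma add_root_finite nu a b : (exists N, vanish_from N nu) ->
  exists N, vanish_from N (add_root nu a b).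
Proof.
move=> [N nuN]; exists (maxn N (maxn a b).+1).
by apply: vanish_add_root; rewrite ?leq_max; [lia|lia|apply: vanish_fromW nuN; lia].
Qed.

Lemma degree_add_root P d nu a b : P a -> P b -> degree_weight P d nu ->
  degree_weight P d (add_root nu a b).
Proof.
move=> Pa Pb [nuP nuf nud]; split; first last.
- by rewrite pairing_add_root // subrr addr0.
- exact: add_root_finite.
move=> i nPi; rewrite /add_root nuP // add0r.
case: eqP => [ia|_]; first by rewrite ia in nPi.
by case: eqP => [ib|_] //; rewrite ib in nPi.
Qed.

Lemma degree_weight_unique P d nu nu' : (exists i, P i) ->
  degree_weight P d nu -> degree_weight P d nu' ->
  (forall a b, P a -> P b -> nu a - nu b = nu' a - nu' b) -> nu = nu'.
Proof.
move=> [i0 Pi0] [nuP [N nuN] nud] [nuP' [N' nuN'] nud'] E; apply/funext => j.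
pose M := maxn i0.+1 (maxn N N'); pose c := nu i0 - nu' i0.
have diff i : nu i - nu' i = c * `[< P i >]%:Z.
  case: asboolP => [Pi|nPi]; last by rewrite nuP // nuP' // subrr mulr0.
  by rewrite mulr1; move: (E i i0 Pi Pi0); rewrite /c; lia.
suff c0 : c = 0 by apply/eqP; rewrite -subr_eq0 diff c0 mul0r.
have : \sum_(0 <= i < M) (nu i - nu' i) = 0.
  rewrite sumrB; apply/eqP; rewrite subr_eq0; apply/eqP.
  move: nud nud'; rewrite (@pairingE M); last by apply: vanish_fromW nuN; lia.
  rewrite (@pairingE M _ nu'); last by apply: vanish_fromW nuN'; lia.
  under eq_bigr do rewrite mul1r.
  by under [X in _ -> X = _ -> _]eq_bigr do rewrite mul1r; move=> -> ->.
under eq_bigr do rewrite diff; rewrite -mulr_sumr => /eqP.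
rewrite mulf_eq0 => /orP[/eqP//|]; rewrite (bigD1_seq i0) ?iota_uniq //=; last first.
  by rewrite mem_index_iota /M; lia.
have S0 : 0 <= \sum_(0 <= i < M | i != i0) (`[< P i >]%:Z : int).
  by apply: sumr_ge0 => i _; case: `[< _ >].
by rewrite asboolT // paddr_eq0 // => /andP[].
Qed.

Lemma swapK a b : involutive (swap a b).
Proof. by move=> i; rewrite /swap; do !case: eqP => //=; congruence. Qed.

End Weights.

Section WeightCharacters.
Variable K : numFieldType.
Local Open Scope classical_set_scope.
Local Notation g := (slinf K).
Implicit Types (nu : nat -> int) (x : g).

Definition weight_char nu (x : g) : K :=
  \sum_(i \in [set: nat]) (nu i)%:~R * val x i i.

Lemma weight_charE N nu x : vanish_outside N (val x) ->
  weight_char nu x = \sum_(0 <= i < N) (nu i)%:~R * val x i i.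
Proof. by move=> xN; apply: fsum_bound => i Ni; rewrite xN ?mulr0 //; left. Qed.

Lemma weight_char_linear nu (c : K) x y :
  weight_char nu (c *: x + y) = c * weight_char nu x + weight_char nu y.
Proof.
have [N [xN yN]] := finmx_bound2 (val x) (val y).
rewrite !(@weight_charE N) //; last first.
  by move=> i j ij; rewrite slDE slZE xN // yN // mulr0 addr0.
by rewrite mulr_sumr -big_split; apply: eq_bigr => i _ /=; rewrite mulrDr mulrCA.
Qed.

Lemma weight_char_add_root nu a b x :
  weight_char (add_root nu a b) x = weight_char nu x + (val x a a - val x b b).
Proof.
have [N0 xN0] := finmxP (val x); pose N := maxn N0 (maxn a b).+1.
have xN : vanish_outside N (val x) by apply: vanish_outsideW xN0; rewrite leq_maxl.
have delta c : (c < N)%N ->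
    \sum_(0 <= i < N) (i == c)%:Z%:~R * val x i i = val x c c :> K.
  move=> cN; rewrite (bigD1_seq c) /= ?iota_uniq ?mem_index_iota //=.
  rewrite eqxx mul1r big1 ?addr0 // => i /negbTE ->; exact: mul0r.
rewrite !(@weight_charE N) //; under eq_bigr do rewrite rmorphD rmorphB /= mulrDl mulrBl.
by rewrite big_split sumrB /= !delta // /N; lia.
Qed.

Lemma weight_char_mcoroot nu a b : a != b ->
  weight_char nu (mcoroot a b) = (nu a - nu b)%:~R.
Proof.
move=> ab; pose N := (maxn a b).+1.
have delta M c : (c < M)%N -> \sum_(0 <= i < M) (nu i)%:~R * (i == c)%:R = (nu c)%:~R :> K.
  move=> cM; rewrite (bigD1_seq c) /= ?iota_uniq ?mem_index_iota //=.
  rewrite eqxx mulr1 big1 ?addr0 // => i /negbTE ->; exact: mulr0.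
rewrite (@weight_charE N); last first.
  move=> i j ij; rewrite mcorootE //; case: eqVneq => [E|]; last by rewrite mul0r.
  have iN : (N <= i)%N by case: ij; rewrite E.
  by rewrite [i == a]gtn_eqF ?[i == b]gtn_eqF ?subrr ?mulr0 // -/N; lia.
have aN : (a < N)%N by rewrite /N; lia.
have bN : (b < N)%N by rewrite /N; lia.
rewrite intrB -(delta _ _ aN) -(delta _ _ bN) -sumrB.
by apply: eq_bigr => i _; rewrite mcorootE // eqxx mul1r mulrBr.
Qed.

Lemma weight_char_inj P d nu nu' : (exists i, P i) ->
  degree_weight P d nu -> degree_weight P d nu' ->
  (forall x, torus P x -> weight_char nu x = weight_char nu' x) -> nu = nu'.
Proof.
move=> P0 nuP nuP' E; apply: degree_weight_unique P0 nuP nuP' _ => a b Pa Pb.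
have [->|ab] := eqVneq a b; first by rewrite !subrr.
have := E _ (torus_mcoroot Pa Pb); rewrite !weight_char_mcoroot //.
exact: intr_inj.
Qed.

End WeightCharacters.

(** * Weight vectors and reflections *)

Section WeightVectors.
Variables (K : numFieldType) (V : lmodType K) (rho : lieRep (slinf K) V).
Local Open Scope classical_set_scope.
Local Notation e a b := (rho (munit a b)).
Implicit Types (nu : nat -> int) (a b i : nat) (P : nat -> Prop) (v : V).

Definition weight_vector P nu v := eigen rho (torus P) (weight_char nu) v.

Definition weight_vectors P (C : set (nat -> int)) : set V :=
  [set v | exists2 nu, C nu & weight_vector P nu v].

Lemma weight_vector_munit P nu a b v :
  weight_vector P nu v -> weight_vector P (add_root nu a b) (e a b v).
Proof.
move=> vnu x xP; have [xd _] := xP.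
rewrite rep_comm vnu // rep_actZ lie_diag_munit // rep_scale -scalerDl.
by rewrite weight_char_add_root.
Qed.

Lemma weight_vector_unique P d nu nu' v : (exists i, P i) -> v != 0 ->
  degree_weight P d nu -> degree_weight P d nu' ->
  weight_vector P nu v -> weight_vector P nu' v -> nu = nu'.
Proof.
move=> P0 v0 dnu dnu' vnu vnu'; apply: weight_char_inj P0 dnu dnu' _ => x xP.
have /eqP := vnu x xP; rewrite vnu' // -subr_eq0 -scalerBl scaler_eq0 (negbTE v0).
by rewrite orbF subr_eq0 => /eqP.
Qed.

Lemma weight_in_span P d (A : set V) (C : set (nat -> int)) nu v :
  (exists i, P i) -> A `<=` weight_vectors P C ->
  (forall nu', C nu' -> degree_weight P d nu') ->
  degree_weight P d nu -> lspan A v -> weight_vector P nu v ->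
  lspan [set u | A u /\ (u != 0 -> C nu /\ weight_vector P nu u)] v.
Proof.
move=> P0 AC Cd dnu Av vnu.
have AT u : A u -> exists chi, eigen rho (torus P) chi u.
  by case/AC => nu' _ anu'; exists (weight_char nu').
apply: lspan_mono (eigen_in_span AT Av vnu) => a [Aa anu].
split=> // a0; have [nu' Cnu' anu'] := AC _ Aa.
have -> : nu = nu' := weight_vector_unique P0 a0 dnu (Cd _ Cnu') anu anu'.
by split.
Qed.

Lemma weight_label P d (C : set (nat -> int)) nu v : (exists i, P i) ->
  (forall nu', C nu' -> degree_weight P d nu') ->
  degree_weight P d nu -> lspan (weight_vectors P C) v ->
  weight_vector P nu v -> v != 0 -> C nu.
Proof.
move=> P0 Cd dnu Av vnu v0; apply: contrapT => nC.
have /lspan_eq0 := weight_in_span P0 (@subset_refl _ _) Cd dnu Av vnu.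
move=> /(_ _)/eqP; rewrite (negbTE v0) => /(_ _)/negP; apply=> // x [_ xC].
by have [//|/xC[]] := eqVneq x 0.
Qed.

Definition munits (r : nat -> nat -> Prop) : set (slinf K) :=
  [set x | exists a b, r a b /\ x = munit a b].

(** For lowering operators r, Low will consist of the weights with smaller
    partial sums than those in Base. *)
Lemma generated_weights P (r : nat -> nat -> Prop) (S B : set V)
    (Base Low : set (nat -> int)) (X : set V) :
  (forall nu a b, Base nu \/ Low nu -> r a b -> Low (add_root nu a b)) ->
  stable rho (munits r) X -> B `<=` X ->
  B `<=` weight_vectors P Base -> S `<=` lspan B ->
  generated rho (munits r) S `<=` lspan (B `|` (weight_vectors P Low `&` X)).
Proof.
move=> rLow rX BX BBase SB.
have sA := subspace_lspan (B `|` (weight_vectors P Low `&` X)).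
apply: generated_sub => //; last first.
  by apply: subset_trans SB _; apply: lspan_mono => v; left.
move=> _ v [a [b [rab ->]]]; move: v; apply: lspan_sub.
  split=> [|c u w /= Au Aw]; first by rewrite /= rep_act0; case: sA.
  by rewrite rep_linearr; case: sA => _; apply.
move=> v Av; apply: sub_lspan; right; split; last first.
  by apply: rX; [exists a, b|case: Av => [/BX|[]]].
case: Av => [/BBase|[]] [nu Cnu vnu]; exists (add_root nu a b).
- by apply: rLow rab; left.
- exact: weight_vector_munit.
- by apply: rLow rab; right.
- exact: weight_vector_munit.
Qed.

Lemma iter_add_rootE n nu a b i : iter n (fun nu => add_root nu a b) nu i =
  nu i + n%:Z * ((i == a)%:Z - (i == b)%:Z).
Proof.
elim: n => [|n IHn] /=; first by rewrite mul0r addr0.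
by rewrite {1}/add_root IHn; case: (i == a); case: (i == b); lia.
Qed.

Lemma weight_vector_iter P nu a b n v : weight_vector P nu v ->
  weight_vector P (iter n (fun nu => add_root nu a b) nu) (iter n (e a b) v).
Proof. by move=> vnu; elim: n => //= n; apply: weight_vector_munit. Qed.

Lemma degree_iter P d nu a b n : P a -> P b -> degree_weight P d nu ->
  degree_weight P d (iter n (fun nu => add_root nu a b) nu).
Proof. by move=> Pa Pb dnu; elim: n => //= n; apply: degree_add_root. Qed.

Lemma swap_add_root nu a b : a != b -> nu b <= nu a ->
  nu \o swap a b = iter `|nu a - nu b|%N (fun nu => add_root nu b a) nu.
Proof.
move=> ab le; apply/funext => i; rewrite iter_add_rootE /= /swap.
have [->|ia] := eqVneq i a; first by rewrite (negbTE ab); lia.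
by have [->|ib] := eqVneq i b; lia.
Qed.

Lemma swapC a b : swap a b = swap b a.
Proof. by apply/funext => i; rewrite /swap; do !case: eqP => //; congruence. Qed.

Lemma swapxx a : swap a a = id.
Proof. by apply/funext => i; rewrite /swap; do !case: eqP => //; congruence. Qed.

Lemma degree_swap P d nu a b : P a -> P b -> degree_weight P d nu ->
  degree_weight P d (nu \o swap a b).
Proof.
wlog le : a b / nu b <= nu a => [th|] Pa Pb dnu.
  by have [le|/ltW le] := leP (nu b) (nu a); [|rewrite swapC]; apply: th.
have [->|ab] := eqVneq a b; first by rewrite swapxx.
by rewrite swap_add_root //; apply: degree_iter.
Qed.

Lemma rep_mcoroot P nu a b v : P a -> P b -> a != b -> weight_vector P nu v ->
  rho (mcoroot a b) v = (nu a - nu b)%:~R *: v.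
Proof.
by move=> Pa Pb ab vnu; rewrite vnu ?weight_char_mcoroot //; apply: torus_mcoroot.
Qed.

(** With c = nu a - nu b, the coroot [E, F] acts on F^i u by c - 2 i; the factor
    is the sum of these values for i = 0, ..., n. *)
Lemma munit_string P nu a b u n : P a -> P b -> a != b ->
  weight_vector P nu u -> e a b u = 0 ->
  e a b (iter n.+1 (e b a) u) =
    (n.+1%:Z * (nu a - nu b - n%:Z))%:~R *: iter n (e b a) u.
Proof.
move=> Pa Pb ab unu eu0; elim: n => [|n IHn]; rewrite iterS rep_comm.
  rewrite /= eu0 rep_act0 add0r -/(mcoroot a b) (rep_mcoroot Pa Pb ab unu).
  by congr (_%:~R *: _); lia.
rewrite IHn rep_actZ -iterS -/(mcoroot a b).
rewrite (rep_mcoroot Pa Pb ab (weight_vector_iter b a n.+1 unu)) -scalerDl -intrD.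
congr (_%:~R *: _); rewrite !iter_add_rootE !eqxx [b == a]eq_sym (negbTE ab).
by rewrite /=; ring.
Qed.

(** An sl(2)-string through v: climb with E to the top, where the weight c is
    at least that of v, then descend with F, which stays nonzero for c steps
    and thus reaches the reflected weight. *)
Lemma reflect_weight P nu a b v r : P a -> P b -> a != b -> nu b <= nu a ->
  v != 0 -> weight_vector P nu v -> iter r (e a b) v = 0 ->
  exists m n, let u := iter m (e b a) (iter n (e a b) v) in
    u != 0 /\ weight_vector P (nu \o swap a b) u.
Proof.
move=> Pa Pb ab le v0 vnu evr.
have ex0 : exists r, iter r (e a b) v == 0 by exists r; apply/eqP.
have [[|n] /eqP evn nmin] := find_ex_minn ex0; first by move: v0; rewrite [v]evn eqxx.
pose u := iter n (e a b) v; pose nu' := iter n (fun nu => add_root nu a b) nu.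
have u0 : u != 0 by apply/negP => /nmin; rewrite ltnn.
have unu : weight_vector P nu' u by apply: weight_vector_iter.
pose m := `|nu a - nu b|%N.
have nu'E : nu' a - nu' b = m%:Z + n.*2%:Z.
  rewrite /nu' !iter_add_rootE !eqxx [b == a]eq_sym (negbTE ab) /m; lia.
have fu0 j : (j <= m + n)%N -> iter j (e b a) u != 0.
  elim: j => // j IHj jmn; apply/negP => /eqP fj0.
  have := munit_string j Pa Pb ab unu evn; rewrite fj0 rep_act0 => /esym/eqP.
  rewrite scaler_eq0 (negbTE (IHj (ltnW jmn))) orbF intr_eq0 mulf_eq0 nu'E.
  lia.
exists (m + n)%N, n; split; first exact: fu0.
have := weight_vector_iter b a (m + n) unu.
congr (weight_vector P _ _); apply/funext => i.
by rewrite swap_add_root // /nu' !iter_add_rootE -/m PoszD; ring.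
Qed.

(** With y = [F, x], the relation F (y w) = y (F w) + c F w carries nilpotency of
    F from w to y w, and then F (x w) = x (F w) + y w carries it to x w. *)
Lemma munit_nilpotent a b x r w : a != b -> iter r (e a b) w = 0 ->
  exists n, iter n (e a b) (rho x w) = 0.
Proof.
move=> ab; set F := e a b; set y := lie (munit a b) x.
have F0 n : iter n F 0 = 0 by elim: n => //= n ->; apply: rep_act0.
have FD n u u' : iter n F (u + u') = iter n F u + iter n F u'.
  by elim: n => //= n ->; apply: rep_actD.
have FZ n c u : iter n F (c *: u) = c *: iter n F u.
  by elim: n => //= n ->; apply: rep_actZ.
have yF n u : iter n F u = 0 -> iter n F (rho y u) = 0.
  elim: n u => [|n IHn] u; first by rewrite /= => ->; apply: rep_act0.
  rewrite !iterSr => Fu.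
  have -> : F (rho y u) = rho y (F u) + (- (val x b a *+ 2)) *: F u.
    by rewrite /F rep_comm /y lie_munit_munit // rep_scale.
  by rewrite FD FZ IHn // Fu scaler0 addr0.
move=> Fw; exists r.+1; elim: r w Fw => [|r IHr] w Fw.
  by rewrite [w]Fw rep_act0; apply: F0.
rewrite iterSr; have -> : F (rho x w) = rho x (F w) + rho y w by rewrite /F rep_comm.
by rewrite FD IHr -?iterSr // add0r yF.
Qed.

End WeightVectors.

(** * Modules generated by a highest weight vector *)

(** P is the whole of nat or an initial segment, so that sl(infinity) and its
    finite-rank subalgebras are treated at once. *)
Record highest_weight_module (K : numFieldType) (V : lmodType K)
    (rho : lieRep (slinf K) V) (P : nat -> Prop) (d : int) (mu : nat -> int)
    (X : set V) (v0 : V) : Prop := HighestWeightModule {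
  hw_zero : P 0%N;
  hw_down : forall a b, (a <= b)%N -> P b -> P a;
  hw_noninc : forall i, mu i.+1 <= mu i;
  hw_degree : degree_weight P d mu;
  hw_subspace : subspace X;
  hw_stable : stable rho (supported P) X;
  hw_simple : forall Y : set V, subspace Y -> (Y `<=` X)%classic ->
    stable rho (supported P) Y -> (exists2 y, Y y & y != 0) -> (X `<=` Y)%classic;
  hw_in : X v0;
  hw_neq0 : v0 != 0;
  hw_weight : weight_vector rho P mu v0;
  hw_highest : forall a b, (a < b)%N -> P b -> rho (munit a b) v0 = 0
}.

Section HighestWeight.
Variables (K : numFieldType) (V : lmodType K) (rho : lieRep (slinf K) V).
Local Open Scope classical_set_scope.
Local Notation e a b := (rho (munit a b)).
Implicit Types (nu : nat -> int) (a b i n : nat) (u v : V).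

Variables (P : nat -> Prop) (d : int) (mu : nat -> int) (X : set V) (v0 : V).
Hypothesis hw : highest_weight_module rho P d mu X v0.

Let P0 := hw_zero hw.
Let P_down := hw_down hw.
Let mu_noninc := hw_noninc hw.
Let mu_degree := hw_degree hw.
Let X_subspace := hw_subspace hw.
Let X_stable := hw_stable hw.
Let X_simple := hw_simple hw.
Let Xv0 := hw_in hw.
Let v0_neq0 := hw_neq0 hw.
Let v0_weight := hw_weight hw.
Let v0_highest := hw_highest hw.
Let exP : exists i, P i. Proof. by exists 0%N. Qed.

Definition partial_sum n nu : int := pairing (ind (fun i => i < n)%N) nu.

Definition lower_weight nu : set (nat -> int) :=
  [set nu' | [/\ degree_weight P d nu',
    forall n, partial_sum n nu' <= partial_sum n nu &
    exists n, partial_sum n nu' < partial_sum n nu]].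

Definition lowering a b : Prop := [/\ (b < a)%N, P a & P b].

Lemma indE (A : nat -> bool) i : ind (fun i => A i) i = (A i)%:Z.
Proof. by rewrite /ind; case: asboolP => [->//|/negP/negbTE->]. Qed.

Lemma partial_sum_add_root n nu a b : (exists N, vanish_from N nu) ->
  partial_sum n (add_root nu a b) =
  partial_sum n nu + ((a < n)%N%:Z - (b < n)%N%:Z).
Proof. by move=> nuN; rewrite /partial_sum pairing_add_root // !indE. Qed.

Lemma partial_sum_iter n nu a b m : (exists N, vanish_from N nu) ->
  partial_sum n (iter m (fun nu => add_root nu a b) nu) =
  partial_sum n nu + m%:Z * ((a < n)%N%:Z - (b < n)%N%:Z).
Proof.
move=> nuN; elim: m => [|m IHm]; first by rewrite mul0r addr0.
rewrite iterS partial_sum_add_root ?IHm.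
  by rewrite intS; ring.
by elim: m {IHm} => //= m; apply: add_root_finite.
Qed.

Lemma lower_weight_step nu nu' a b : degree_weight P d nu ->
  nu' = nu \/ lower_weight nu nu' -> lowering a b ->
  lower_weight nu (add_root nu' a b).
Proof.
move=> dnu nu'P [ba Pa Pb].
have dnu' : degree_weight P d nu' by case: nu'P => [->|[]].
have [_ nu'f _] := dnu'.
have le n : partial_sum n nu' <= partial_sum n nu.
  by case: nu'P => [->//|[_ h _]]; apply: h.
split; first exact: degree_add_root.
  by move=> n; rewrite partial_sum_add_root //; move: (le n); lia.
by exists a; rewrite partial_sum_add_root // ltnn ba; move: (le a); lia.
Qed.

(** By minimality of X it suffices that the lowering closure of u is stable
    under every matrix supported on P. *)
Lemma highest_generates u nu : X u -> u != 0 -> weight_vector rho P nu u ->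
  (forall a b, (a < b)%N -> P b -> e a b u = 0) ->
  X `<=` generated rho (munits lowering) [set c *: u | c in setT].
Proof.
move=> Xu u0 unu u_high; set S := [set _ | _ in _]; set Y := generated _ _ _.
pose p : set (slinf K) := torus P `|` munits (fun a b => (a < b)%N /\ P b).
have spanP x : supported P x -> lspan (p `|` munits lowering) x.
  move/matrix_unit_span; apply: lspan_mono => y [yT|[a [b [ab Pa Pb _ ->]]]].
    by left; left.
  have [lt|lt|E] := ltngtP a b; last by rewrite E eqxx in ab.
    by left; right; exists a, b.
  by right; exists a, b.
have sS : subspace S.
  split; first by exists 0; rewrite ?scale0r.
  by move=> c _ _ [s _ <-] [t _ <-]; exists (c * s + t); rewrite // scalerDl scalerA.
have lowX (x : slinf K) : munits lowering x -> supported P x.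
  by move=> [a [b [[_ Pa Pb] ->]]]; apply: supported_munit.
have pX x : p x -> supported P x.
  move=> [[]//|[a [b [[ab Pb] ->]]]]; apply: supported_munit => //.
  exact: P_down (ltnW ab) Pb.
apply: X_simple.
- exact: subspace_generated.
- apply: generated_sub => //.
    by move=> x v /lowX xP; apply: X_stable.
  by move=> _ [c _ <-]; apply: subspaceZ.
- move=> x v /spanP; apply: stable_lspan; first exact: subspace_generated.
  move=> y w [py|]; last exact: generated_stable.
  apply: (generated_stable_complement (p := p)) => //.
    by move=> z t /pX zP /lowX tP; apply: spanP; apply: supported_lie.
  move=> z _ pz [c _ <-]; case: pz => [zT|[a [b [[ab Pb] ->]]]].
    by exists (weight_char nu z * c); rewrite // rep_actZ unu // !scalerA mulrC.
  by exists 0; rewrite // rep_actZ u_high // scaler0 scale0r.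
- by exists u => //; apply: sub_generated; exists 1; rewrite ?scale1r.
Qed.

Lemma highest_span u nu : X u -> u != 0 -> weight_vector rho P nu u ->
  degree_weight P d nu -> (forall a b, (a < b)%N -> P b -> e a b u = 0) ->
  X `<=` lspan ([set c *: u | c in setT] `|`
    (weight_vectors rho P (lower_weight nu) `&` X)).
Proof.
move=> Xu u0 unu dnu u_high; apply: subset_trans (highest_generates Xu u0 unu u_high) _.
apply: (generated_weights (Base := [set nu])) => //.
- by move=> nu' a b h; apply: lower_weight_step.
- by move=> x w [a [b [[_ Pa Pb] ->]]]; apply: X_stable; apply: supported_munit.
- by move=> _ [c _ <-]; apply: subspaceZ.
- by move=> _ [c _ <-]; exists nu => //; apply: eigenZ.
- by move=> ? ?; apply: sub_lspan.
Qed.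

Lemma highest_weights u nu v nu' : X u -> u != 0 -> weight_vector rho P nu u ->
  degree_weight P d nu -> (forall a b, (a < b)%N -> P b -> e a b u = 0) ->
  X v -> v != 0 -> weight_vector rho P nu' v -> degree_weight P d nu' ->
  nu' = nu \/ lower_weight nu nu'.
Proof.
move=> Xu u0 unu dnu u_high Xv vn0 vnu' dnu'.
apply: (@weight_label _ _ rho P d [set nu' | nu' = nu \/ lower_weight nu nu']) vnu' vn0 => //.
  by move=> nu2 [->|[]].
apply: lspan_mono (highest_span Xu u0 unu dnu u_high Xv) => w [[c _ <-]|[[nu2 low w2] _]].
  by exists nu; [left|apply: eigenZ].
by exists nu2; [right|].
Qed.

Definition is_weight nu : Prop :=
  degree_weight P d nu /\ exists2 v, X v /\ v != 0 & weight_vector rho P nu v.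

Lemma weight_dominated nu : is_weight nu -> nu = mu \/ lower_weight mu nu.
Proof.
move=> [dnu [v [Xv vn0] vnu]].
exact: (highest_weights Xv0 v0_neq0 v0_weight mu_degree v0_highest Xv vn0 vnu dnu).
Qed.

Lemma partial_sum_weight nu n : is_weight nu -> partial_sum n nu <= partial_sum n mu.
Proof. by case/weight_dominated => [->//|[_ h _]]; apply: h. Qed.

Lemma X_iter a b n v : P a -> P b -> X v -> X (iter n (e a b) v).
Proof.
by move=> Pa Pb Xv; elim: n => //= n IHn; exact: X_stable (supported_munit Pa Pb) IHn.
Qed.

(** F^(m+1) v0 would be another highest weight vector, of a weight not above
    mu. *)
Lemma simple_root_string i : P i.+1 ->
  iter `|mu i - mu i.+1|.+1 (e i.+1 i) v0 = 0.
Proof.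
move=> Pi1; have Pi : P i := P_down (leqnSn i) Pi1.
have ii1 : i != i.+1 by rewrite ltn_eqF.
set m := `|_|%N; apply/eqP; apply: contraT => u0.
have comm j a b : (a < b)%N -> P b -> (a, b) != (i, i.+1) ->
    e a b (iter j (e i.+1 i) v0) = 0.
  elim: j a b => [|j IHj] a b ab Pb abi; first exact: v0_highest.
  rewrite iterS rep_comm IHj // rep_act0 add0r.
  have ab' : a != b by rewrite ltn_eqF.
  have i1i : i.+1 != i by rewrite gtn_eqF.
  rewrite (lie_munit _ ab' i1i abi) addrC -scaleNr rep_linearl rep_scale.
  suff [h1 h2] : (i == a -> e i.+1 b (iter j (e i.+1 i) v0) = 0) /\
      (b == i.+1 -> e a i (iter j (e i.+1 i) v0) = 0).
    have [/h1 E1|_] := boolP (i == a); have [/h2 E2|_] := boolP (b == i.+1);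
    by rewrite ?E1 ?E2 ?(scaler0, oppr0, scale0r, addr0).
  move: abi; rewrite xpair_eqE => abi; split=> /eqP E; subst.
    by apply: IHj => //; [lia|rewrite xpair_eqE; lia].
  by apply: IHj => //; [lia|rewrite xpair_eqE; lia].
have dnu := degree_iter m.+1 Pi1 Pi mu_degree.
have unu := weight_vector_iter i.+1 i m.+1 v0_weight.
have Xu := X_iter m.+1 Pi1 Pi Xv0.
have u_high a b : (a < b)%N -> P b -> e a b (iter m.+1 (e i.+1 i) v0) = 0.
  have [[-> ->] _ _|ne] := eqVneq (a, b) (i, i.+1); last by move=> *; apply: comm.
  rewrite (munit_string m Pi Pi1 ii1 v0_weight) ?v0_highest //.
  suff -> : mu i - mu i.+1 - m%:Z = 0 by rewrite mulr0 scale0r.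
  by rewrite /m; have := mu_noninc i; lia.
have := highest_weights Xu u0 unu dnu u_high Xv0 v0_neq0 v0_weight mu_degree.
case=> [/(congr1 (fun f => f i))|].
  by rewrite iter_add_rootE eqxx (ltn_eqF (ltnSn i)); lia.
move=> [_ /(_ i.+1) + _]; have [_ muf _] := mu_degree.
by rewrite partial_sum_iter // ltnn ltnSn; lia.
Qed.

(** The vectors on which F acts nilpotently form a submodule containing v0. *)
Lemma simple_root_nilpotent i v : P i.+1 -> X v ->
  exists r, iter r (e i.+1 i) v = 0.
Proof.
move=> Pi1; have Pi : P i := P_down (leqnSn i) Pi1.
have F0 n : iter n (e i.+1 i) 0 = 0 by elim: n => //= n ->; apply: rep_act0.
pose Y := X `&` [set v | exists r, iter r (e i.+1 i) v = 0].
have sY : subspace Y.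
  apply: subspaceI => //; split=> [|c u w [r ru] [s sw]]; first by exists 0%N.
  exists (maxn r s).
  have lin n : iter n (e i.+1 i) (c *: u + w) =
      c *: iter n (e i.+1 i) u + iter n (e i.+1 i) w.
    by elim: n => //= n ->; apply: rep_linearr.
  rewrite lin; have [rs|sr] := leqP r s.
    by rewrite sw addr0 -(subnK rs) iterD ru F0 scaler0.
  by rewrite ru scaler0 add0r -(subnK (ltnW sr)) iterD sw F0.
suff XY : X `<=` Y by move=> /XY[].
apply: X_simple => //.
- by move=> x [].
- move=> x w xP [Xw [r rw]]; split; first exact: X_stable.
  by apply: munit_nilpotent rw; rewrite gtn_eqF.
- exists v0 => //; split=> //; eexists; exact: simple_root_string.
Qed.

(** Raising operators are nilpotent because a partial sum would otherwise exceed
    that of mu. *)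
Lemma is_weight_swap i nu : P i.+1 -> is_weight nu -> is_weight (nu \o swap i i.+1).
Proof.
move=> Pi1 nuw; have [dnu [v [Xv vn0] vnu]] := nuw.
have Pi : P i := P_down (leqnSn i) Pi1.
have ii1 : i != i.+1 by rewrite ltn_eqF.
split; first exact: degree_swap.
have [le|/ltW le] := leP (nu i.+1) (nu i); last first.
  have [r vr] := simple_root_nilpotent Pi1 Xv; rewrite swapC.
  have [|m [n [un0 unu]]] := reflect_weight Pi1 Pi _ le vn0 vnu vr; first by rewrite eq_sym.
  exists (iter m (e i i.+1) (iter n (e i.+1 i) v)) => //; split=> //.
  by apply: X_iter => //; apply: X_iter.
pose r := `|partial_sum i.+1 mu - partial_sum i.+1 nu|.+1%N.
have vr : iter r (e i i.+1) v = 0.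
  apply/eqP; apply: contraT => vrn0.
  have : is_weight (iter r (fun nu => add_root nu i i.+1) nu).
    split; first exact: degree_iter.
    by exists (iter r (e i i.+1) v); [split=> //; apply: X_iter|apply: weight_vector_iter].
  move/(partial_sum_weight i.+1); have [_ nuf _] := dnu.
  by rewrite partial_sum_iter // ltnn ltnSn /r; lia.
have [m [n [un0 unu]]] := reflect_weight Pi Pi1 ii1 le vn0 vnu vr.
exists (iter m (e i.+1 i) (iter n (e i i.+1) v)) => //; split=> //.
by apply: X_iter => //; apply: X_iter.
Qed.

Lemma partial_sum_all N nu : vanish_from N nu ->
  partial_sum N nu = pairing (fun=> 1) nu.
Proof.
move=> nuN; rewrite /partial_sum !(pairingE _ nuN).
by rewrite !big_nat; apply: eq_bigr => i /andP[_ iN]; rewrite indE iN.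
Qed.

(** The last coordinate N of a weight is d minus a partial sum, and such a
    partial sum is at most d; adjacent reflections carry any other coordinate
    to the last place. *)
Lemma weight_ge0 N nu i : P N -> vanish_from N mu -> is_weight nu ->
  vanish_from N.+1 nu -> 0 <= nu i.
Proof.
move=> PN muN nuw nuN; have [iN|Ni] := leqP i N; last by rewrite nuN.
elim: {i}(N - i)%N {-2}i iN (erefl (N - i)%N) nu nuw nuN => [|m IHm] i iN Ni nu nuw nuN.
  have -> : i = N by lia.
  have := partial_sum_weight N nuw; have [_ _ mud] := mu_degree.
  rewrite (partial_sum_all muN) mud; have [[_ _ <-] _] := nuw.
  rewrite -(partial_sum_all nuN) /partial_sum !(pairingE _ nuN).
  rewrite !big_nat_recr //= !indE ltnn ltnSn mul0r addr0 mul1r.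
  suff -> : \sum_(0 <= i0 < N) ind (fun i1 => (i1 < N)%N) i0 * nu i0 =
            \sum_(0 <= i0 < N) ind (fun i1 => (i1 < N.+1)%N) i0 * nu i0.
    by rewrite lerDl.
  by rewrite !big_nat; apply: eq_bigr => j /andP[_ jN]; rewrite !indE jN ltnS ltnW.
have iN' : (i.+1 <= N)%N by lia.
have Pi1 : P i.+1 := P_down iN' PN.
have /(_ _ _)/= := IHm i.+1 iN' _ _ (is_weight_swap Pi1 nuw).
rewrite /swap eqxx gtn_eqF //; apply; first lia.
move=> j jN /=; do 2!(case: eqP => [?|_]; first lia); exact: nuN.
Qed.

End HighestWeight.

(** * The highest weight vector of a Schur module *)

Section SchurHighestWeight.
Variables (K : numFieldType) (mu : seq nat).
Hypothesis mu_partition : is_partition mu.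
Variables (W : lmodType K) (rho : lieRep (slinf K) W).
Hypothesis schur : is_schur_module mu rho.
Local Open Scope classical_set_scope.
Local Notation e a b := (rho (munit a b)).

Definition part_weight (mu : seq nat) : nat -> int := fun i => (nth 0%N mu i)%:Z.

Let d : int := (sumn mu)%:Z.
Let P n := fun i => (i <= n)%N : Prop.

Lemma part_weight_noninc i : part_weight mu i.+1 <= part_weight mu i.
Proof.
rewrite /part_weight lez_nat; have [mu_sorted _] := mu_partition.
have [im|mi] := ltnP i.+1 (size mu); last by rewrite nth_default.
by move: (mu_sorted) => /(sortedP 0%N) /(_ i im).
Qed.

Lemma part_weight_vanish : vanish_from (size mu) (part_weight mu).
Proof. by move=> i mi; rewrite /part_weight nth_default. Qed.

Lemma part_weight_degree (Q : nat -> Prop) :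
  (forall i, (i < size mu)%N -> Q i) -> degree_weight Q d (part_weight mu).
Proof.
move=> muQ; split.
- move=> i nQ; rewrite /part_weight nth_default //.
  by rewrite leqNgt; apply: contra_notN nQ; apply: muQ.
- by exists (size mu); apply: part_weight_vanish.
rewrite (pairingE _ part_weight_vanish) /d sumnE (big_nth 0%N).
by rewrite (big_morph Posz PoszD (erefl _)); apply: eq_bigr => i _; rewrite mul1r.
Qed.

Lemma supported_all x : supported (K := K) (fun=> True) x.
Proof. by move=> i j [/(_ I)|/(_ I)]. Qed.

Lemma supported_mono (Q Q' : nat -> Prop) x : (forall i, Q i -> Q' i) ->
  supported (K := K) Q x -> supported Q' x.
Proof.
by move=> QQ' xQ i j ij; apply: xQ; case: ij => n; [left|right] => /QQ'.
Qed.

Lemma supported_bounded x : exists n, forall m, (n <= m)%N -> supported (K := K) (P m) x.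
Proof.
have [N xN] := finmxP (val x); exists N => m Nm i j ij; apply: xN.
by rewrite /P in ij; case: ij => /negP; rewrite -ltnNge => h; [left|right]; lia.
Qed.

(** Moving the simple modules into W along the maps phi n makes all operators
    act on one space. *)
Lemma schur_filtration : exists (n0 : nat) (X : nat -> set W) (v : nat -> W),
  [/\ (size mu <= n0)%N,
      forall n, (n0 <= n)%N ->
        highest_weight_module rho (P n) d (part_weight mu) (X n) (v n),
      forall n, (n0 <= n)%N -> X n `<=` X n.+1 &
      forall w, exists2 n, (n0 <= n)%N & X n w].
Proof.
case: schur => n0 [L [pi [iota [phi [szmu Lhw phiP phi_surj]]]]].
have hwv n : exists v : L n, (n0 <= n)%N ->
    v != 0 /\ forall x : sl_fin K n, upper_triangular (val x) ->
      pi n x v = (\sum_(i < n.+1) (nth 0%N mu i)%:R * val (val x) i i) *: v.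
  have [n0n|n0n] := boolP (n0 <= n)%N; last by exists 0.
  by have [[_ [v [v0 vP]]] _ _] := Lhw n n0n; exists v.
pose v n := projT1 (cid (hwv n)); have vP n := projT2 (cid (hwv n)).
exists n0, (fun n => range (phi n)), (fun n => phi n (v n)); split=> //.
- move=> n n0n; have [Lsimple _ _] := Lhw n n0n.
  have [phi_inj phi_eq _] := phiP n n0n; have [vn0 v_high] := vP n n0n.
  have lift x : supported (P n) x -> exists y : sl_fin K n, val y = x.
    move=> xP; suff xn : x \in subalg_set (sl_fin K n) by exists (SubalgElt xn).
    apply/mem_set => i j ij; apply: xP.
    by case: ij => h; [left|right]; rewrite /P; apply/negP; rewrite -ltnNge.
  have phi0 u : u != 0 -> phi n u != 0.
    by apply: contraNneq => E; apply/eqP/phi_inj; rewrite E linear0.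
  split.
  + by [].
  + by move=> a b ab; apply: leq_trans.
  + exact: part_weight_noninc.
  + by apply: part_weight_degree => i im; rewrite /P; lia.
  + split; first by exists 0; rewrite ?linear0.
    by move=> a _ _ [u _ <-] [w _ <-]; exists (a *: u + w); rewrite ?linearP.
  + by move=> x _ /lift[y <-] [u _ <-]; exists (pi n y u).
  + move=> Y sY YX Ystable [y Yy yn0].
    have [[_ Lsub] _] := Lsimple; have [] := Lsub (phi n @^-1` Y).
    * split; last first.
        move=> x u /= Yu; rewrite phi_eq; apply: Ystable => //.
        move=> i j ij; apply: (set_mem (valP x)).
        by case: ij => /negP h; [left|right]; rewrite ltnNge.
      have [Y0 YP] := sY; split=> [|a u w /= Yu Yw]; rewrite /= ?linear0 // linearP.
      exact: YP.
    * have [u _ uy] := YX _ Yy; move=> E; have : (phi n @^-1` Y) u by rewrite /= uy.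
      by rewrite E => /= u0; move: yn0; rewrite -uy u0 linear0 eqxx.
    * by move=> E _ [u _ <-]; have : (phi n @^-1` Y) u by rewrite E.
  + by exists (v n).
  + exact: phi0.
  + move=> x [xd xP]; have [y yx] := lift x xP; rewrite -yx -phi_eq v_high.
      rewrite linearZ /= (@weight_charE _ n.+1) ?big_mkord //.
      by apply: (set_mem (valP y)).
    by move=> i j ji; rewrite yx; apply: xd => E; rewrite E ltnn in ji.
  + move=> a b ab Pb; have Pa : P n a by apply: leq_trans (ltnW ab) Pb.
    have [y yx] := lift _ (supported_munit Pa Pb).
    rewrite -yx -phi_eq v_high; last first.
      move=> i j ji; rewrite yx munitE; case: eqP => //= ia; case: eqP => //= jb.
      by lia.
    rewrite big1 ?scale0r ?linear0 // => i _; rewrite yx munitE.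
    case: eqP => [->|] /=; last by rewrite mulr0.
    by rewrite (ltn_eqF ab) mulr0.
- move=> n n0n _ [u _ <-]; have [_ _ <-] := phiP n n0n; by exists (iota n u).
- by move=> w; have [n [u [n0n <-]]] := phi_surj w; exists n => //; exists u.
Qed.

Lemma part_weight_of_eigen n nu (a : W) : (size mu <= n)%N ->
  degree_weight (P n.+1) d nu -> (forall i, 0 <= nu i) -> a != 0 ->
  weight_vector rho (P n.+1) nu a -> weight_vector rho (P n) (part_weight mu) a ->
  nu = part_weight mu.
Proof.
move=> szn dnu nu0 a0 anu amu; have [nuP [N nuN] nud] := dnu.
have diff i j : (i <= n)%N -> (j <= n)%N ->
    nu i - nu j = part_weight mu i - part_weight mu j.
  move=> iN jN; have [->|ij] := eqVneq i j; first by rewrite !subrr.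
  have /eqP := rep_mcoroot iN jN ij amu.
  rewrite (rep_mcoroot (P := P n.+1) _ _ ij anu) ?/P ?leqW //.
  by rewrite -subr_eq0 -scalerBl scaler_eq0 (negbTE a0) orbF subr_eq0 eqr_int => /eqP.
have mun : part_weight mu n = 0 by apply: part_weight_vanish.
have mun1 : part_weight mu n.+1 = 0 by apply: part_weight_vanish; lia.
have ge i : part_weight mu i <= nu i.
  have [iN|] := leqP i n.
    by have := diff i n iN (leqnn n); rewrite mun; have := nu0 n; lia.
  by move=> ni; rewrite part_weight_vanish //; lia.
have nuV : vanish_from n.+2 nu by move=> i ni; apply: nuP; rewrite /P; lia.
have muV : vanish_from n.+2 (part_weight mu).
  by apply: vanish_fromW part_weight_vanish; lia.
apply/funext => i; have [iN|] := ltnP i n.+2; last by move=> h; rewrite nuV ?muV.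
have [_ _ mud] : degree_weight (P n.+1) d (part_weight mu).
  by apply: part_weight_degree => j; rewrite /P; lia.
have /eqP : \sum_(0 <= j < n.+2) (nu j - part_weight mu j) = 0.
  rewrite sumrB; apply/eqP; rewrite subr_eq0.
  move: nud mud; rewrite !(pairingE _ nuV) !(pairingE _ muV).
  under eq_bigr do rewrite mul1r; under [X in _ -> X = _ -> _]eq_bigr do rewrite mul1r.
  by move=> -> ->.
rewrite psumr_eq0; last by move=> j _; rewrite subr_ge0.
move/allP/(_ i); rewrite mem_index_iota /= => /(_ iN).
by rewrite subr_eq0 => /eqP.
Qed.

(** A weight of L (n+1) that restricts to mu on sl(n+1) has the form
    mu + (c, ..., c, -(n+1) c) with nonnegative entries, hence equals mu; since
    the weight mu has multiplicity one, the highest weight vectors of L n and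
    of L (n+1) are proportional. *)
Lemma highest_vector_extends n (X X' : set W) (v v' : W) : (size mu <= n)%N ->
  highest_weight_module rho (P n) d (part_weight mu) X v ->
  highest_weight_module rho (P n.+1) d (part_weight mu) X' v' ->
  X `<=` X' -> exists c, v = c *: v'.
Proof.
move=> szn hw hw' XX'.
have := highest_span hw' (hw_in hw') (hw_neq0 hw') (hw_weight hw') (hw_degree hw')
  (hw_highest hw') (XX' _ (hw_in hw)).
set A := _ `|` _ => Av.
have torusS x : torus (K := K) (P n) x -> torus (P n.+1) x.
  by case=> xd xP; split=> //; apply: supported_mono xP => i; rewrite /P; lia.
have AT (u : W) : A u -> exists chi, eigen rho (torus (P n)) chi u.
  case=> [[c _ <-]|[[nu _ unu] _]].
    exists (weight_char (part_weight mu)); apply: eigenZ => x /torusS.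
    exact: (hw_weight hw').
  by exists (weight_char nu) => x /torusS; apply: unu.
have := eigen_in_span AT Av (hw_weight hw).
apply: (@lspan_sub _ _ _ [set u | exists c, u = c *: v']).
  split=> [|c _ _ [s ->] [t ->]]; first by exists 0; rewrite scale0r.
  by exists (c * s + t); rewrite scalerDl scalerA.
move=> u [[[c _ <-] _|[[nu [dnu _ [j ltj]] unu] X'u] umu]]; first by exists c.
have [->|u0] := eqVneq u 0; first by exists 0; rewrite scale0r.
suff E : nu = part_weight mu by rewrite E ltxx in ltj.
apply: (part_weight_of_eigen szn dnu _ u0 unu umu) => i.
apply: (weight_ge0 hw' (N := n.+1) i) => //; rewrite /P //.
- by apply: vanish_fromW part_weight_vanish; lia.
- by split=> //; exists u.
- by move=> k nk; case: dnu => h _ _; apply: h; rewrite /P; lia.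
Qed.

Lemma schur_highest_weight : simple_module rho /\ exists w0,
  highest_weight_module rho (fun=> True) d (part_weight mu) setT w0.
Proof.
have [n0 [X [v [szn0 hw XS Xsurj]]]] := schur_filtration.
have Xmono n m : (n0 <= n)%N -> (n <= m)%N -> X n `<=` X m.
  move=> n0n /subnK <-; elim: (m - n)%N => // k IHk.
  by apply: subset_trans IHk _; rewrite addSn; apply: XS; lia.
have prop n : (n0 <= n)%N -> exists c, v n0 = c *: v n.
  elim: n => [|n IHn] n0n.
    by exists 1; rewrite scale1r; congr (v _); lia.
  move: n0n; rewrite leq_eqVlt => /orP[/eqP->|n0n]; first by exists 1; rewrite scale1r.
  have [c ->] := IHn n0n.
  have [c' ->] := highest_vector_extends (leq_trans szn0 n0n) (hw _ n0n)
    (hw n.+1 (leqW n0n)) (XS _ n0n).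
  by exists (c * c'); rewrite scalerA.
have simple (Y : set W) : subspace Y -> stable rho setT Y ->
    (exists2 y, Y y & y != 0) -> Y = setT.
  move=> sY Ystable [y Yy y0]; apply/seteqP; split=> // w _.
  have [n n0n Xw] := Xsurj w; have [m n0m Xy] := Xsurj y.
  pose k := maxn n m; have n0k : (n0 <= k)%N by rewrite /k; lia.
  suff /(_ w) : X k `<=` Y `&` X k.
    by case=> //; apply: Xmono Xw => //; rewrite /k leq_maxl.
  apply: (hw_simple (hw k n0k)).
  - by apply: subspaceI => //; apply: hw_subspace (hw k n0k).
  - by move=> ? [].
  - move=> x u xP [Yu Xu]; split; first exact: Ystable.
    exact: (hw_stable (hw k n0k)).
  - exists y => //; split=> //; apply: Xmono Xy => //; rewrite /k leq_maxr //.
split.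
  split; first by exists (v n0); apply: hw_neq0 (hw n0 (leqnn n0)).
  move=> N /submoduleE[sN NT]; have [[y [Ny y0]]|nex] := pselect (exists y, N y /\ y != 0).
    by right; apply: simple => //; exists y.
  left; apply/seteqP; split=> y; last by move=> ->; case: sN.
  by move=> Ny; apply: contrapT => /eqP y0; apply: nex; exists y.
exists (v n0); split=> //.
- exact: part_weight_noninc.
- exact: part_weight_degree.
- move=> Y sY _ Ystable Y0 u _; rewrite (simple Y) //.
  by move=> x w _; apply: Ystable; apply: supported_all.
- exact: hw_neq0 (hw n0 (leqnn n0)).
- move=> x [xd _]; have [N xN] := supported_bounded x.
  have n0m : (n0 <= maxn n0 N)%N by lia.
  have [c ->] := prop _ n0m; rewrite rep_actZ (hw_weight (hw _ n0m)); last first.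
    by split=> //; apply: xN; lia.
  by rewrite !scalerA mulrC.
- move=> a b ab _; have n0m : (n0 <= maxn n0 b)%N by lia.
  have [c ->] := prop _ n0m; rewrite rep_actZ (hw_highest (hw _ n0m)) ?scaler0 //.
  by rewrite /P; lia.
Qed.

End SchurHighestWeight.

(** * The weights of a Schur module *)

Section SchurWeights.
Variables (K : numFieldType) (mu : seq nat).
Hypothesis mu_partition : is_partition mu.
Variables (W : lmodType K) (rho : lieRep (slinf K) W) (w0 : W).
Local Open Scope classical_set_scope.
Local Notation e a b := (rho (munit a b)).
Local Notation all_indices := (fun=> True).
Local Notation d := ((sumn mu)%:Z).
Hypothesis hw :
  highest_weight_module rho all_indices d (part_weight mu) setT w0.
Implicit Types (nu : nat -> int) (s : seq nat).

Definition schur_weight nu := is_weight rho all_indices d setT nu.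

Let ex_index : exists i : nat, (fun=> True) i. Proof. by exists 0%N. Qed.

Lemma schur_weight_ge0 nu i : schur_weight nu -> 0 <= nu i.
Proof.
move=> nuw; have [[_ [N nuN] _] _] := nuw.
apply: (weight_ge0 hw (N := maxn N (size mu)) i) => //.
  by apply: vanish_fromW (@part_weight_vanish mu); lia.
by apply: vanish_fromW nuN; lia.
Qed.

Lemma schur_weight_step nu a b v : degree_weight all_indices d nu ->
  weight_vector rho all_indices nu v -> e a b v != 0 ->
  schur_weight (add_root nu a b).
Proof.
move=> dnu vnu ev0; split; first exact: degree_add_root.
by exists (e a b v) => //; apply: weight_vector_munit.
Qed.

Lemma schur_weight_swap nu a b : schur_weight nu -> schur_weight (nu \o swap a b).
Proof.
move=> nuw; wlog le : a b / nu b <= nu a => [th|].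
  by have [|/ltW] := leP (nu b) (nu a); [|rewrite swapC]; apply: th.
have [->|ab] := eqVneq a b; first by rewrite swapxx.
have [dnu [v [_ v0] vnu]] := nuw; split; first exact: degree_swap.
have vr : iter `|nu b|.+1 (e a b) v = 0.
  apply/eqP; apply: contraT => vr0; set r := `|_|.+1 in vr0.
  have : schur_weight (iter r (fun nu => add_root nu a b) nu).
    split; first exact: degree_iter.
    by exists (iter r (e a b) v) => //; apply: weight_vector_iter.
  move/(schur_weight_ge0 b); rewrite iter_add_rootE eqxx [b == a]eq_sym (negbTE ab).
  by rewrite /r; lia.
have [//|//|m [n [u0 unu]]] := reflect_weight _ _ ab le v0 vnu vr.
by exists (iter m (e b a) (iter n (e a b) v)).
Qed.

Lemma schur_weight_swapE nu a b :
  schur_weight (nu \o swap a b) <-> schur_weight nu.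
Proof.
split=> [/(schur_weight_swap a b)|]; last exact: schur_weight_swap.
by congr schur_weight; apply/funext => i /=; rewrite swapK.
Qed.

(** Transpositions carry any list of distinct indices to any other. *)
Lemma schur_weight_relabel (x y : seq nat) : uniq x -> uniq y -> size x = size y ->
  exists sigma : nat -> nat, [/\ injective sigma,
    forall j, (j < size x)%N -> sigma (nth 0%N x j) = nth 0%N y j &
    forall nu, schur_weight (nu \o sigma) <-> schur_weight nu].
Proof.
move=> ux uy sxy; have := leqnn (size x); move: {-2}(size x) => t.
elim: t => [|t IHt] tx; first by exists id; split.
have [sigma [s_inj sxyE sW]] := IHt (ltnW tx).
set c := sigma (nth 0%N x t); set y' := nth 0%N y t.
have swap_inj : injective (swap c y') := inv_inj (swapK c y').
exists (swap c y' \o sigma); split.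
- exact: inj_comp.
- move=> j; rewrite ltnS leq_eqVlt => /orP[/eqP->|jt] /=.
    by rewrite /swap eqxx.
  have jx : (j < size x)%N := ltn_trans jt tx.
  rewrite sxyE // /swap.
  have -> : (nth 0%N y j == c) = false.
    by rewrite -sxyE // /c (inj_eq s_inj) nth_uniq ?(ltn_eqF jt).
  have tjF : (nth 0%N y j == y') = false.
    by rewrite /y' nth_uniq ?(ltn_eqF jt) -?sxy.
  by rewrite tjF.
- move=> nu; exact: iff_trans (sW (nu \o swap c y')) (schur_weight_swapE nu c y').
Qed.

(** After relabelling, nu is supported on the first t = size s indices; were t
    less than the number of parts, the t-th partial sum |mu| of nu would exceed
    that of mu. *)
Lemma schur_weight_support nu s : schur_weight nu -> uniq s ->
  (forall i, nu i != 0 -> i \in s) -> (size mu <= size s)%N.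
Proof.
move=> nuw us snu; rewrite leqNgt; apply/negP => lt; set t := size s in lt.
have [sigma [s_inj sE sW]] := schur_weight_relabel (iota_uniq 0 t) us (size_iota 0 t).
rewrite size_iota in sE; have nusw : schur_weight (nu \o sigma) by apply/sW.
have vt : vanish_from t (nu \o sigma).
  move=> m tm /=; apply/eqP; apply: contraT => /snu.
  move/(nthP 0%N) => [j jt]; rewrite -sE // nth_iota // => /s_inj.
  by rewrite -/t in jt; lia.
have := partial_sum_weight hw t nusw; have [[_ _ nud] _] := nusw.
have [_ _ mud] := hw_degree hw; rewrite (partial_sum_all vt) nud -mud.
rewrite -subr_ge0 /partial_sum !(pairingE _ (@part_weight_vanish mu)) -sumrB.
rewrite (bigD1_seq t) ?iota_uniq ?mem_index_iota //= indE ltnn.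
have mut : (0 < nth 0%N mu t)%N.
  by have [_ /allP] := mu_partition; apply; apply: mem_nth.
set S := \sum_(_ <- _ | _) _; suff : S <= 0 by rewrite /part_weight; lia.
apply: sumr_le0 => i _; rewrite indE /part_weight; case: (i < t)%N; lia.
Qed.

(** The extremal weight with entries mu along s: a matrix unit that does not
    kill its weight vector would yield a negative entry, or, after
    relabelling s as 0, 1, ..., a weight above mu. *)
Lemma schur_extremal_vector s : uniq s -> size s = size mu ->
  exists nu v, [/\ degree_weight all_indices d nu, v != 0,
    weight_vector rho all_indices nu v &
    forall a b, (b \in s -> a \in take (index b s) s) -> e a b v = 0].
Proof.
move=> us sz; have [sigma [s_inj sE sW]] :=
  schur_weight_relabel us (iota_uniq 0 (size mu)) (etrans sz (esym (size_iota _ _))).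
have sigmaE j : (j < size mu)%N -> sigma (nth 0%N s j) = j.
  by move=> js; rewrite sE ?sz // nth_iota.
have muw : schur_weight (part_weight mu).
  by split; [exact: hw_degree hw|exists w0; [split=> //; exact: hw_neq0 hw|exact: hw_weight hw]].
have [dnu [v [_ v0] vnu]] : schur_weight (part_weight mu \o sigma) by apply/sW.
exists (part_weight mu \o sigma), v; split=> // a b ab_s.
apply/eqP; apply: contraT => ev0; have abw := schur_weight_step dnu vnu ev0.
have ab : a != b by apply: contraNneq ev0 => ->; rewrite munit_diag rep_zero.
have [bs|nbs] := boolP (b \in s); last first.
  have := schur_weight_ge0 b abw; rewrite /add_root eqxx [b == a]eq_sym (negbTE ab) /=.
  rewrite part_weight_vanish // leqNgt; apply: contra nbs => sb.
  by rewrite -(s_inj _ _ (sigmaE _ sb)) mem_nth // sz.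
have := ab_s bs; set l := index b s => a_l.
have ls : (l < size s)%N by rewrite index_mem.
have [j jl aE] := nthP 0%N a_l.
rewrite size_take ls in jl; rewrite nth_take // in aE.
have js : (j < size mu)%N by rewrite -sz; apply: ltn_trans jl ls.
have aj : sigma a = j by rewrite -aE sigmaE.
have bl : sigma b = l by rewrite -(nth_index 0%N bs) sigmaE // -sz.
have /sW : schur_weight (add_root (part_weight mu) j l \o sigma).
  move: abw; congr schur_weight; apply/funext => i.
  by rewrite /add_root /= -aj -bl !(inj_eq s_inj).
move/(partial_sum_weight hw j.+1); have [_ muf _] := hw_degree hw.
by rewrite partial_sum_add_root // ltnSn ltnS [(l <= j)%N]leqNgt jl /=; lia.
Qed.

Lemma schur_weights_span :
  [set: W] `<=` lspan (weight_vectors rho all_indices (degree_weight all_indices d)).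
Proof.
apply: subset_trans (highest_span hw (hw_in hw) (hw_neq0 hw) (hw_weight hw)
  (hw_degree hw) (hw_highest hw)) _.
apply: lspan_mono => w [[c _ <-]|[[nu [dnu _ _] wnu] _]]; last by exists nu.
by exists (part_weight mu); [exact: hw_degree hw|apply: eigenZ; exact: hw_weight hw].
Qed.

Let eigen_label a : weight_vectors rho all_indices (degree_weight all_indices d) a ->
  exists chi, eigen rho (torus all_indices) chi a.
Proof. by case=> nu _ anu; exists (weight_char nu). Qed.

(** W is spanned by vectors with a label, and eigenvectors for distinct
    functions chi are independent. *)
Lemma schur_eigen_weight chi v : v != 0 -> eigen rho (torus all_indices) chi v ->
  exists2 nu, degree_weight all_indices d nu &
    forall x, torus all_indices x -> chi x = weight_char nu x.
Proof.
move=> v0 ev; apply: contrapT => nex.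
have := eigen_in_span eigen_label (schur_weights_span (I : setT v)) ev.
move/lspan_eq0 => h; move/eqP: v0; apply; apply: h => a [[nu dnu anu] ea].
have [//|a0] := eqVneq a 0; case: nex; exists nu => // x xT.
have /eqP := ea x xT; rewrite anu // -subr_eq0 -scalerBl scaler_eq0 (negbTE a0) orbF.
by rewrite subr_eq0 => /eqP.
Qed.

Lemma schur_decomposition (N : set W) : subspace N ->
  stable rho (torus all_indices) N ->
  N `<=` lspan (N `&` weight_vectors rho all_indices (degree_weight all_indices d)).
Proof.
move=> sN NT w Nw.
have := eigen_decomposition eigen_label sN NT (schur_weights_span (I : setT w)) Nw.
apply: lspan_sub; first exact: subspace_lspan.
move=> a [Na [chi Aa]]; have [->|a0] := eqVneq a 0.
  by case: (subspace_lspan (N `&` weight_vectors rho all_indices (degree_weight all_indices d))).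
have ea : eigen rho (torus all_indices) chi a.
  by move: Aa; apply: lspan_sub; [exact: eigen_subspace|move=> ? []].
have [nu dnu chiE] := schur_eigen_weight a0 ea.
by apply: sub_lspan; split=> //; exists nu => // x xT; rewrite ea // chiE.
Qed.

(** * Finite-dimensionality of the weight spaces *)

Definition word_vector (l : seq (nat * nat)) : W :=
  foldr (fun p w => e p.1 p.2 w) w0 l.

Definition word_weight (l : seq (nat * nat)) : nat -> int :=
  foldr (fun p nu => add_root nu p.1 p.2) (part_weight mu) l.

Definition lowering_word (l : seq (nat * nat)) : bool := all (fun p => p.2 < p.1)%N l.

Lemma word_vector_weight l :
  weight_vector rho all_indices (word_weight l) (word_vector l).
Proof.
elim: l => [|p l IHl]; first exact: hw_weight hw.
exact: weight_vector_munit.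
Qed.

Lemma word_weight_degree l : degree_weight all_indices d (word_weight l).
Proof. by elim: l => [|p l IHl]; [exact: hw_degree hw|apply: degree_add_root]. Qed.

Lemma pairing_word w l : pairing w (word_weight l) =
  pairing w (part_weight mu) + \sum_(p <- l) (w p.1 - w p.2).
Proof.
elim: l => [|p l IHl]; first by rewrite big_nil addr0.
rewrite big_cons /= pairing_add_root; last by case: (word_weight_degree l).
by rewrite IHl -addrA [X in _ + X]addrC.
Qed.

Lemma words_span : [set: W] `<=`
  lspan [set w | exists2 l, lowering_word l & w = word_vector l].
Proof.
set A := [set w | _]; have [s0 sP] := subspace_lspan A.
apply: subset_trans (highest_generates hw (hw_in hw) (hw_neq0 hw) (hw_weight hw)
  (hw_highest hw)) _.
apply: generated_sub => //.
  move=> _ v [a [b [[ba _ _] ->]]]; move: v; apply: lspan_sub.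
    by split=> [|c u w /= Au Aw]; rewrite /= ?rep_act0 // rep_linearr; apply: sP.
  move=> _ [l low ->]; apply: sub_lspan; exists ((a, b) :: l) => //.
  by rewrite /lowering_word /= ba.
move=> _ [c _ <-]; apply: (subspaceZ _ (subspace_lspan A)).
by apply: sub_lspan; exists [::].
Qed.

(** If a letter (a, b) has N <= a, its contribution to the sum of the entries
    from a on is 1, and no letter of a lowering word contributes negatively;
    but this sum vanishes for mu and for nu. *)
Lemma word_letters N nu l : vanish_from N nu -> (size mu <= N)%N ->
  lowering_word l -> word_weight l = nu -> forall p, p \in l -> (p.1 < N)%N.
Proof.
move=> nuN muN low lnu p pl; rewrite ltnNge; apply/negP => Np.
pose w := ind (fun i => (p.1 <= i)%N).
have w0P nu' : vanish_from N nu' -> pairing w nu' = 0.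
  move=> nuN'; rewrite (pairingE _ nuN') big_nat big1 // => i /andP[_ iN].
  by rewrite /w indE leqNgt (leq_trans iN Np) mul0r.
have := pairing_word w l; rewrite lnu !w0P //; last first.
  by apply: vanish_fromW (@part_weight_vanish mu).
rewrite add0r big_seq => /esym/eqP; rewrite psumr_eq0; last first.
  by move=> q ql; rewrite /w !indE; have := allP low q ql => /=; lia.
move/allP/(_ p pl); rewrite pl /w /= !indE leqnn.
by have := allP low p pl => /=; lia.
Qed.

(** Each lowering operator raises the sum of i * nu i by at least one. *)
Lemma word_size l : lowering_word l ->
  (size l <= `|pairing (fun i => i%:Z) (word_weight l) -
               pairing (fun i => i%:Z) (part_weight mu)|)%N.
Proof.
move=> low; rewrite pairing_word addrAC subrr add0r /=.
rewrite -lez_nat abszE; apply: le_trans (ler_norm _).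
elim: l low => [|p l IHl] /=; first by rewrite big_nil.
by move=> /andP[p21 /IHl]; rewrite big_cons; lia.
Qed.

Fixpoint short_words (N B : nat) : seq W :=
  if B is B'.+1 then w0 :: [seq e p.1 p.2 w |
    p <- [seq (a, b) | a <- iota 0 N, b <- iota 0 N], w <- short_words N B']
  else [:: w0].

Lemma mem_short_words N B l : (size l <= B)%N -> lowering_word l ->
  (forall p, p \in l -> (p.1 < N)%N) -> word_vector l \in short_words N B.
Proof.
elim: l B => [|[a b] l IHl] [|B] //= sz; rewrite ?mem_head //.
move=> /andP[ba low] lN; rewrite inE; apply/orP; right.
have aN : (a < N)%N by apply: (lN (a, b)); apply: mem_head.
apply/allpairsP; exists ((a, b), word_vector l); split=> //=.
- by apply/allpairsP; exists (a, b); rewrite !mem_iota /= !add0n aN (ltn_trans ba aN).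
- by apply: IHl => // p pl; apply: lN; rewrite inE pl orbT.
Qed.

Lemma schur_weight_space_finite chi : exists s : seq W,
  forall w, eigen rho (torus all_indices) chi w -> lspan [set` s] w.
Proof.
have [[v [v0 ev]]|nex] := pselect (exists v, v != 0 /\ eigen rho (torus all_indices) chi v);
    last first.
  exists [::] => w ew; have [->|w0'] := eqVneq w 0; first by case: (@subspace_lspan _ W [set` [::]]).
  by case: nex; exists w.
have [nu dnu chiE] := schur_eigen_weight v0 ev; have [_ [N0 nuN0] _] := dnu.
pose N := maxn N0 (size mu); have nuN : vanish_from N nu.
  by apply: vanish_fromW nuN0; rewrite /N; lia.
pose B := `|pairing (fun i => i%:Z) nu - pairing (fun i => i%:Z) (part_weight mu)|%N.
exists (short_words N B) => w ew; have wnu : weight_vector rho all_indices nu w.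
  by move=> x xT; rewrite ew // chiE.
set A := [set w | exists2 l, lowering_word l & w = word_vector l].
have AC : A `<=` weight_vectors rho all_indices (degree_weight all_indices d).
  move=> _ [l _ ->]; exists (word_weight l); first exact: word_weight_degree.
  exact: word_vector_weight.
have := weight_in_span ex_index AC (fun _ h => h) dnu (words_span (I : setT w)) wnu.
apply: lspan_sub; first exact: subspace_lspan.
move=> _ [[l low ->] lP]; have [->|l0] := eqVneq (word_vector l) 0.
  by case: (subspace_lspan [set` short_words N B]).
have [_ lnu] := lP l0.
have E : word_weight l = nu.
  exact: weight_vector_unique ex_index l0 (word_weight_degree l) dnu (word_vector_weight l) lnu.
apply: sub_lspan; apply: mem_short_words => //.
  by rewrite /B -E; apply: word_size.
by apply: word_letters low E => //; rewrite /N; lia.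
Qed.

End SchurWeights.

(** * Initial lists of an admissible order *)

Section InitialLists.
Variable prec : nat -> nat -> Prop.
Hypothesis adm : admissible prec.
Implicit Types (a b m : nat) (s : seq nat).
Local Notation cl := (ord_class prec).

Definition initial_list s : Prop :=
  forall a b, b \in s -> prec a b -> a \in take (index b s) s.

Lemma ord_class_incomparable a b : ~ prec_comparable prec a b -> cl a = cl b.
Proof.
move=> nab; apply: contrapT => /(prec_adm adm) E.
have : (cl a `&` cl b)%classic b by split; [right|left].
by rewrite E.
Qed.

Lemma initial_list_rcons s m : uniq s -> m \notin s -> initial_list s ->
  (forall a, prec a m -> a \in s) -> initial_list (rcons s m).
Proof.
move=> us ms s_init m_init a b; rewrite mem_rcons inE => /orP[/eqP->|bs] ab.
  rewrite -cats1 index_cat (negbTE ms) /= eqxx addn0 take_size_cat //.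
  exact: m_init.
rewrite -cats1 index_cat bs take_cat index_mem bs.
exact: s_init.
Qed.

(** A down-closed set D on which the order is well-founded can be listed from
    below, one minimal element after the other. *)
Lemma initial_list_exists (D : nat -> Prop) (rk : nat -> nat) (x : seq nat) n :
  (forall a b, prec a b -> D b -> D a) ->
  (forall a b, D a -> D b -> prec a b -> (rk a < rk b)%N) ->
  uniq x -> (forall a, a \in x -> D a) -> (n <= size x)%N ->
  exists s, [/\ uniq s, size s = n & initial_list s].
Proof.
move=> Ddown rkD ux xD nx.
suff [s [us ss s_init _]] : exists s, [/\ uniq s, size s = n, initial_list s &
    forall a, a \in s -> D a] by exists s.
elim: n nx => [|n IHn] nx; first by exists [::].
have [s [us ss s_init sD]] := IHn (ltnW nx).
have ex_m : exists r, `[< exists m, [/\ D m, m \notin s & rk m = r] >].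
  have [/allP xs|/allPn[m mx ms]] := boolP (all (mem s) x).
    by have := uniq_leq_size ux xs; rewrite ss leqNgt nx.
  by exists (rk m); apply/asboolP; exists m; split=> //; apply: xD.
have [_ /asboolP[m [Dm ms <-]] m_min] := find_ex_minn ex_m.
exists (rcons s m); split.
- by rewrite rcons_uniq ms.
- by rewrite size_rcons ss.
- apply: initial_list_rcons => // a am; have Da := Ddown _ _ am Dm.
  apply: contraT => nas; have := rkD _ _ Da Dm am; rewrite ltnNge m_min //.
  by apply/asboolP; exists a.
- by move=> a; rewrite mem_rcons inE => /orP[/eqP->|/sD].
Qed.

(** Given the indices i, let D be the union of their classes: it is
    down-closed, and the position of a class among those of the i is a rank
    function on D. *)
Lemma initial_list_condition k :
  (exists i : 'I_k.+1 -> nat,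
    [/\ injective i,
        forall j l : 'I_k.+1, prec (i j) (i l) -> (j < l)%N &
        forall m : nat, (forall j : 'I_k.+1, m <> i j) ->
          prec (i ord_max) m \/
          exists j : 'I_k.+1, ~ prec_comparable prec m (i j)]) <->
  exists s, [/\ uniq s, size s = k.+1 & initial_list s].
Proof.
split=> [[i [i_inj i_mono i_init]]|[s [us ss s_init]]]; last first.
  have js (j : 'I_k.+1) : (j < size s)%N by rewrite ss.
  exists (fun j => nth 0%N s j); split.
  - by move=> j l /eqP; rewrite nth_uniq // => /eqP/val_inj.
  - move=> j l /(s_init _ _ (mem_nth _ (js l))); rewrite index_uniq //.
    by move/index_ltn; rewrite index_uniq.
  - move=> m nm; pose top := nth 0%N s (ord_max : 'I_k.+1).
    have [[|ml]|] := pselect (prec_comparable prec m top).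
    + move=> /(s_init _ _ (mem_nth _ (js ord_max)))/mem_take/(nthP 0%N)[j jk mE].
      by rewrite ss in jk; case: (nm (Ordinal jk)).
    + by left.
    + by right; exists ord_max.
pose D m := exists j, cl m = cl (i j).
pose rk m := if pselect (D m) is left Dm then val (projT1 (cid Dm)) else 0%N.
apply: (@initial_list_exists D rk (codom i)).
- move=> a b ab [l bl]; have [[j ->]|ni] := pselect (exists j, a = i j); first by exists j.
  have [j|la|[j /ord_class_incomparable]] := i_init a; first by move=> aj; apply: ni; exists j.
    have /i_mono := prec_classr adm (prec_trans adm la ab) bl.
    by rewrite ltnNge -ltnS ltn_ord.
  by exists j.
- move=> a b Da Db ab; rewrite /rk; case: pselect => // Da'; case: pselect => // Db'.
  case: cid => j aj; case: cid => l bl /=; apply: i_mono.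
  by apply: prec_classl (esym aj) _ => //; apply: prec_classr ab bl.
- exact/injectiveP.
- by move=> a /codomP[j ->]; exists j.
- by rewrite size_codom card_ord.
Qed.

End InitialLists.

(** * Induced modules *)

Section Induced.
Variables (K : fieldType) (L : lieAlgType K) (k : subalgebra L).
Variables (S : lmodType K) (tau : lieRep k S).

Definition induced_one (s : S) : induced tau := tpure _ _ 1 s.

Lemma induced_one_linear a s s' :
  induced_one (a *: s + s') = a *: induced_one s + induced_one s'.
Proof. exact: tpure_linearr. Qed.

Lemma induced_one0 : induced_one 0 = 0.
Proof.
have := induced_one_linear 1 0 0; rewrite scaler0 addr0 scale1r => /eqP.
by rewrite -subr_eq0 opprD addNKr oppr_eq0 => /eqP.
Qed.

Lemma induced_act_one (x : k) s :
  induced_rep tau (val x) (induced_one s) = induced_one (tau x s).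
Proof.
rewrite /= /induced_one induced_act_pure mulr1.
have -> : uea_gen (val x) = 1 * uea_map (uea_gen x).
  by rewrite mul1r /uea_gen uea_mapE.
rewrite tpure_balanced; congr (tpure _ _ _ _).
by rewrite /uea_gen uea_actE.
Qed.

Lemma induced_uterm t (u : uea L) s :
  uterm_act (induced_rep tau) t (tpure _ _ u s : induced tau) =
  tpure _ _ (\pi_(uea L)%qT t * u) s.
Proof.
pose tp (u : uea L) s : induced tau := tpure _ _ u s.
have tpP a m m' s' : tp (a *: m + m') s' = a *: tp m s' + tp m' s'.
  exact: tpure_linearl.
have tp0 s' : tp 0 s' = 0.
  have := tpP 1 0 0 s'; rewrite scaler0 addr0 scale1r => /eqP.
  by rewrite -subr_eq0 opprD addNKr oppr_eq0 => /eqP.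
have tpZ a m s' : tp (a *: m) s' = a *: tp m s' by rewrite -[_ *: _]addr0 tpP tp0 addr0.
have tpD m m' s' : tp (m + m') s' = tp m s' + tp m' s' by rewrite -[m]scale1r tpP !scale1r.
rewrite -/(tp _ _) -[RHS]/(tp _ _).
elim: t u s => [x|||t IHt|a t IHt|t IHt t' IHt'|t IHt t' IHt'] u s /=.
- exact: induced_act_pure.
- by have -> : \pi_(uea L)%qT (UZero L) = 0 by []; rewrite mul0r tp0.
- by have -> : \pi_(uea L)%qT (UOne L) = 1 by []; rewrite mul1r.
- have -> : \pi_(uea L)%qT (UOpp t) = (-1) *: \pi_(uea L)%qT t.
    by rewrite scaleN1r -uea_oppE.
  by rewrite IHt -scalerAl tpZ scaleN1r.
- by rewrite IHt -uea_scaleE -[uea_scale _ _]/(a *: \pi_(uea L)%qT t) -scalerAl tpZ.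
- rewrite IHt IHt' -uea_addE -[uea_add _ _]/(\pi_(uea L)%qT t + \pi_(uea L)%qT t').
  by rewrite mulrDl tpD.
- rewrite IHt' IHt -uea_mulE -[uea_mul _ _]/(\pi_(uea L)%qT t * \pi_(uea L)%qT t').
  by rewrite mulrA.
Qed.

Lemma induced_generated (N : set (induced tau)) : subspace N ->
  stable (induced_rep tau) setT N -> (forall s, N (induced_one s)) ->
  forall t, N t.
Proof.
move=> sN NT N1; elim/tensor_ind => [u s||a t u Nt Nu]; [|by case: sN|by case: sN => _; apply].
elim/quotW: u => u; rewrite -[\pi_(uea L)%qT u]mulr1 -induced_uterm.
have := N1 s; rewrite /induced_one; move: (tpure _ _ 1 s : induced tau).
elim: u =>
    [x|||t IHt|a t IHt|t IHt t' IHt'|t IHt t' IHt'] v Nv /=.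
- exact: (NT x v I Nv).
- by case: sN.
- by [].
- by rewrite -scaleN1r; apply: subspaceZ => //; apply: IHt.
- by apply: subspaceZ => //; apply: IHt.
- by apply: subspaceD => //; [apply: IHt|apply: IHt'].
- by apply: IHt; apply: IHt'.
Qed.

End Induced.

(** * Aligned modules contain vectors killed by the nilradical *)

Section AlignedSingular.
Variables (K : numFieldType) (prec : nat -> nat -> Prop) (adm : admissible prec).
Variables (W : lmodType K) (rho : lieRep (slinf K) W).
Local Open Scope classical_set_scope.

Definition singular : set W :=
  [set w | forall a b, prec a b -> rho (munit a b) w = 0].

Lemma singular_subspace : subspace singular.
Proof.
split=> [a b _|c u v su sv a b ab]; first exact: rep_act0.
by rewrite rep_linearr su // sv // scaler0 addr0.
Qed.

Lemma nilradical_munit a b : prec a b -> nilradical prec (munit a b : slinf K).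
Proof.
move=> ab; have ne : a != b by apply/eqP => E; rewrite E in ab; case: (prec_irr adm ab).
by apply: sub_lspan; exists a, b; split=> //; [apply/eqP|apply: munit_val].
Qed.

Lemma aligned_singular : aligned adm rho -> exists2 w, singular w & w != 0.
Proof.
move=> [[[w0 w00] _] _ [S [sigma [tau [_ _ [_ tau_nil] [f [f_eq f_surj _ _]]]]]]].
apply: contrapT => nex.
have f1 s : f (induced_one tau s) = 0.
  apply: contrapT => /eqP f1; apply: nex; exists (f (induced_one tau s)) => // a b ab.
  have abN := nilradical_munit ab.
  have abP : munit a b \in subalg_set (parabolic K adm).
    by rewrite in_setE; apply: sub_lspan; right.
  have := induced_act_one tau (SubalgElt abP) s.
  rewrite tau_nil // => /(congr1 f); rewrite f_eq /= => ->.
  by rewrite induced_one0 linear0.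
have [t _ ft] : range f w0 by rewrite f_surj.
move: w00; rewrite -ft; apply/negP/negPn/eqP.
apply: (induced_generated (N := fun t => f t = 0)) => //.
- by split=> [|a u v /= fu fv]; rewrite ?linear0 // linearP fu fv scaler0 addr0.
- by move=> x u _ /= fu; rewrite f_eq fu rep_act0.
Qed.

Lemma singular_stable_torus : stable rho (torus (fun=> True)) singular.
Proof.
move=> x w [xd _] sw a b ab; rewrite rep_comm sw // rep_act0 add0r.
have -> : lie (munit a b) x = (- (val x a a - val x b b)) *: munit a b.
  rewrite scaleNr -lie_diag_munit //; apply: sl_eq => i j.
  rewrite -[RHS]/(- val (lie x (munit a b)) i j) !sl_lieE !finmxDE !finmxNE.
  by rewrite opprB addrC.
by rewrite rep_scale sw // scaler0.
Qed.

End AlignedSingular.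

Section SingularWeights.
Variables (K : numFieldType) (mu : seq nat).
Hypothesis mu_partition : is_partition mu.
Variables (W : lmodType K) (rho : lieRep (slinf K) W) (w0 : W).
Local Open Scope classical_set_scope.
Local Notation e a b := (rho (munit a b)).
Local Notation all_indices := (fun=> True).
Local Notation d := ((sumn mu)%:Z).
Hypothesis hw :
  highest_weight_module rho all_indices d (part_weight mu) setT w0.
Variables (prec : nat -> nat -> Prop) (adm : admissible prec).

(** Let v be singular of weight nu, and a before b with nu a = 0. Then
    E b a v is zero too, as its weight has a negative entry; so [E a b, E b a]
    kills v, and nu b = nu a = 0: the support of nu is down-closed. *)
Lemma singular_initial_list w : singular prec rho w -> w != 0 ->
  exists s, [/\ uniq s, size s = size mu & initial_list prec s].
Proof.
move=> sw w0'; have [v [[sv [nu dnu vnu]] v0]] : exists v,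
    (singular prec rho `&` weight_vectors rho all_indices (degree_weight all_indices d)) v
    /\ v != 0.
  apply: contrapT => nex; move/eqP: w0'; apply.
  have := schur_decomposition hw (singular_subspace prec rho)
    (@singular_stable_torus _ prec _ rho) sw.
  move/lspan_eq0; apply=> v vP.
  by apply: contrapT => /eqP v0; apply: nex; exists v.
have nuw : schur_weight mu rho nu by split=> //; exists v.
have down a b : prec a b -> nu b != 0 -> nu a != 0.
  move=> ab; apply: contra => /eqP nua.
  have ne : a != b by apply/eqP => E; rewrite E in ab; case: (prec_irr adm ab).
  have eba : e b a v = 0.
    apply/eqP; apply: contraT => /(schur_weight_step dnu vnu).
    move/(schur_weight_ge0 hw a); rewrite /add_root eqxx (negbTE ne) nua; lia.
  have := rep_mcoroot (I : all_indices a) (I : all_indices b) ne vnu.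
  rewrite rep_lie eba (sv _ _ ab) !rep_act0 subrr => /esym/eqP.
  rewrite scaler_eq0 (negbTE v0) orbF intr_eq0 nua; lia.
have [_ [N nuN] _] := dnu.
have [x xP ux] : exists2 x, forall i, (i \in x) = (nu i != 0) & uniq x.
  exists [seq i <- iota 0 N | nu i != 0]; last by rewrite filter_uniq ?iota_uniq.
  move=> i; rewrite mem_filter mem_iota /= add0n; case: eqP => //= nui.
  by rewrite ltnNge; apply/negP => /nuN.
apply: (initial_list_exists (D := fun i => nu i != 0)
  (rk := fun b => count (fun a => `[< prec a b >]) x) (x := x)) => //.
- move=> a b xa xb ab; rewrite -!size_filter.
  have sub : {subset a :: [seq c <- x | `[< prec c a >]] <= [seq c <- x | `[< prec c b >]]}.
    move=> c; rewrite inE !mem_filter => /orP[/eqP->|/andP[/asboolP ca ->]].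
      by rewrite xP xa andbT; apply/asboolP.
    by rewrite andbT; apply/asboolP; apply: (prec_trans adm) ca ab.
  apply: uniq_leq_size sub; rewrite /= mem_filter filter_uniq // andbT.
  by apply/negP => /andP[/asboolP/(prec_irr adm)].
- by move=> a; rewrite xP.
- by apply: (schur_weight_support mu_partition hw nuw) => // i; rewrite xP.
Qed.

End SingularWeights.

(** * Submodules as modules *)

Lemma linear_exists (K : fieldType) (U V : lmodType K) (f : U -> V) :
  (forall a u v, f (a *: u + v) = a *: f u + f v) ->
  exists g : {linear U -> V}, g =1 f.
Proof.
move=> fP; pose F : {linear U -> V} := HB.pack f (GRing.isLinear.Build K U V *:%R f fP).
by exists F.
Qed.

Lemma scalar_exists (K : fieldType) (U : lmodType K) (f : U -> K) :
  (forall a u v, f (a *: u + v) = a * f u + f v) ->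
  exists g : {scalar U}, g =1 f.
Proof.
move=> fP; pose F : {scalar U} := HB.pack f (GRing.isLinear.Build K U K *%R f fP).
by exists F.
Qed.

(** Bundling a subspace lets its carrier type have a module structure. *)
Record subspace_of (K : fieldType) (V : lmodType K) := SubspaceOf {
  subspace_set : set V;
  subspace_setP : subspace subspace_set
}.

Record subspace_sort (K : fieldType) (V : lmodType K) (N : subspace_of V) :
  Type := SubspaceElt { subspace_val : V; _ : subspace_val \in subspace_set N }.

Section SubspaceType.
Variables (K : fieldType) (V : lmodType K) (N : subspace_of V).

HB.instance Definition _ := [isSub for @subspace_val K V N].
HB.instance Definition _ := [Choice of subspace_sort N by <:].

Lemma subspace_closed : GRing.subsemimod_closed (mem (subspace_set N)).
Proof.
have sN := subspace_setP N; split; first split.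
- by rewrite in_setE; case: sN.
- by move=> u v; rewrite !in_setE; apply: subspaceD.
- by move=> a v; rewrite !in_setE; apply: subspaceZ.
Qed.

HB.instance Definition _ :=
  GRing.SubChoice_isSubLmodule.Build K V _ (subspace_sort N) subspace_closed.

End SubspaceType.

Section Restriction.
Variables (K : fieldType) (L : lieAlgType K) (V : lmodType K) (rho : lieRep L V).
Variables (h : subalgebra L) (N : subspace_of V).
Hypothesis hN : stable rho (subalg_set h) (subspace_set N).

Definition restrict_act (x : h) (s : subspace_sort N) : subspace_sort N :=
  SubspaceElt (mem_set (hN (set_mem (valP x)) (set_mem (valP s)))).

Lemma restrict_linearl a x y s :
  restrict_act (a *: x + y) s = a *: restrict_act x s + restrict_act y s.
Proof. by apply: val_inj; rewrite /= rep_linearl. Qed.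

Lemma restrict_linearr x a s t :
  restrict_act x (a *: s + t) = a *: restrict_act x s + restrict_act x t.
Proof. by apply: val_inj; rewrite /= rep_linearr. Qed.

Lemma restrict_lie x y s : restrict_act (lie x y) s =
  restrict_act x (restrict_act y s) - restrict_act y (restrict_act x s).
Proof. by apply: val_inj; rewrite /= rep_lie. Qed.

Definition restrict_rep : lieRep h (subspace_sort N) :=
  LieRep restrict_linearl restrict_linearr restrict_lie.

End Restriction.

(** * The universal property of an induced module *)

Section InducedMap.
Variables (K : fieldType) (L : lieAlgType K) (k : subalgebra L).
Variables (S : lmodType K) (tau : lieRep k S).
Variables (W : lmodType K) (rho : lieRep L W) (j : {linear S -> W}).
Hypothesis j_eq : forall (x : k) s, j (tau x s) = rho (val x) (j s).

Lemma uea_act_linear a (p q : uea L) w :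
  uea_act rho (a *: p + q) w = a *: uea_act rho p w + uea_act rho q w.
Proof.
elim/quotW: p => p; elim/quotW: q => q.
rewrite -[X in uea_act rho X _]/(uea_add (uea_scale a (\pi_(uea L)%qT p)) (\pi_(uea L)%qT q)).
by rewrite uea_scaleE uea_addE !uea_actE.
Qed.

Lemma uea_act_mul (p q : uea L) w :
  uea_act rho (p * q) w = uea_act rho p (uea_act rho q w).
Proof.
elim/quotW: p => p; elim/quotW: q => q.
rewrite -[X in uea_act rho X _]/(uea_mul (\pi_(uea L)%qT p) (\pi_(uea L)%qT q)).
by rewrite uea_mulE !uea_actE.
Qed.

Lemma uea_act_map (p : uea k) s :
  uea_act rho (uea_map p) (j s) = j (uea_act tau p s).
Proof.
have act_act0 w : uea_act rho 0 w = 0.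
  by have -> : 0 = \pi_(uea L)%qT (UZero L) by []; rewrite uea_actE.
have act_actZ a q w : uea_act rho (a *: q) w = a *: uea_act rho q w.
  by rewrite -[a *: q]addr0 uea_act_linear act_act0 addr0.
elim/quotW: p => p; rewrite uea_mapE uea_actE.
elim: p s => [x|||t IHt|a t IHt|t IHt t' IHt'|t IHt t' IHt'] s /=.
- by rewrite /uea_gen uea_actE /= j_eq.
- by rewrite linear0.
- by have -> : 1 = \pi_(uea L)%qT (UOne L) by []; rewrite uea_actE.
- by rewrite -[- uterm_map t]scaleN1r act_actZ IHt scaleN1r linearN.
- by rewrite act_actZ IHt linearZ.
- by rewrite -[uterm_map t]scale1r uea_act_linear IHt IHt' scale1r linearD.
- by rewrite uea_act_mul IHt' IHt.
Qed.

Fixpoint induced_term_map (t : tterm (uea L) S) : W :=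
  match t with
  | TPure u s => uea_act rho u (j s)
  | TZero => 0
  | TOpp t => - induced_term_map t
  | TScale a t => a *: induced_term_map t
  | TAdd t u => induced_term_map t + induced_term_map u
  end.

Lemma induced_term_map_cong t u :
  tcong (fun (u : uea L) (p : uea k) => u * uea_map p) (uea_act tau) t u ->
  induced_term_map t = induced_term_map u.
Proof.
elim=> //= {t u}; try by move=> *; congruence.
- by move=> *; rewrite addrA.
- by move=> *; rewrite addrC.
- by move=> *; rewrite add0r.
- by move=> *; rewrite addNr.
- by move=> *; rewrite scalerA.
- by move=> *; rewrite scale1r.
- by move=> *; rewrite scalerDr.
- by move=> *; rewrite scalerDl.
- by move=> *; rewrite uea_act_linear.
- by move=> *; rewrite linearP; apply: uterm_act_linear.
- by move=> m p s; rewrite uea_act_mul uea_act_map.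
Qed.

Lemma induced_map : exists f : {linear induced tau -> W},
  equivariant (induced_rep tau) rho f /\ forall s, f (induced_one tau s) = j s.
Proof.
pose f0 (t : induced tau) : W := induced_term_map (repr t).
have f0E t : f0 (\pi_(induced tau)%qT t) = induced_term_map t.
  exact/induced_term_map_cong/tcong_repr.
have f0P a t u : f0 (a *: t + u) = a *: f0 t + f0 u.
  elim/quotW: t => t; elim/quotW: u => u.
  by rewrite -tensor_piZ -tensor_piD !f0E.
have [f fE] := linear_exists f0P; exists f; split.
- move=> x t; rewrite !fE; elim/tensor_ind: t => [u s||a t u IHt IHu].
  + rewrite /= induced_act_pure !f0E /= uea_act_mul.
    by rewrite /uea_gen uea_actE.
  + by rewrite rep_act0 -fE linear0 rep_act0.
  + by rewrite rep_linearr !f0P IHt IHu rep_linearr.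
- move=> s; rewrite fE f0E /=.
  by have -> : 1 = \pi_(uea L)%qT (UOne L) by []; rewrite uea_actE.
Qed.

End InducedMap.

(** * A singular weight vector makes the module aligned *)

Section SingularAligned.
Variables (K : numFieldType) (mu : seq nat).
Variables (W : lmodType K) (rho : lieRep (slinf K) W) (w0 : W).
Local Open Scope classical_set_scope.
Local Notation g := (slinf K).
Local Notation e a b := (rho (munit a b)).
Local Notation all_indices := (fun=> True).
Local Notation d := ((sumn mu)%:Z).
Hypothesis hw :
  highest_weight_module rho all_indices d (part_weight mu) setT w0.
Hypothesis rho_simple : simple_module rho.
Variables (prec : nat -> nat -> Prop) (adm : admissible prec).
Local Notation cl := (ord_class prec).
Local Notation p := (parabolic K adm).
Local Notation l := (levi K prec).
Variables (nu0 : nat -> int) (v0 : W).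
Hypothesis dnu0 : degree_weight all_indices d nu0.
Hypothesis v0_neq0 : v0 != 0.
Hypothesis v0_weight : weight_vector rho all_indices nu0 v0.
Hypothesis v0_singular : singular prec rho v0.
Implicit Types (nu : nat -> int) (a b c : nat).

Let ex_index : exists i : nat, (fun=> True) i. Proof. by exists 0%N. Qed.

(** The roots of l preserve these sums, and the roots opposite to u lower them:
    this separates 1 (x) S from the rest of the induced module. *)
Definition class_sum c nu : int :=
  pairing (ind (fun i => prec i c \/ cl i = cl c)) nu.

Definition same_weight : set (nat -> int) :=
  [set nu | degree_weight all_indices d nu /\
    forall c, class_sum c nu = class_sum c nu0].

Definition below_weight : set (nat -> int) :=
  [set nu | [/\ degree_weight all_indices d nu,
    forall c, class_sum c nu <= class_sum c nu0 &
    exists c, class_sum c nu < class_sum c nu0]].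

Lemma same_weight0 : same_weight nu0. Proof. by []. Qed.

Lemma class_sum_levi c nu a b : cl a = cl b -> (exists N, vanish_from N nu) ->
  class_sum c (add_root nu a b) = class_sum c nu.
Proof.
move=> ab nuf; rewrite /class_sum pairing_add_root // /ind.
suff -> : `[< prec a c \/ cl a = cl c >] = `[< prec b c \/ cl b = cl c >].
  by rewrite subrr addr0.
apply: asbool_equiv_eq; rewrite ab; split=> -[h|h]; [left| by right|left|by right].
  exact: prec_classl (esym ab) h.
exact: prec_classl ab h.
Qed.

Lemma below_weight_step nu a b : same_weight nu \/ below_weight nu -> prec b a ->
  below_weight (add_root nu a b).
Proof.
move=> nuP ba; have dnu : degree_weight all_indices d nu by case: nuP => -[].
have [_ nuf _] := dnu.
have le c : class_sum c nu <= class_sum c nu0.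
  by case: nuP => [[_ h]|[_ h _]]; [rewrite h|apply: h].
have step c : class_sum c (add_root nu a b) =
    class_sum c nu + (`[< prec a c \/ cl a = cl c >]%:Z - `[< prec b c \/ cl b = cl c >]%:Z).
  by rewrite /class_sum pairing_add_root.
split; first exact: degree_add_root.
  move=> c; rewrite step; have := le c.
  case: asboolP => [[ac|ac]|_]; last by case: asboolP => _; lia.
    by rewrite asboolT; [lia|left; apply: (prec_trans adm) ba ac].
  by rewrite asboolT; [lia|left; apply: prec_classr ba ac].
exists b; rewrite step asboolF; last first.
  case=> [ab|ab]; first exact: (prec_irr adm) (prec_trans adm ab ba).
  exact: (prec_class_neq adm ba) (esym ab).
by rewrite asboolT; [have := le b; lia|right].
Qed.

Lemma same_below nu : same_weight nu -> ~ below_weight nu.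
Proof. by move=> [_ E] [_ _ [c]]; rewrite E ltxx. Qed.

Lemma levi_sub x : subalg_set l x -> subalg_set p x.
Proof. by move=> lx; apply: sub_lspan; left. Qed.

Lemma cartan_torus x : subalg_set (cartan K) x <-> torus all_indices x.
Proof. by split=> [xd|[]//]; split=> //; apply: supported_all. Qed.

Lemma torus_levi x : torus all_indices x -> subalg_set l x.
Proof. by move=> /cartan_torus xh; apply: sub_lspan; left. Qed.

Lemma nilradical_zero (N : set W) : N `<=` singular prec rho ->
  forall x w, nilradical prec x -> N w -> rho x w = 0.
Proof.
move=> Nsing x w xn Nw; move: x xn; apply: lspan_sub.
  split=> [|a y z /= y0 z0]; first by rewrite /= rep_zero.
  by rewrite rep_linearl y0 z0 scaler0 addr0.
move=> x [a [b [ab pab xE]]]; have -> : x = munit a b.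
  by apply: val_inj; rewrite /= xE munit_val //; apply/eqP.
exact: (Nsing _ Nw).
Qed.

(** Only the Levi part has to be checked, as u kills singular vectors. *)
Lemma stable_parabolic (N : set W) : subspace N -> N `<=` singular prec rho ->
  stable rho (torus all_indices) N ->
  (forall a b w, cl a = cl b -> a != b -> N w -> N (e a b w)) ->
  stable rho (subalg_set p) N.
Proof.
move=> sN Nsing NT Nl; apply: stable_lspan => // x w [|xn] Nw; last first.
  by rewrite (nilradical_zero Nsing xn Nw); case: sN.
move: x w Nw; suff : stable rho (subalg_set l) N by move=> h x w Nw lx; apply: h.
apply: stable_lspan => // x w [/cartan_torus xT|[a [b [ab clab xE]]]] Nw.
  exact: NT.
have -> : x = munit a b by apply: val_inj; rewrite /= xE munit_val //; apply/eqP.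
by apply: Nl => //; apply/eqP.
Qed.

Lemma singular_levi a b w : cl a = cl b -> a != b -> singular prec rho w ->
  singular prec rho (e a b w).
Proof.
move=> clab ab sw c d' cd; rewrite rep_comm sw // rep_act0 add0r.
have ne : c != d' by apply/eqP => E; rewrite E in cd; case: (prec_irr adm cd).
rewrite lie_munit //; last first.
  rewrite xpair_eqE; apply/negP => /andP[/eqP cb /eqP da].
  by apply: (prec_class_neq adm cd); rewrite cb da clab.
rewrite addrC -scaleNr rep_linearl rep_scale.
have -> : (- (b == c)%:R) *: rho (munit a d') w = 0.
  have [bc|_] := eqVneq b c; last by rewrite oppr0 scale0r.
  by rewrite sw ?scaler0 //; apply: prec_classl clab _; rewrite // bc.
have [da|_] := eqVneq d' a; last by rewrite scale0r addr0.
by rewrite sw ?scaler0 ?addr0 //; apply: prec_classr cd _; rewrite // da.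
Qed.

(** The module S to induce from. The weights of the p-module generated by v0
    have the class sums of nu0 by construction. *)
Definition top : set W := generated rho (subalg_set p) [set v0].

Let box : set W := lspan (weight_vectors rho all_indices same_weight `&` singular prec rho).

Let top_subspace : subspace top.
Proof. exact: subspace_generated. Qed.

Let top_stable : stable rho (subalg_set p) top.
Proof. exact: generated_stable. Qed.

Let top_v0 : top v0.
Proof. exact: sub_generated. Qed.

Lemma top_box : top `<=` box.
Proof.
have sbox : subspace box := @subspace_lspan _ _ _.
have box_sing : box `<=` singular prec rho.
  by apply: lspan_sub; [exact: singular_subspace|move=> ? []].
apply: generated_sub => //; last first.
  move=> _ ->; apply: sub_lspan; split=> //; exists nu0 => //; exact: same_weight0.
apply: stable_parabolic => //.
- move=> x w xT; move: w; apply: lspan_sub.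
    split=> [|c u w /= bu bw]; rewrite /= ?rep_act0 ?rep_linearr; case: sbox => //.
    by move=> _; apply.
  move=> w [[nu nus wnu] ws]; rewrite wnu //; apply: (subspaceZ _ sbox).
  by apply: sub_lspan; split=> //; exists nu.
- move=> a b w clab ab; move: w; apply: lspan_sub.
    split=> [|c u w /= bu bw]; rewrite /= ?rep_act0 ?rep_linearr; case: sbox => //.
    by move=> _; apply.
  move=> w [[nu [dnu nus] wnu] ws]; apply: sub_lspan; split; last exact: singular_levi.
  exists (add_root nu a b); last exact: weight_vector_munit.
  split; first exact: degree_add_root.
  by move=> c; rewrite class_sum_levi //; case: dnu.
Qed.

Lemma top_singular : top `<=` singular prec rho.
Proof.
by apply: subset_trans top_box _; apply: lspan_sub; [exact: singular_subspace|move=> ? []].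
Qed.

Let top_torus : stable rho (torus all_indices) top.
Proof. by move=> x w /torus_levi/levi_sub; apply: top_stable. Qed.

Lemma top_weights (N : set W) : subspace N -> stable rho (torus all_indices) N ->
  N `<=` top -> N `<=` lspan (N `&` weight_vectors rho all_indices same_weight).
Proof.
move=> sN NT Ntop; apply: subset_trans (schur_decomposition hw sN NT) _.
set A := N `&` weight_vectors _ _ same_weight.
apply: lspan_sub; first exact: subspace_lspan.
move=> w [Nw [nu dnu wnu]].
have [->|w_neq0] := eqVneq w 0; first by case: (subspace_lspan A).
apply: sub_lspan; split=> //; exists nu => //.
apply: (weight_label (rho := rho) ex_index _ dnu _ wnu w_neq0) => [nu' []//|].
by apply: lspan_mono (top_box (Ntop _ Nw)) => u [].
Qed.

Let p_lower_span x : lspan (subalg_set p `|` munits (fun a b => prec b a)) x.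
Proof.
have := matrix_unit_span (@supported_all _ x); apply: lspan_mono => y.
case=> [/torus_levi/levi_sub|[a [b [ab _ _ _ ->]]]]; first by left.
have [ba|nba] := pselect (prec b a); first by right; exists a, b.
have [pab|nab] := pselect (prec a b).
  by left; apply: sub_lspan; right; apply: nilradical_munit.
left; apply: levi_sub; apply: sub_lspan; right; exists a, b.
split; [exact/eqP| |exact: munit_val].
by apply: (ord_class_incomparable adm) => -[].
Qed.

Lemma parabolic_generates (V : lmodType K) (sigma : lieRep g V) (N : set V) :
  stable sigma (subalg_set p) N ->
  stable sigma setT (generated sigma (munits (fun a b => prec b a)) N).
Proof.
move=> Np x w _; move: (p_lower_span x); apply: stable_lspan; first exact: subspace_generated.
move=> y u [py|]; last exact: generated_stable.
by apply: (generated_stable_complement (p := subalg_set p)) => // ? ? _ _; apply: p_lower_span.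
Qed.

Lemma simple_full (N : set W) : subspace N -> stable rho setT N ->
  (exists2 w, N w & w != 0) -> N = setT.
Proof.
move=> sN NT [w Nw w_neq0]; have [_ /(_ N)[]//] := rho_simple; first exact/submoduleE.
by move=> E; move: Nw w_neq0; rewrite E /= => ->; rewrite eqxx.
Qed.

(** A nonzero p-submodule N of top generates W; modulo N only weights below
    nu0 are added, so that v0 itself lies in N. *)
Lemma top_simple (N : set W) : subspace N -> N `<=` top ->
  stable rho (subalg_set p) N -> (exists2 w, N w & w != 0) -> top `<=` N.
Proof.
move=> sN Ntop Np [w Nw w_neq0]; apply: generated_sub => // _ ->.
have NT : stable rho (torus all_indices) N by move=> x u /torus_levi/levi_sub; apply: Np.
set B := N `&` weight_vectors rho all_indices same_weight.
have WB : setT `<=` lspan (B `|` (weight_vectors rho all_indices below_weight `&` setT)).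
  have E : generated rho (munits (fun a b => prec b a)) N = setT.
    apply: simple_full; [exact: subspace_generated|exact: parabolic_generates|].
    by exists w => //; apply: sub_generated.
  rewrite -{1}E; apply: (generated_weights (Base := same_weight)) => //.
  + by move=> nu a b; apply: below_weight_step.
  + by move=> u [].
  + exact: top_weights.
set A := _ `|` _ in WB.
have AC : A `<=` weight_vectors rho all_indices (same_weight `|` below_weight).
  by move=> u [[_ [nu ? ?]]|[[nu ? ?] _]]; exists nu => //; [left|right].
have Cd nu : (same_weight `|` below_weight) nu -> degree_weight all_indices d nu.
  by case=> [[]|[]].
have := weight_in_span ex_index AC Cd dnu0 (WB v0 I) v0_weight.
apply: (lspan_sub sN) => u [[[]//|[[nu nub unu] _]] uP].
have [->|u_neq0] := eqVneq u 0; first by case: sN.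
have [_ unu0] := uP u_neq0; case: (same_below same_weight0).
have [dnu _ _] := nub.
by rewrite -(weight_vector_unique ex_index u_neq0 dnu dnu0 unu unu0).
Qed.

Let topS : subspace_of W := SubspaceOf top_subspace.
Local Notation S := (subspace_sort topS).

Let valL : exists j : {linear S -> W}, j =1 val.
Proof. by apply: linear_exists. Qed.

Let l_stable : stable rho (subalg_set l) (subspace_set topS).
Proof. by move=> x w /levi_sub; apply: top_stable. Qed.

Let sigma : lieRep l S := restrict_rep l_stable.
Let tau : lieRep p S :=
  restrict_rep (top_stable : stable rho (subalg_set p) (subspace_set topS)).

Let v : S := SubspaceElt (mem_set top_v0 : v0 \in subspace_set topS).

Lemma sigma_simple : simple_module sigma.
Proof.
split; first by exists v; apply: contraNneq v0_neq0 => /(congr1 val) /= ->.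
move=> N [sN Nl]; have [[s [Ns s_neq0]]|nex] := pselect (exists s, N s /\ s != 0); last first.
  left; apply/seteqP; split=> s; last by move=> ->; case: sN.
  by move=> Ns; apply: contrapT => /eqP s_neq0; apply: nex; exists s.
right; apply/seteqP; split=> // t _.
pose N' : set W := [set val s | s in N].
have N'top : N' `<=` top by move=> _ [u _ <-]; apply: set_mem (valP u).
have sN' : subspace N'.
  split; first by exists 0 => //; case: sN.
  by move=> c _ _ [x Nx <-] [y Ny <-]; exists (c *: x + y) => //; case: sN => _; apply.
have N'l x w : subalg_set l x -> N' w -> N' (rho x w).
  by move=> lx [u Nu <-]; exists (sigma (SubalgElt (mem_set lx)) u) => //; apply: Nl.
have : top `<=` N'.
  apply: top_simple => //; last first.
    by exists (val s); [exists s|apply: contraNneq s_neq0 => E; apply/eqP/val_inj].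
  apply: stable_parabolic => //.
  - by move=> u /N'top/top_singular.
  - by move=> x w /torus_levi; apply: N'l.
  - move=> a b w clab ab; apply: N'l; apply: sub_lspan; right; exists a, b.
    by split; [apply/eqP| |apply: munit_val].
by move=> /(_ _ (set_mem (valP t)))[u Nu /val_inj <-].
Qed.

Lemma sigma_weight : weight_module (sub_in l (cartan K)) sigma.
Proof.
have [j jE] := valL.
have lift x : torus all_indices x -> exists y : sub_in l (cartan K), val (val y) = x.
  move=> xT; pose y : l := SubalgElt (mem_set (torus_levi xT)).
  have yP : subalg_set (sub_in l (cartan K)) y by apply/cartan_torus.
  by exists (SubalgElt (mem_set yP)).
have torusP (y : sub_in l (cartan K)) : torus all_indices (val (val y)).
  by apply/cartan_torus; apply: (set_mem (valP y)).
split.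
- apply/seteqP; split=> // s _; set A := \bigcup_lambda _.
  have : lspan [set val t | t in A] (val s).
    have := top_weights top_subspace top_torus (@subset_refl _ _) (set_mem (valP s)).
    apply: lspan_mono => w [wtop [nu nus wnu]].
    exists (SubspaceElt (mem_set wtop : w \in subspace_set topS)) => //.
    have [lam lamE] : exists lam : {scalar sub_in l (cartan K)},
        lam =1 fun x => weight_char nu (val (val x)).
      by apply: scalar_exists => a x y; apply: weight_char_linear.
    exists lam => // x; apply: val_inj; rewrite /= lamE.
    exact: (wnu _ (torusP x)).
  suff : lspan [set val t | t in A] `<=` [set val t | t in lspan A].
    by move=> /[apply] -[t At /val_inj <-].
  apply: lspan_sub => [|_ [t At <-]]; last by exists t => //; apply: sub_lspan.
  have [A0 AP] := subspace_lspan A; split; first by exists 0.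
  move=> c _ _ [x Ax <-] [y Ay <-]; exists (c *: x + y); last by [].
  exact: AP Ax Ay.
- move=> lam.
  pose chi x :=
    if pselect (torus all_indices x) is left xT then lam (projT1 (cid (lift x xT)))
    else 0.
  have [t tP] := schur_weight_space_finite hw chi.
  apply: (@finite_dim_sub _ _ _ j _ t).
  + by move=> x y; rewrite !jE; apply: val_inj.
  + split=> [x|a x y ex ey z]; first by rewrite rep_act0 scaler0.
    by rewrite rep_linearr ex ey scalerDr !scalerA mulrC.
  + move=> u uP; apply: tP => x xT; rewrite /chi; case: pselect => // xT'.
    case: cid => y /= yx; rewrite jE.
    by have /(congr1 val) /= := uP y; rewrite yx.
Qed.

Lemma tau_inflation : inflation sigma tau.
Proof.
split=> [x y s xy|x s xn]; apply: val_inj; rewrite /=; first by rewrite xy.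
by apply: (nilradical_zero top_singular) => //; apply: (set_mem (valP s)).
Qed.

(** A maximal submodule N not in the kernel maps onto v0. A preimage n of v0 in
    N has, besides a component of weight nu0, only components of other
    weights; the former lies in N and in 1 (x) S, so it is 1 (x) v0, which
    generates the induced module. *)
Lemma induced_quotient : is_unique_simple_quotient (induced_rep tau) rho.
Proof.
have [j jE] := valL.
have j_eq (x : p) s : j (tau x s) = rho (val x) (j s) by rewrite !jE.
have [f [f_eq f1]] := induced_map j_eq.
have img_sub (N : set (induced tau)) : submodule (induced_rep tau) N ->
    submodule rho [set f t | t in N].
  move=> [[N0 NP] Nst]; split; last first.
    by move=> x _ [t Nt <-]; exists (induced_rep tau x t); [apply: Nst|apply: f_eq].
  split; first by exists 0; rewrite ?linear0.
  by move=> c _ _ [x Nx <-] [y Ny <-]; exists (c *: x + y); [apply: NP|rewrite linearP].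
have ker_sub : submodule (induced_rep tau) (f @^-1` [set 0]).
  split; last by move=> x t /= ft; rewrite f_eq ft rep_act0.
  by split=> [|c t u /= ft fu]; rewrite /= ?linear0 // linearP ft fu scaler0 addr0.
have fv : f (induced_one tau v) = v0 by rewrite f1 jE.
have rangef : range f = setT.
  have [_ /(_ (range f))[]//] := rho_simple; first exact: (img_sub setT).
  move=> E; have : range f v0 by exists (induced_one tau v).
  by rewrite E /= => v00; move/eqP: v0_neq0.
have ker_proper : f @^-1` [set 0] <> setT.
  move=> E; have : (f @^-1` [set 0]) (induced_one tau v) by rewrite E.
  by rewrite /= fv => v00; move/eqP: v0_neq0.
have ker_max : maximal_submodule (induced_rep tau) (f @^-1` [set 0]).
  split=> // N Nsub kerN; have [_ /(_ _ (img_sub N Nsub))[E|E]] := rho_simple.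
    left; apply/seteqP; split=> // t Nt /=.
    have : [set f t | t in N] (f t) by exists t.
    by rewrite E.
  right; apply/seteqP; split=> // t _; have : [set f t | t in N] (f t) by rewrite E.
  move=> [u Nu fu]; rewrite -(subrK u t); have [sN _] := Nsub.
  by apply: subspaceD => //; apply: kerN; rewrite /= linearB fu subrr.
exists f; split=> // N [Nsub Nproper Nmax].
have [_ /(_ _ (img_sub N Nsub))[E|E]] := rho_simple.
  have Nker : N `<=` f @^-1` [set 0].
    move=> t Nt /=; have : [set f t | t in N] (f t) by exists t.
    by rewrite E.
  by case: (Nmax _ ker_sub Nker) => // /ker_proper.
case: Nproper; apply/seteqP; split=> // t0 _; move: t0.
have /submoduleE[sN Nst] := Nsub.
have NT : stable (induced_rep tau) (torus all_indices) N by move=> x u _; apply: Nst.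
(* Since v0 generates S over p, one vector 1 (x) v0 in N gives all of 1 (x) S. *)
suff N1 : N (induced_one tau v).
  apply: induced_generated => // s.
  pose N' : set W := [set val s | s in [set s | N (induced_one tau s)]].
  suff /(_ _ (set_mem (valP s)))[u Nu /val_inj <-] : top `<=` N' by [].
  apply: generated_sub; last by move=> _ ->; exists v.
    split; first by exists 0; rewrite //= induced_one0; case: sN.
    move=> c _ _ [x Nx <-] [y Ny <-]; exists (c *: x + y) => //=.
    by rewrite induced_one_linear; case: sN => _; apply.
  move=> x _ px [u /= Nu <-]; exists (tau (SubalgElt (mem_set px)) u) => //=.
  by rewrite -induced_act_one; apply: Nst.
pose one : set (induced tau) := range (induced_one tau).
have one_sub : subspace one.
  split; first by exists 0; rewrite ?induced_one0.
  by move=> c _ _ [x _ <-] [y _ <-]; exists (c *: x + y); rewrite ?induced_one_linear.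
pose B := [set induced_one tau s | s in
  [set s | weight_vectors rho all_indices same_weight (val s)]].
have BW : B `<=` weight_vectors (induced_rep tau) all_indices same_weight.
  move=> _ [s [nu nus snu] <-]; exists nu => // x xT.
  have px : subalg_set p x by apply: levi_sub; apply: torus_levi.
  have -> : induced_rep tau x (induced_one tau s) =
      induced_one tau (tau (SubalgElt (mem_set px)) s).
    exact: (induced_act_one tau (SubalgElt (mem_set px)) s).
  have -> : tau (SubalgElt (mem_set px)) s = weight_char nu x *: s.
    by apply: val_inj; rewrite /= snu.
  by rewrite -[_ *: s]addr0 induced_one_linear induced_one0 addr0.
have oneB : one `<=` lspan B.
  move=> _ [s _ <-].
  have := top_weights top_subspace top_torus (@subset_refl _ _) (set_mem (valP s)).
  suff /[apply] : lspan (top `&` weight_vectors rho all_indices same_weight) `<=`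
      [set val s | s in [set s | lspan B (induced_one tau s)]].
    by move=> [u Bu /val_inj <-].
  have [B0 BP] := subspace_lspan B; apply: lspan_sub.
    split; first by exists 0; rewrite //= induced_one0.
    move=> c _ _ [x Bx <-] [y By <-]; exists (c *: x + y) => //=.
    by rewrite induced_one_linear; apply: BP.
  move=> w [tw wW]; exists (SubspaceElt (mem_set tw : w \in subspace_set topS)) => //=.
  by apply: sub_lspan; exists (SubspaceElt (mem_set tw : w \in subspace_set topS)).
have one_p : stable (induced_rep tau) (subalg_set p) one.
  move=> x _ px [s _ <-]; exists (tau (SubalgElt (mem_set px)) s) => //.
  by rewrite -induced_act_one.
set A := B `|` (weight_vectors (induced_rep tau) all_indices below_weight `&` setT).
have spanA t : lspan A t.
  have : generated (induced_rep tau) (munits (fun a b => prec b a)) one t.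
    apply: induced_generated; first exact: subspace_generated.
      exact: parabolic_generates.
    by move=> s; apply: sub_generated; exists s.
  apply: (generated_weights (Base := same_weight)) => //.
  by move=> nu a b; apply: below_weight_step.
have AC : A `<=` weight_vectors (induced_rep tau) all_indices (same_weight `|` below_weight).
  by move=> u [/BW[nu ? ?]|[[nu ? ?] _]]; exists nu => //; [left|right].
have AT u : A u -> exists chi, eigen (induced_rep tau) (torus all_indices) chi u.
  by move=> /AC[nu _ unu]; exists (weight_char nu).
have [n Nn fn] : [set f t | t in N] v0 by rewrite E.
have [n0 [s [n0A sP nE]]] := eigen_split (weight_char nu0) AT (spanA n).
have n0_eigen : weight_vector (induced_rep tau) all_indices nu0 n0.
  by move: n0A; apply: lspan_sub; [exact: eigen_subspace|move=> ? []].
have Nn0 : N n0 by apply: (eigen_separation sN NT n0_eigen sP); rewrite -nE.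
have f_eigen chi u : eigen (induced_rep tau) (torus all_indices) chi u ->
    eigen rho (torus all_indices) chi (f u).
  by move=> eu x xT; rewrite -f_eq eu // linearZ.
(* The images of the other components have weights different from nu0. *)
have fn0 : f n0 = v0.
  apply/eqP; rewrite -subr_eq0; apply/eqP.
  apply: (@eigen_separation _ _ _ rho (torus all_indices) [set 0]
    (weight_char nu0) _ [seq f y | y <- s]).
  - exact: subspace_set0.
  - by move=> x u _ /= ->; rewrite rep_act0.
  - apply: (subspaceB (eigen_subspace _ _ _)) => //; exact: f_eigen.
  - by move=> _ /mapP[u /sP[chi eu ne] ->]; exists chi => //; apply: f_eigen.
  - rewrite /= big_map -linear_sum addrAC -linearD -nE fn; exact: subrr.
(* No vector of below_weight has the weight nu0. *)
have [s' _ n0E] : one n0.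
  move: n0A; apply: lspan_sub => // u [[[s' _ <-] _|[[nu nub unu] _] unu0]]; first by exists s'.
  have [->|u_neq0] := eqVneq u 0; first by case: one_sub.
  case: (same_below same_weight0); have [dnu _ _] := nub.
  by rewrite -(weight_vector_unique ex_index u_neq0 dnu dnu0 unu unu0).
suff <- : s' = v by rewrite n0E.
by apply: val_inj; rewrite /= -fn0 -n0E f1 jE.
Qed.

Lemma singular_aligned : aligned adm rho.
Proof.
split=> //; last first.
  exists (subspace_sort topS), sigma, tau; split.
  - exact: sigma_simple.
  - exact: sigma_weight.
  - exact: tau_inflation.
  - exact: induced_quotient.
have lift x : torus all_indices x -> exists y : cartan K, val y = x.
  by move=> /cartan_torus xh; exists (SubalgElt (mem_set xh)).
split.
- apply/seteqP; split=> // w _; apply: lspan_mono (schur_weights_span hw (I : setT w)).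
  move=> u [nu _ unu].
  have [lam lamE] : exists lam : {scalar cartan K}, lam =1 fun x => weight_char nu (val x).
    by apply: scalar_exists => a x y; apply: weight_char_linear.
  by exists lam => // x; rewrite lamE; apply: unu; apply/cartan_torus/(set_mem (valP x)).
- move=> lam.
  pose chi x :=
    if pselect (torus all_indices x) is left xT then lam (projT1 (cid (lift x xT)))
    else 0.
  have [t tP] := schur_weight_space_finite hw chi.
  apply: (@finite_dim_sub _ _ _ idfun _ t) => //.
  + split=> [x|a x y ex ey z]; first by rewrite rep_act0 scaler0.
    by rewrite rep_linearr ex ey scalerDr !scalerA mulrC.
  + move=> u uP; apply: tP => x xT; rewrite /chi; case: pselect => // xT'.
    by case: cid => y /= <-; apply: uP.
Qed.

End SingularAligned.

Theorem proposition3p7 (R : realType) (k : nat) (mu : k.+1.-tuple nat)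
    (hmu : is_partition mu)
    (prec : nat -> nat -> Prop) (adm : admissible prec)
    (W : lmodType R[i]) (rho : lieRep (slinf R[i]) W)
    (hW : is_schur_module mu rho) :
  aligned adm rho <->
  exists i : 'I_k.+1 -> nat,
    [/\ injective i,
        forall j l : 'I_k.+1, prec (i j) (i l) -> (j < l)%N &
        forall m : nat, (forall j : 'I_k.+1, m <> i j) ->
          prec (i ord_max) m \/
          exists j : 'I_k.+1, ~ prec_comparable prec m (i j)].
Proof.
have [rho_simple [w0 hw]] := schur_highest_weight hmu hW.
have sz : size mu = k.+1 := size_tuple mu.
apply: iff_trans _ (iff_sym (initial_list_condition adm k)).
split=> [/aligned_singular[w ws w_neq0]|[s [us ss s_init]]].
  by have := singular_initial_list hmu hw adm ws w_neq0; rewrite sz.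
have [nu [v [dnu v0 vnu v_kill]]] := schur_extremal_vector hw us (etrans ss (esym sz)).
apply: (singular_aligned hw rho_simple adm dnu v0 vnu) => a b ab.
by apply: v_kill => bs; apply: s_init.
Qed.
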